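(* Let $\varphi:\mathbb{D}\to\mathbb{D}$ be a parabolic holomorphic self-map of zero hyperbolic step. Then the map $$\mathcal{Z}_{\forall}(\varphi)\ni\psi\mapsto c_{\varphi,\psi}\in\mathbb{C}$$ is a homeomorphism onto a closed subset $\mathcal{A}_\varphi\subset\mathbb{C}$. Moreover, $$c_{\varphi,\psi_1\circ\psi_2}=c_{\varphi,\psi_1}+c_{\varphi,\psi_2}\quad\text{for any }\psi_1,\psi_2\in\mathcal{Z}_{\forall}(\varphi)$$ and, as a consequence, $[\mathcal{A}_\varphi,+]$ is an additive semigroup containing $\mathbb{N}_0=\{0,1,2,\dots\}$.
   Context: $\mathbb{D}=\{z\in\mathbb{C}:|z|<1\}$, and $\rho_{\mathbb{D}}$ denotes the hyperbolic distance in $\mathbb{D}$. The centralizer of $\varphi$ is $\mathcal{Z}_{\forall}(\varphi)=\{\psi:\mathbb{D}\to\mathbb{D}\text{ holomorphic}:\psi\circ\varphi=\varphi\circ\psi\}$, endowed with the topology of locally uniform convergence in $\mathbb{D}$. A holomorphic self-map $\varphi$ of $\mathbb{D}$ is parabolic if its iterates converge locally uniformly to a point $\tau\in\partial\mathbb{D}$ (its Denjoy–Wolff point) and the angular derivative satisfies $\varphi'(\tau)=1$. It is of zero hyperbolic step if $\lim_{n\to\infty}\rho_{\mathbb{D}}(\varphi^{\circ n}(z),\varphi^{\circ(n+1)}(z))=0$ for some (equivalently, all) $z\in\mathbb{D}$. Koenigs function (parabolic, zero hyperbolic step): $h_\varphi$ is the unique holomorphic function $h:\mathbb{D}\to\mathbb{C}$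 with $h(0)=0$ such that $h\circ\varphi=h+1$, $\mathbb{C}=\bigcup_{n\ge0}(h(\mathbb{D})-n)$, and $h$ is injective on some $\varphi$-absorbing domain, i.e. a domain $V\subset\mathbb{D}$ with $\varphi(V)\subset V$ and $\mathbb{D}=\bigcup_{n\in\mathbb{N}}(\varphi^{\circ n})^{-1}(V)$. Simultaneous linearization coefficient: for $\varphi$ parabolic of zero hyperbolic step and $\psi\in\mathcal{Z}_{\forall}(\varphi)$, the function $h_\varphi\circ\psi-h_\varphi$ is constant; $c_{\varphi,\psi}\in\mathbb{C}$ denotes this constant, so $h_\varphi\circ\psi=h_\varphi+c_{\varphi,\psi}$. *)

(* Defs.v *)
From Stdlib Require Import Reals Lra.
From Coquelicot Require Import Coquelicot.

Open Scope R_scope.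

(** * Topology *)

Lemma pullback_ball_center (T : Type) (U : UniformSpace) (f : T -> U)
  (x : T) (e : posreal) : ball (f x) e (f x).
Proof. apply ball_center. Qed.

Lemma pullback_ball_sym (T : Type) (U : UniformSpace) (f : T -> U)
  (x y : T) (e : R) : ball (f x) e (f y) -> ball (f y) e (f x).
Proof. apply ball_sym. Qed.

Lemma pullback_ball_triangle (T : Type) (U : UniformSpace) (f : T -> U)
  (x y z : T) (e1 e2 : R) :
  ball (f x) e1 (f y) -> ball (f y) e2 (f z) -> ball (f x) (e1 + e2) (f z).
Proof. apply ball_triangle. Qed.

(** The initial uniform structure of [f : T -> U]; for an inclusion [f] it is
    the subspace structure.  Coquelicot's uniform spaces are pointed, whence
    [x0]. *)
Definition pullback_UniformSpace (T : Type) (U : UniformSpace) (f : T -> U)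
  (x0 : T) : UniformSpace :=
  UniformSpace.Pack T
    (UniformSpace.Mixin T x0 (fun x e y => ball (f x) e (f y))
       (pullback_ball_center T U f) (pullback_ball_sym T U f)
       (pullback_ball_triangle T U f)) T.

Definition connected_set {T : UniformSpace} (A : T -> Prop) : Prop :=
  forall U1 U2 : T -> Prop,
    open U1 -> open U2 ->
    (forall x, A x -> U1 x \/ U2 x) ->
    (exists x, A x /\ U1 x) -> (exists x, A x /\ U2 x) ->
    exists x, A x /\ U1 x /\ U2 x.

Definition is_domain {T : UniformSpace} (A : T -> Prop) : Prop :=
  (exists x, A x) /\ open A /\ connected_set A.

Definition homeomorphism_onto {X Y : UniformSpace} (f : X -> Y)
  (A : Y -> Prop) : Prop :=
  (forall x, A (f x)) /\
  (forall x, continuous f x) /\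
  exists g : Y -> X,
    (forall x, g (f x) = x) /\
    (forall y, A y -> f (g y) = y) /\
    continuous_on A g.

(** * The unit disc *)

Definition disk : Type := {z : C | Cmod z < 1}.
Definition disk_val (z : disk) : C := proj1_sig z.
Coercion disk_val : disk >-> C.

Lemma disk0_lt : Cmod 0 < 1.
Proof. rewrite Cmod_0; lra. Qed.

Definition disk0 : disk := exist _ (RtoC 0) disk0_lt.

Canonical disk_UniformSpace : UniformSpace :=
  pullback_UniformSpace disk C_UniformSpace disk_val disk0.

Definition holomorphic (f : disk -> C) : Prop :=
  exists F : C -> C,
    (forall z : disk, f z = F z) /\
    (forall z : disk, ex_derive F (disk_val z)).

Definition holomorphic_self_map (f : disk -> disk) : Prop :=
  holomorphic (fun z => f z).

(** A normalization by another constant factor (curvature -1 instead of -4)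
    would not affect [zero_hyperbolic_step]. *)
Definition hyperbolic_dist (z w : disk) : R :=
  let t := Cmod (z - w) / Cmod (1 - Cconj w * z) in
  / 2 * ln ((1 + t) / (1 - t)).

(** * Locally uniform convergence *)

(** The functions [disk -> C], under a name of their own so that they do not
    receive Coquelicot's structure of globally uniform convergence. *)
Definition locunif_fun : Type := disk -> C.

Definition locunif_ball (f : locunif_fun) (e : R) (g : locunif_fun) : Prop :=
  forall z : disk, Cmod z <= 1 - e -> Cmod (g z - f z) < e.

Lemma locunif_ball_center (f : locunif_fun) (e : posreal) : locunif_ball f e f.
Proof.
intros z _; replace (f z - f z)%C with (RtoC 0) by ring.
rewrite Cmod_0; apply cond_pos.
Qed.

Lemma locunif_ball_sym (f g : locunif_fun) (e : R) :
  locunif_ball f e g -> locunif_ball g e f.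
Proof.
intros H z Hz; replace (f z - g z)%C with (- (g z - f z))%C by ring.
rewrite Cmod_opp; exact (H z Hz).
Qed.

Lemma locunif_ball_nonneg (f g : locunif_fun) (e : R) :
  e <= 1 -> locunif_ball f e g -> 0 < e.
Proof.
intros He H; apply Rle_lt_trans with (1 := Cmod_ge_0 (g disk0 - f disk0)).
apply H; simpl; rewrite Cmod_0; lra.
Qed.

Lemma locunif_ball_triangle (f g h : locunif_fun) (e1 e2 : R) :
  locunif_ball f e1 g -> locunif_ball g e2 h -> locunif_ball f (e1 + e2) h.
Proof.
intros H1 H2 z Hz.
assert (Pe1 : 0 < e1).
{ destruct (Rle_lt_dec e1 1) as [L | L]; [| lra].
  exact (locunif_ball_nonneg f g e1 L H1). }
assert (Pe2 : 0 < e2).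
{ destruct (Rle_lt_dec e2 1) as [L | L]; [| lra].
  exact (locunif_ball_nonneg g h e2 L H2). }
replace (h z - f z)%C with ((h z - g z) + (g z - f z))%C by ring.
apply Rle_lt_trans with (1 := Cmod_triangle _ _).
assert (A1 := H1 z ltac:(lra)); assert (A2 := H2 z ltac:(lra)); lra.
Qed.

Canonical locunif_UniformSpace : UniformSpace :=
  UniformSpace.Pack locunif_fun
    (UniformSpace.Mixin locunif_fun (fun _ => RtoC 0) locunif_ball
       locunif_ball_center locunif_ball_sym locunif_ball_triangle) locunif_fun.

(** Convergence in [locunif_UniformSpace] is uniform convergence on the closed
    discs of radius [r < 1], which exhaust the compact subsets of the disc. *)
Lemma filterlim_locunif (T : Type) (F : (T -> Prop) -> Prop) (FF : Filter F)
  (u : T -> locunif_fun) (f : locunif_fun) :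
  filterlim u F (locally f) <->
  forall r eps : R, r < 1 -> 0 < eps ->
    F (fun t => forall z : disk, Cmod z <= r -> Cmod (u t z - f z) < eps).
Proof.
split.
- intros H r eps Hr Heps.
  assert (Hd : 0 < Rmin (1 - r) eps) by (apply Rmin_pos; lra).
  assert (L : locally f (locunif_ball f (Rmin (1 - r) eps))).
  { exists (mkposreal _ Hd); intros g Hg; exact Hg. }
  generalize (H _ L : F (fun t => locunif_ball f (Rmin (1 - r) eps) (u t))).
  apply filter_imp; intros t Ht z Hz.
  assert (A := Rmin_l (1 - r) eps); assert (B := Rmin_r (1 - r) eps).
  apply Rlt_le_trans with (2 := B); apply Ht; lra.
- intros H P [e He].
  assert (He1 : 1 - e < 1) by (assert (A := cond_pos e); lra).
  unfold filtermap; generalize (H (1 - e) e He1 (cond_pos e)); apply filter_imp.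
  intros t Ht; apply He; exact Ht.
Qed.

(** * Parabolic self-maps of zero hyperbolic step *)

Definition stolz_filter (tau : C) (M : R) (P : disk -> Prop) : Prop :=
  locally tau (fun w : C => forall z : disk,
    disk_val z = w -> Cmod (z - tau) < M * (1 - Cmod z) -> P z).

Definition angular_limit (tau : C) (f : disk -> C) (l : C) : Prop :=
  forall M : R, 1 < M -> filterlim f (stolz_filter tau M) (locally l).

Definition angular_derivative (phi : disk -> disk) (tau a : C) : Prop :=
  exists sigma : C,
    angular_limit tau (fun z => phi z) sigma /\
    angular_limit tau (fun z => ((phi z - sigma) / (z - tau))%C) a.

Definition denjoy_wolff_boundary (phi : disk -> disk) (tau : C) : Prop :=
  Cmod tau = 1 /\
  filterlim (fun n => (fun z => disk_val (Nat.iter n phi z)) : locunif_fun)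
    eventually (locally ((fun _ => tau) : locunif_fun)).

Definition parabolic (phi : disk -> disk) : Prop :=
  holomorphic_self_map phi /\
  exists tau : C,
    denjoy_wolff_boundary phi tau /\ angular_derivative phi tau 1.

Definition zero_hyperbolic_step (phi : disk -> disk) : Prop :=
  exists z : disk,
    is_lim_seq
      (fun n => hyperbolic_dist (Nat.iter n phi z) (Nat.iter (S n) phi z)) 0.

(** * Koenigs function *)

Definition absorbing_domain (phi : disk -> disk) (V : disk -> Prop) : Prop :=
  is_domain V /\
  (forall z, V z -> V (phi z)) /\
  (forall z, exists n : nat, V (Nat.iter n phi z)).

Definition koenigs_function (phi : disk -> disk) (h : disk -> C) : Prop :=
  holomorphic h /\
  h disk0 = 0 /\
  (forall z, h (phi z) = (h z + 1)%C) /\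
  (forall w : C, exists (n : nat) (z : disk), w = (h z - INR n)%C) /\
  exists V : disk -> Prop,
    absorbing_domain phi V /\
    forall z1 z2, V z1 -> V z2 -> h z1 = h z2 -> z1 = z2.

(** * Centralizer and simultaneous linearization coefficient *)

Definition in_centralizer (phi psi : disk -> disk) : Prop :=
  holomorphic_self_map psi /\ forall z, psi (phi z) = phi (psi z).

Definition centralizer (phi : disk -> disk) : Type :=
  {psi : disk -> disk | in_centralizer phi psi}.

Definition centralizer_fun (phi : disk -> disk) (psi : centralizer phi) :
  disk -> disk := proj1_sig psi.
Coercion centralizer_fun : centralizer >-> Funclass.

Lemma in_centralizer_id (phi : disk -> disk) : in_centralizer phi (fun z => z).
Proof.
split; [| reflexivity].
exists (fun z => z); split; [reflexivity |].
intros z; exists (RtoC 1); split; [apply is_linear_scal_l |].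
intros x _ eps; apply filter_forall; intros y.
match goal with |- norm ?v <= _ => replace v with (@zero C_NormedModule) end.
- rewrite norm_zero; apply Rmult_le_pos; [apply Rlt_le, cond_pos | apply norm_ge_0].
- change (RtoC 0 = (y - x) - (y - x) * RtoC 1)%C; ring.
Qed.

Canonical centralizer_UniformSpace (phi : disk -> disk) : UniformSpace :=
  pullback_UniformSpace (centralizer phi) locunif_UniformSpace
    (fun psi => (fun z => disk_val (psi z)) : locunif_fun)
    (exist _ (fun z => z) (in_centralizer_id phi)).

(** The constant [c] with [h o psi = h + c]. *)
Definition lin_coef (h : disk -> C) (psi : disk -> disk) : C :=
  iota (fun c : C_CompleteNormedModule => forall z, h (psi z) = (h z + c)%C).

Lemma lin_coef_eq (h : disk -> C) (psi : disk -> disk) (c : C) :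
  (forall z, h (psi z) = (h z + c)%C) -> lin_coef h psi = c.
Proof.
intros Hc; apply (iota_unique (K := C_AbsRing) (V := C_CompleteNormedModule)).
- intros d Hd.
  assert (E : forall u v : C, v = ((u + v) - u)%C) by (intros u v; ring).
  rewrite (E (h disk0) d), (E (h disk0) c), <- Hd, <- Hc; reflexivity.
- exact Hc.
Qed.

Definition coef_set (phi : disk -> disk) (h : disk -> C) (c : C) : Prop :=
  exists psi : centralizer phi, c = lin_coef h psi.

(* Main.v *)
Require Import Defs.
From Stdlib Require Import Reals Lra Lia Psatz Classical ClassicalEpsilon FunctionalExtensionality.
From Coquelicot Require Import Coquelicot.

(** Let [s] be the inverse of [h] on the absorbing domain [V]. Since [h V] contains discs of
    any radius, [s] contracts hyperbolic distances on far translates of a fixed disc, so any two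
    orbits of [phi] merge hyperbolically; hence a commuting [psi] moves the points
    [phi^n 0 -> tau] by a distance tending to [0]. By Julia's inequality [P o psi - P] has
    nonnegative real part, [P] being the Cayley transform with pole [tau], and Harnack's
    inequality makes [psi] injective on pairs of points of two merged orbits. Therefore
    [h o psi = g o h] with [g] entire, injective and [g (w + 1) = g w + 1], so that [g] is a
    translation by some [c].

    Conversely, on a fixed small disc, which depends only on a bound for [c], the identity
    theorem gives [psi = s o (h + c)]. So [psi] depends Lipschitz continuously on [c] there, and a
    quantitative Vitali theorem propagates this to all compact sets. This gives injectivity,
    continuity of the inverse and closedness of the image. *)

(** * Complex differentiability *)

(** The relation [g (w + 1) = g w + 1] alone also admits entire functions such as
    [w + sin (2 * PI * w)], so everything hinges on the injectivity of [g], although neither [h] nor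
    [psi] is known to be injective on the disc. It suffices to treat late points of orbits: if
    [h (psi x) = h (psi y)], then [psi] takes equal values at [phi^n x] and [phi^n y] for large [n],
    when these points are already hyperbolically close to each other and to their images. Julia's
    inequality holds with constant 1 because two points at vanishing hyperbolic distance have
    asymptotically equal distances to the unit circle. If [psi x = psi y], then [P o psi - P] varies
    between [x] and [y] exactly as much as [P] does, while Harnack allows only a fraction of this.
    In the second half normal families are replaced by explicit estimates, uniform over bounded sets
    of coefficients, so that a single estimate yields injectivity, continuity of the inverse and
    closedness of the image. *)

Lemma is_derive_C (f : C -> C) (z l : C) :
  is_derive f z l <->
  forall eps, 0 < eps -> exists del, 0 < del /\ forall w : C, Cmod (w - z) < del ->
    Cmod (f w - f z - l * (w - z)) <= eps * Cmod (w - z).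
Proof.
split.
- intros [_ H] eps He.
  assert (L : is_filter_lim (locally (T := AbsRing_UniformSpace C_AbsRing) z) z) by (intros P HP; exact HP).
  destruct (H z L (mkposreal _ He)) as [d Hd].
  exists d; split; [apply cond_pos | intros w Hw].
  assert (E := Hd w Hw).
  change (Cmod ((f w - f z) - (w - z) * l) <= eps * Cmod (w - z)) in E.
  replace (l * (w - z))%C with ((w - z) * l)%C by ring; exact E.
- intros H; split; [apply is_linear_scal_l |].
  intros y Hy eps.
  assert (Ey : z = y) 
    by exact (is_filter_lim_locally_unique (V := AbsRing_NormedModule C_AbsRing) z y Hy).
  subst y.
  destruct (H eps (cond_pos eps)) as [d [Hd K]].
  exists (mkposreal d Hd); intros w Hw.
  assert (E := K w Hw).
  change (Cmod ((f w - f z) - (w - z) * l) <= eps * Cmod (w - z)).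
  replace ((w - z) * l)%C with (l * (w - z))%C by ring; exact E.
Qed.

(** On [C] Coquelicot has two normed-module structures, [C_NormedModule] and the one of
    [C_AbsRing] over itself, which do not unify. *)
Lemma is_derive_C_swap (f : C -> C) (z l : C) :
  is_derive f z l <-> is_derive (V := AbsRing_NormedModule C_AbsRing) f z l.
Proof. split; intros [_ H]; (split; [apply is_linear_scal_l | exact H]). Qed.

(** The balls of [C_UniformSpace] are squares, being balls of a product, but they generate the same
    neighbourhoods as the discs. *)
Lemma locally_C_disc (z : C) (P : C -> Prop) :
  locally (T := C_UniformSpace) z P <->
  exists d, 0 < d /\ forall w : C, Cmod (w - z) < d -> P w.
Proof.
split.
- intros H; destruct (proj1 (locally_C z P) H) as [d Hd].
  exists d; split; [apply cond_pos | intros w Hw; apply Hd, Hw].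
- intros [d [Hd H]]; apply locally_C; exists (mkposreal d Hd); intros w Hw; apply H, Hw.
Qed.

Lemma continuous_C (f : C -> C) (z : C) :
  continuous f z <->
  forall eps, 0 < eps -> exists del, 0 < del /\ forall w : C, Cmod (w - z) < del ->
    Cmod (f w - f z) < eps.
Proof.
split.
- intros H eps He.
  assert (L : locally (T := C_UniformSpace) (f z) (fun y : C => Cmod (y - f z) < eps)).
  { apply locally_C_disc; exists eps; split; [exact He | intros w Hw; exact Hw]. }
  exact (proj1 (locally_C_disc _ _) (H _ L)).
- intros H P HP.
  destruct (proj1 (locally_C_disc _ _) HP) as [e [He K]].
  destruct (H e He) as [d [Hd L]].
  apply locally_C_disc; exists d; split; [exact Hd | intros w Hw; apply K, L, Hw].
Qed.

Lemma Cmod_sub_sym (x y : C) : Cmod (x - y) = Cmod (y - x).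
Proof. rewrite <- Cmod_opp; f_equal; ring. Qed.

Lemma Cmod_sub_self (x : C) : Cmod (x - x) = 0.
Proof. replace (x - x)%C with (RtoC 0) by ring; apply Cmod_0. Qed.

Lemma Cmod_sub_triangle (x y z : C) : Cmod (x - z) <= Cmod (x - y) + Cmod (y - z).
Proof. replace (x - z)%C with ((x - y) + (y - z))%C by ring; apply Cmod_triangle. Qed.

Lemma Cmod_sub_ge (x y : C) : Cmod x - Cmod y <= Cmod (x - y).
Proof.
  assert (H := Cmod_triangle (x - y) y).
  replace (x - y + y)%C with x in H by ring; lra.
Qed.

Lemma Cmod_sub_le (x y : C) : Cmod (x - y) <= Cmod x + Cmod y.
Proof. rewrite <- (Cmod_opp y); apply Cmod_triangle. Qed.

Lemma Cmod_sub_eq_0 (x y : C) : Cmod (x - y) <= 0 -> x = y.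
Proof.
  intros H; assert (E : (x - y)%C = 0).
  { apply Cmod_eq_0, Rle_antisym; [exact H | apply Cmod_ge_0]. }
  replace x with ((x - y) + y)%C by ring; rewrite E; ring.
Qed.

Lemma Csub_neq_0 (x y : C) : x <> y -> (x - y)%C <> 0.
Proof.
  intros H E; apply H; replace x with ((x - y) + y)%C by ring; rewrite E; ring.
Qed.

Lemma Cmod_sub_pos (x y : C) : x <> y -> 0 < Cmod (x - y).
Proof. intros H; apply Cmod_gt_0, Csub_neq_0, H. Qed.

Lemma is_derive_C_plus (f g : C -> C) (z a b : C) :
  is_derive f z a -> is_derive g z b -> is_derive (fun w => f w + g w)%C z (a + b)%C.
Proof. intros Hf Hg; exact (is_derive_plus f g z a b Hf Hg). Qed.

Lemma is_derive_C_mult (f g : C -> C) (z a b : C) :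
  is_derive f z a -> is_derive g z b ->
  is_derive (fun w => f w * g w)%C z (a * g z + f z * b)%C.
Proof.
  intros Hf Hg.
  apply is_derive_C_swap in Hf; apply is_derive_C_swap in Hg; apply is_derive_C_swap.
  exact (is_derive_mult (K := C_AbsRing) f g z a b Hf Hg Cmult_comm).
Qed.

Lemma is_derive_C_comp (f g : C -> C) (z a b : C) :
  is_derive f (g z) a -> is_derive g z b -> is_derive (fun w => f (g w)) z (b * a)%C.
Proof. intros Hf Hg; apply is_derive_C_swap in Hg.
  exact (is_derive_comp (K := C_AbsRing) f g z a b Hf Hg). Qed.

Lemma is_derive_C_const (c z : C) : is_derive (fun _ : C => c) z (RtoC 0).
Proof. exact (is_derive_const (K := C_AbsRing) (V := C_NormedModule) c z). Qed.

Lemma is_derive_C_id (z : C) : is_derive (fun w : C => w) z (RtoC 1).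
Proof. apply is_derive_C_swap; exact (is_derive_id (K := C_AbsRing) z). Qed.

Lemma is_derive_C_inv (z : C) : z <> 0 -> is_derive (fun w : C => / w)%C z (- / (z * z))%C.
Proof.
  intros Hz; apply is_derive_C; intros eps He.
  assert (Pz := proj1 (Cmod_gt_0 z) Hz).
  set (m := Cmod z) in *.
  (* The remainder is [(w - z)^2 / (w * (z * z))], and for [Cmod (w - z) < m / 2] its denominator
     has modulus at least [m * m * m / 2]. *)
  assert (Pm : 0 < m * m * m / 2) by (apply Rdiv_lt_0_compat; [repeat apply Rmult_lt_0_compat; lra | lra]).
  exists (Rmin (m / 2) (eps * (m * m * m / 2))); split.
  { apply Rmin_pos; [lra | apply Rmult_lt_0_compat; lra]. }
  intros w Hw.
  destruct (Rmin_Rgt_l _ _ _ Hw) as [H1 H2].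
  assert (Hm : m / 2 <= Cmod w).
  { assert (A := Cmod_sub_ge z w); rewrite Cmod_sub_sym in A; fold m in A; lra. }
  assert (Hw0 : w <> 0) by (apply Cmod_gt_0; lra).
  replace (/ w - / z - - / (z * z) * (w - z))%C
    with ((w - z) * (w - z) * / (w * (z * z)))%C by (field; split; assumption).
  rewrite !Cmod_mult, Cmod_inv by (repeat apply Cmult_neq_0; assumption).
  rewrite !Cmod_mult; fold m.
  assert (K : Cmod (w - z) * / (Cmod w * (m * m)) <= eps).
  { apply Rmult_le_reg_r with (Cmod w * (m * m)).
    { repeat apply Rmult_lt_0_compat; lra. }
    rewrite Rmult_assoc, Rinv_l, Rmult_1_r.
    2: apply Rgt_not_eq; repeat apply Rmult_lt_0_compat; lra.
    assert (eps * (m * m * m / 2) <= eps * (Cmod w * (m * m))).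
    { apply Rmult_le_compat_l; [lra |].
      replace (m * m * m / 2) with (m / 2 * (m * m)) by field.
      apply Rmult_le_compat_r; [nra | lra]. }
    lra. }
  rewrite Rmult_assoc, Rmult_comm.
  apply Rmult_le_compat_r; [apply Cmod_ge_0 | exact K].
Qed.

Lemma ex_derive_C_plus (f g : C -> C) (z : C) :
  ex_derive f z -> ex_derive g z -> ex_derive (fun w => f w + g w)%C z.
Proof. intros [a Ha] [b Hb]; eexists; apply is_derive_C_plus; eassumption. Qed.

Lemma ex_derive_C_mult (f g : C -> C) (z : C) :
  ex_derive f z -> ex_derive g z -> ex_derive (fun w => f w * g w)%C z.
Proof. intros [a Ha] [b Hb]; eexists; apply is_derive_C_mult; eassumption. Qed.

Lemma ex_derive_C_comp (f g : C -> C) (z : C) :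
  ex_derive f (g z) -> ex_derive g z -> ex_derive (fun w => f (g w)) z.
Proof. intros [a Ha] [b Hb]; eexists; apply is_derive_C_comp; eassumption. Qed.

Lemma ex_derive_C_const (c z : C) : ex_derive (fun _ : C => c) z.
Proof. eexists; apply is_derive_C_const. Qed.

Lemma ex_derive_C_id (z : C) : ex_derive (fun w : C => w) z.
Proof. eexists; apply is_derive_C_id. Qed.

Lemma ex_derive_C_minus (f g : C -> C) (z : C) :
  ex_derive f z -> ex_derive g z -> ex_derive (fun w => f w - g w)%C z.
Proof. exact (ex_derive_minus f g z). Qed.

Lemma ex_derive_C_inv (f : C -> C) (z : C) :
  ex_derive f z -> f z <> 0 -> ex_derive (fun w => / f w)%C z.
Proof.
  intros H Hz; apply (ex_derive_C_comp Cinv f); [eexists; apply is_derive_C_inv, Hz | exact H].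
Qed.

Lemma ex_derive_C_div (f g : C -> C) (z : C) :
  ex_derive f z -> ex_derive g z -> g z <> 0 -> ex_derive (fun w => f w / g w)%C z.
Proof. intros Hf Hg Hz; apply ex_derive_C_mult, ex_derive_C_inv; assumption. Qed.

Lemma ex_derive_C_pow (f : C -> C) (n : nat) (z : C) :
  ex_derive f z -> ex_derive (fun w => (f w) ^ n)%C z.
Proof.
  intros H; induction n as [| n IH]; simpl.
  - apply ex_derive_C_const.
  - apply ex_derive_C_mult; assumption.
Qed.

Lemma ex_derive_C_eq_near (f g : C -> C) (z : C) (d : R) :
  0 < d -> (forall w : C, Cmod (w - z) < d -> f w = g w) -> ex_derive f z -> ex_derive g z.
Proof.
  intros Hd E; apply (ex_derive_ext_loc (K := C_AbsRing) (V := C_NormedModule)).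
  exists (mkposreal d Hd); intros w Hw; apply E, Hw.
Qed.

Lemma ex_derive_C_continuous (f : C -> C) (z : C) :
  ex_derive f z ->
  forall eps, 0 < eps -> exists del, 0 < del /\ forall w : C, Cmod (w - z) < del ->
    Cmod (f w - f z) < eps.
Proof.
  intros [l H] eps He.
  destruct (proj1 (is_derive_C f z l) H 1 Rlt_0_1) as [d [Hd K]].
  assert (Pl := Cmod_ge_0 l).
  assert (P : 0 < eps / (Cmod l + 2)) by (apply Rdiv_lt_0_compat; lra).
  exists (Rmin d (eps / (Cmod l + 2))); split; [apply Rmin_pos; assumption |].
  intros w Hw.
  assert (K1 := K w (Rlt_le_trans _ _ _ Hw (Rmin_l _ _))).
  assert (H2 := Rlt_le_trans _ _ _ Hw (Rmin_r _ _)).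
  replace (f w - f z)%C with ((f w - f z - l * (w - z)) + l * (w - z))%C by ring.
  apply Rle_lt_trans with (1 := Cmod_triangle _ _).
  rewrite Cmod_mult.
  assert (Cmod (w - z) * (Cmod l + 2) < eps).
  { apply Rmult_lt_reg_r with (/ (Cmod l + 2)); [apply Rinv_0_lt_compat; lra |].
    rewrite Rmult_assoc, Rinv_r, Rmult_1_r; [exact H2 | lra]. }
  nra.
Qed.

Lemma Cmult_integral (x y : C) : (x * y)%C = 0 -> x = 0 \/ y = 0.
Proof.
  intros H; destruct (classic (x = 0)) as [E | E]; [left; exact E |].
  destruct (classic (y = 0)) as [E' | E']; [right; exact E' |].
  exfalso; exact (Cmult_neq_0 x y E E' H).
Qed.

Lemma is_derive_C_unique (f : C -> C) (z l l' : C) :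
  is_derive f z l -> is_derive f z l' -> l = l'.
Proof.
  intros H H'; apply Cmod_sub_eq_0, Rnot_lt_le; intros Hlt.
  destruct (proj1 (is_derive_C f z l) H (Cmod (l - l') / 4) ltac:(lra)) as [d1 [Q1 V1]].
  destruct (proj1 (is_derive_C f z l') H' (Cmod (l - l') / 4) ltac:(lra)) as [d2 [Q2 V2]].
  set (s := Rmin d1 d2 / 2).
  assert (Ps : 0 < s) by (unfold s; assert (0 < Rmin d1 d2) by (apply Rmin_pos; assumption); lra).
  assert (S1 : s < d1) by (unfold s in *; assert (A := Rmin_l d1 d2); lra).
  assert (S2 : s < d2) by (unfold s in *; assert (A := Rmin_r d1 d2); lra).
  set (w := (z + RtoC s)%C).
  assert (Mw : Cmod (w - z) = s).
  { unfold w; replace (z + RtoC s - z)%C with (RtoC s) by ring; rewrite Cmod_R, Rabs_pos_eq; lra. }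
  specialize (V1 w ltac:(lra)); specialize (V2 w ltac:(lra)).
  assert (A := Cmod_sub_le (f w - f z - l' * (w - z)) (f w - f z - l * (w - z))).
  replace (f w - f z - l' * (w - z) - (f w - f z - l * (w - z)))%C with ((l - l') * (w - z))%C in A by ring.
  rewrite Cmod_mult, Mw in A; rewrite Mw in V1, V2; nra.
Qed.

Lemma ex_derive_C_sub_const (c z : C) : ex_derive (fun w : C => w - c)%C z.
Proof. apply ex_derive_C_minus; [apply ex_derive_C_id | apply ex_derive_C_const]. Qed.

Lemma ex_derive_C_plus_const (c z : C) : ex_derive (fun w : C => w + c)%C z.
Proof. apply ex_derive_C_plus; [apply ex_derive_C_id | apply ex_derive_C_const]. Qed.

Lemma ex_derive_C_affine (b c z : C) : ex_derive (fun w : C => b + c * w)%C z.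
Proof.
  apply ex_derive_C_plus; [apply ex_derive_C_const |].
  apply ex_derive_C_mult; [apply ex_derive_C_const | apply ex_derive_C_id].
Qed.

Lemma RtoC_neq_0 (x : R) : x <> 0 -> RtoC x <> 0.
Proof. intros H E; apply H, RtoC_inj, E. Qed.

Lemma Rdiv_unit_interval (x y : R) : 0 <= x < y -> 0 <= x / y < 1.
Proof.
  intros H; split; [apply Rdiv_le_0_compat; lra |].
  apply Rmult_lt_reg_r with y; [lra |]; unfold Rdiv; rewrite Rmult_assoc, Rinv_l; lra.
Qed.

(** * Goursat's lemma by bisection *)

Lemma nested_intervals (x w : nat -> R) :
  (forall n, 0 <= w n) -> (forall n, x n <= x (S n)) ->
  (forall n, x (S n) + w (S n) <= x n + w n) ->
  exists X, forall n, x n <= X <= x n + w n.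
Proof.
  intros Hw Hx Hy.
  assert (Mx : forall n k, x n <= x (n + k)%nat).
  { intros n k; induction k as [| k IH]; [rewrite Nat.add_0_r; lra |].
    rewrite Nat.add_succ_r; specialize (Hx (n + k)%nat); lra. }
  assert (My : forall n k, x (n + k)%nat + w (n + k)%nat <= x n + w n).
  { intros n k; induction k as [| k IH]; [rewrite Nat.add_0_r; lra |].
    rewrite Nat.add_succ_r; specialize (Hy (n + k)%nat); lra. }
  assert (B : forall n m, x n <= x m + w m).
  { intros n m; destruct (Nat.le_ge_cases n m) as [L | L].
    - assert (A := Mx n (m - n)%nat); replace (n + (m - n))%nat with m in A by lia.
      specialize (Hw m); lra.
    - assert (A := My m (n - m)%nat); replace (m + (n - m))%nat with n in A by lia.
      specialize (Hw n); lra. }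
  destruct (completeness (fun y => exists n, y = x n)) as [X [HX1 HX2]].
  - exists (x O + w O); intros y [n ->]; apply B.
  - exists (x O), O; reflexivity.
  - exists X; intros n; split.
    + apply HX1; exists n; reflexivity.
    + apply HX2; intros y [m ->]; apply B.
Qed.

(** Goursat: a rectangle violating the bound [eps * (width + height) ^ 2] has a quarter
    violating it. *)
Lemma additive_rectangle_zero (I : R -> R -> R -> R -> C) (a b c d : R) :
  a <= b -> c <= d ->
  (forall x0 x1 x2 y0 y1, a <= x0 <= x1 -> x1 <= x2 <= b -> c <= y0 <= y1 -> y1 <= d ->
     I x0 x2 y0 y1 = (I x0 x1 y0 y1 + I x1 x2 y0 y1)%C) ->
  (forall x0 x1 y0 y1 y2, a <= x0 <= x1 -> x1 <= b -> c <= y0 <= y1 -> y1 <= y2 <= d ->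
     I x0 x1 y0 y2 = (I x0 x1 y0 y1 + I x0 x1 y1 y2)%C) ->
  (forall x y, a <= x <= b -> c <= y <= d -> forall eps, 0 < eps ->
     exists del, 0 < del /\ forall x0 x1 y0 y1,
       a <= x0 <= x -> x <= x1 <= b -> c <= y0 <= y -> y <= y1 <= d ->
       x1 - x0 < del -> y1 - y0 < del ->
       Cmod (I x0 x1 y0 y1) <= eps * (x1 - x0 + (y1 - y0)) ^ 2) ->
  I a b c d = 0.
Proof.
  intros Hab Hcd Ax Ay Loc.
  set (w := fun n => (b - a) * (/ 2) ^ n).
  set (h := fun n => (d - c) * (/ 2) ^ n).
  assert (H2 : forall n, 0 < (/ 2) ^ n) by (intros n; apply pow_lt; lra).
  assert (Hw : forall n, 0 <= w n) by (intros n; apply Rmult_le_pos; [lra | apply Rlt_le, H2]).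
  assert (Hh : forall n, 0 <= h n) by (intros n; apply Rmult_le_pos; [lra | apply Rlt_le, H2]).
  assert (Sw : forall n, w n = w (S n) + w (S n)) by (intros n; unfold w; simpl; field).
  assert (Sh : forall n, h n = h (S n) + h (S n)) by (intros n; unfold h; simpl; field).
  apply Cmod_eq_0, Rle_antisym; [| apply Cmod_ge_0].
  apply Rnot_lt_le; intros Hpos.
  (* Makes the initial rectangle [bad]; the [+ 1] keeps the inequality strict and covers degenerate
     rectangles. *)
  set (eps := Cmod (I a b c d) / (2 * ((b - a + (d - c)) ^ 2 + 1))).
  assert (Pden : 0 < (b - a + (d - c)) ^ 2 + 1) by (assert (A := pow2_ge_0 (b - a + (d - c))); lra).
  assert (He : 0 < eps) by (apply Rdiv_lt_0_compat; lra).
  (* [p] is the lower left corner of a rectangle of generation [n], whose sides have the prescribed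
     lengths [w n] and [h n]. *)
  set (bad := fun n (p : R * R) =>
    eps * (w n + h n) ^ 2 < Cmod (I (fst p) (fst p + w n) (snd p) (snd p + h n))).
  set (sub := fun n (p q : R * R) =>
    (fst q = fst p \/ fst q = fst p + w (S n)) /\
    (snd q = snd p \/ snd q = snd p + h (S n)) /\ bad (S n) q).
  set (inr := fun n (p : R * R) =>
    a <= fst p /\ fst p + w n <= b /\ c <= snd p /\ snd p + h n <= d).
  assert (Ex : forall n p, inr n p -> bad n p -> exists q, sub n p q).
  { intros n [x y] (I1 & I2 & I3 & I4) B; simpl in *.
    apply NNPP; intros No.
    assert (G : forall q, (fst q = x \/ fst q = x + w (S n)) ->
              (snd q = y \/ snd q = y + h (S n)) -> ~ bad (S n) q).
    { intros q A1 A2 A3; apply No; exists q; split; [exact A1 | split; [exact A2 | exact A3]]. }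
    assert (G1 := G (x, y) (or_introl eq_refl) (or_introl eq_refl)).
    assert (G2 := G (x + w (S n), y) (or_intror eq_refl) (or_introl eq_refl)).
    assert (G3 := G (x, y + h (S n)) (or_introl eq_refl) (or_intror eq_refl)).
    assert (G4 := G (x + w (S n), y + h (S n)) (or_intror eq_refl) (or_intror eq_refl)).
    unfold bad in *; simpl fst in *; simpl snd in *.
    apply Rnot_lt_le in G1; apply Rnot_lt_le in G2.
    apply Rnot_lt_le in G3; apply Rnot_lt_le in G4.
    assert (W1 := Hw (S n)); assert (W2 := Hh (S n)).
    assert (E1 := Sw n); assert (E2 := Sh n).
    rewrite (Ax x (x + w (S n)) (x + w n) y (y + h n)) in B by lra.
    rewrite (Ay x (x + w (S n)) y (y + h (S n)) (y + h n)) in B by lra.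
    rewrite (Ay (x + w (S n)) (x + w n) y (y + h (S n)) (y + h n)) in B by lra.
    rewrite E1, E2 in B; rewrite <- !Rplus_assoc in B.
    (* Four good quarters would give at most [4 * eps * (size / 2)^2 = eps * size^2]: the exponent 2
       is what bisection preserves. *)
    match type of B with _ < Cmod ((?i + ?j) + (?k + ?l)) =>
      assert (T1 := Cmod_triangle (i + j) (k + l));
      assert (T2 := Cmod_triangle i j); assert (T3 := Cmod_triangle k l) end.
    simpl in *; nra. }
  set (next := fun n p => epsilon (inhabits p) (sub n p)).
  set (P := fix P n := match n with O => (a, c) | S n => next n (P n) end).
  assert (Inv : forall n, inr n (P n) /\ bad n (P n)).
  { induction n as [| n [IH1 IH2]].
    - split.
      + unfold inr, w, h; simpl; lra.
      + unfold bad, w, h; simpl.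
        replace (a + (b - a) * 1) with b by ring; replace (c + (d - c) * 1) with d by ring.
        replace (((b - a) * 1 + (d - c) * 1) * (((b - a) * 1 + (d - c) * 1) * 1))
          with ((b - a + (d - c)) ^ 2) by ring.
        unfold eps; apply Rmult_lt_reg_r with (2 * ((b - a + (d - c)) ^ 2 + 1)); [lra |].
        replace (Cmod (I a b c d) / (2 * ((b - a + (d - c)) ^ 2 + 1)) * (b - a + (d - c)) ^ 2 *
          (2 * ((b - a + (d - c)) ^ 2 + 1))) with (Cmod (I a b c d) * (b - a + (d - c)) ^ 2)
          by (field; lra).
        apply Rmult_lt_compat_l; [exact Hpos |].
        lra.
    - assert (S1 : sub n (P n) (P (S n))) by (apply epsilon_spec, Ex; assumption).
      destruct S1 as (S1 & S2 & S3); split; [| exact S3].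
      destruct IH1 as (I1 & I2 & I3 & I4).
      assert (W1 := Hw (S n)); assert (W2 := Hh (S n)).
      assert (E1 := Sw n); assert (E2 := Sh n).
      unfold inr; destruct S1 as [-> | ->]; destruct S2 as [-> | ->]; repeat split; lra. }
  assert (Sub : forall n, sub n (P n) (P (S n))).
  { intros n; apply epsilon_spec, Ex; apply Inv. }
  destruct (nested_intervals (fun n => fst (P n)) w) as [X HX]; [exact Hw | | |].
  { intros n; destruct (Sub n) as [[-> | ->] _]; assert (W1 := Hw (S n)); lra. }
  { intros n; assert (E1 := Sw n); assert (W1 := Hw (S n)).
    destruct (Sub n) as [[-> | ->] _]; lra. }
  destruct (nested_intervals (fun n => snd (P n)) h) as [Y HY]; [exact Hh | | |].
  { intros n; destruct (Sub n) as [_ [[-> | ->] _]]; assert (W1 := Hh (S n)); lra. }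
  { intros n; assert (E1 := Sh n); assert (W1 := Hh (S n)).
    destruct (Sub n) as [_ [[-> | ->] _]]; lra. }
  assert (X0 : a <= X <= b).
  { destruct (Inv O) as [(I1 & I2 & _) _]; specialize (HX O); lra. }
  assert (Y0 : c <= Y <= d).
  { destruct (Inv O) as [(_ & _ & I1 & I2) _]; specialize (HY O); lra. }
  destruct (Loc X Y X0 Y0 eps He) as [del [Hd K]].
  destruct (pow_lt_1_zero (/ 2) ltac:(rewrite Rabs_pos_eq; lra) (del / (b - a + (d - c) + 1))
    ltac:(apply Rdiv_lt_0_compat; lra)) as [n Hn].
  specialize (Hn n (le_n n)); rewrite Rabs_pos_eq in Hn by apply Rlt_le, H2.
  assert (Hn' : (/ 2) ^ n * (b - a + (d - c) + 1) < del).
  { apply Rmult_lt_reg_r with (/ (b - a + (d - c) + 1)); [apply Rinv_0_lt_compat; lra |].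
    rewrite Rmult_assoc, Rinv_r, Rmult_1_r by lra; exact Hn. }
  assert (wd : w n < del) by (unfold w; nra).
  assert (hd : h n < del) by (unfold h; nra).
  destruct (Inv n) as [(I1 & I2 & I3 & I4) B].
  specialize (HX n); specialize (HY n).
  assert (Fin := K (fst (P n)) (fst (P n) + w n) (snd (P n)) (snd (P n) + h n)).
  unfold bad in B; apply (Rlt_not_le _ _ B).
  replace (w n + h n) with (fst (P n) + w n - fst (P n) + (snd (P n) + h n - snd (P n))) by ring.
  apply Fin; lra.
Qed.

(** * Integrals of complex-valued functions of a real variable *)

(** Stated with [Cmod] for the sake of estimates; [continuous_path_correct] passes to the real
    module [C_R_CompleteNormedModule], in which paths are integrated. *)
Definition continuous_path (u : R -> C) (x : R) : Prop :=
  forall eps, 0 < eps -> exists del, 0 < del /\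
    forall y, Rabs (y - x) < del -> Cmod (u y - u x) < eps.

Lemma continuous_path_correct (u : R -> C) (x : R) :
  continuous_path u x -> continuous (U := C_R_CompleteNormedModule) u x.
Proof.
  intros H P HP.
  destruct (proj1 (locally_C_disc (u x) P) HP) as [e [He K]].
  destruct (H e He) as [d [Hd L]].
  exists (mkposreal d Hd); intros y Hy; apply K, L, Hy.
Qed.

Lemma continuous_path_mult (u v : R -> C) (x : R) :
  continuous_path u x -> continuous_path v x -> continuous_path (fun t => u t * v t)%C x.
Proof.
  intros Hu Hv eps He.
  set (A := Cmod (u x)); set (B := Cmod (v x)).
  assert (PA : 0 <= A) by apply Cmod_ge_0; assert (PB : 0 <= B) by apply Cmod_ge_0.
  set (k := Rmin 1 (eps / (A + B + 2))).
  assert (Pk : 0 < k) by (apply Rmin_pos; [lra | apply Rdiv_lt_0_compat; lra]).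
  assert (K1 : k <= 1) by apply Rmin_l.
  assert (K2 : k * (A + B + 2) <= eps).
  { apply Rmult_le_reg_r with (/ (A + B + 2)); [apply Rinv_0_lt_compat; lra |].
    rewrite Rmult_assoc, Rinv_r, Rmult_1_r by lra; apply Rmin_r. }
  destruct (Hu k Pk) as [d1 [Hd1 L1]]; destruct (Hv k Pk) as [d2 [Hd2 L2]].
  exists (Rmin d1 d2); split; [apply Rmin_pos; assumption |].
  intros y Hy.
  destruct (Rmin_Rgt_l _ _ _ Hy) as [Hyl Hyr]; assert (M1 := L1 y Hyl); assert (M2 := L2 y Hyr).
  replace (u y * v y - u x * v x)%C
    with ((u y - u x) * (v y - v x) + u x * (v y - v x) + (u y - u x) * v x)%C by ring.
  assert (T1 := Cmod_triangle ((u y - u x) * (v y - v x) + u x * (v y - v x)) ((u y - u x) * v x)).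
  assert (T2 := Cmod_triangle ((u y - u x) * (v y - v x)) (u x * (v y - v x))).
  rewrite !Cmod_mult in *; fold A B in T1, T2.
  assert (N1 := Cmod_ge_0 (u y - u x)); assert (N2 := Cmod_ge_0 (v y - v x)).
  assert (Cmod (u y - u x) * Cmod (v y - v x) <= k * 1) by (apply Rmult_le_compat; lra).
  assert (A * Cmod (v y - v x) <= A * k) by (apply Rmult_le_compat_l; lra).
  assert (Cmod (u y - u x) * B <= k * B) by (apply Rmult_le_compat_r; lra).
  nra.
Qed.

Lemma continuous_path_minus (u v : R -> C) (x : R) :
  continuous_path u x -> continuous_path v x -> continuous_path (fun t => u t - v t)%C x.
Proof.
  intros Hu Hv eps He.
  destruct (Hu (eps / 2)) as [d1 [P1 M1]]; [lra |]; destruct (Hv (eps / 2)) as [d2 [P2 M2]]; [lra |].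
  exists (Rmin d1 d2); split; [apply Rmin_pos; assumption |]; intros y Hy.
  destruct (Rmin_Rgt_l _ _ _ Hy) as [Hyl Hyr]; assert (N1 := M1 y Hyl); assert (N2 := M2 y Hyr).
  replace (u y - v y - (u x - v x))%C with ((u y - u x) - (v y - v x))%C by ring.
  apply Rle_lt_trans with (1 := Cmod_sub_le _ _); lra.
Qed.

Lemma continuous_path_comp (f : C -> C) (u : R -> C) (x : R) :
  continuous f (u x) -> continuous_path u x -> continuous_path (fun t => f (u t)) x.
Proof.
  intros Hf Hu eps He.
  destruct (proj1 (continuous_C f (u x)) Hf eps He) as [d [Hd K]].
  destruct (Hu d Hd) as [d' [Hd' L]].
  exists d'; split; [exact Hd' | intros y Hy; apply K, L, Hy].
Qed.

Lemma ex_derive_cont_C (f : C -> C) (z : C) : ex_derive f z -> continuous f z.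
Proof. intros H; apply continuous_C, ex_derive_C_continuous, H. Qed.

Definition is_velocity (u : R -> C) (x : R) (v : C) : Prop :=
  forall eps, 0 < eps -> exists del, 0 < del /\ forall y, Rabs (y - x) < del ->
    Cmod (u y - u x - v * RtoC (y - x)) <= eps * Rabs (y - x).

Lemma is_velocity_correct (u : R -> C) (x : R) (v : C) :
  is_velocity u x v -> is_derive (V := C_R_CompleteNormedModule) u x v.
Proof.
  intros H; split; [apply is_linear_scal_l |].
  intros y Hy eps.
  assert (Ey : x = y).
  { apply (is_filter_lim_locally_unique (K := R_AbsRing) (V := R_NormedModule) x y Hy). }
  subst y.
  destruct (H eps (cond_pos eps)) as [d [Hd K]].
  exists (mkposreal d Hd); intros w Hw.
  assert (E := K w Hw).
  match goal with |- norm ?p <= _ =>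
    replace p with ((u w - u x - v * RtoC (w - x))%C : C_R_CompleteNormedModule) end.
  - rewrite Cmod_norm in E; exact E.
  - destruct (u w), (u x), v.
    apply injective_projections; cbn -[Rplus Rmult Ropp];
    unfold scal, plus, opp, mult; cbn -[Rplus Rmult Ropp]; unfold mult; cbn -[Rplus Rmult Ropp]; ring.
Qed.

Lemma is_velocity_continuous (u : R -> C) (x : R) (v : C) :
  is_velocity u x v -> continuous_path u x.
Proof.
  intros H eps He.
  destruct (H 1 Rlt_0_1) as [d [Hd K]].
  assert (Pv := Cmod_ge_0 v).
  assert (P : 0 < eps / (Cmod v + 2)) by (apply Rdiv_lt_0_compat; lra).
  exists (Rmin d (eps / (Cmod v + 2))); split; [apply Rmin_pos; assumption |].
  intros w Hw.
  assert (K1 := K w (Rlt_le_trans _ _ _ Hw (Rmin_l _ _))).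
  assert (H2 := Rlt_le_trans _ _ _ Hw (Rmin_r _ _)).
  replace (u w - u x)%C with ((u w - u x - v * RtoC (w - x)) + v * RtoC (w - x))%C by ring.
  apply Rle_lt_trans with (1 := Cmod_triangle _ _).
  rewrite Cmod_mult, Cmod_R.
  assert (Rabs (w - x) * (Cmod v + 2) < eps).
  { apply Rmult_lt_reg_r with (/ (Cmod v + 2)); [apply Rinv_0_lt_compat; lra |].
    rewrite Rmult_assoc, Rinv_r, Rmult_1_r; [exact H2 | lra]. }
  nra.
Qed.

Lemma is_velocity_comp (G : C -> C) (u : R -> C) (x : R) (l v : C) :
  is_derive G (u x) l -> is_velocity u x v ->
  is_velocity (fun t => G (u t)) x (l * v)%C.
Proof.
  intros HG Hu eps He.
  assert (Pv := Cmod_ge_0 v); assert (Pl := Cmod_ge_0 l).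
  set (e1 := eps / (2 * (Cmod v + 1))).
  assert (Pe1 : 0 < e1) by (apply Rdiv_lt_0_compat; lra).
  set (e2 := Rmin 1 (eps / (2 * (Cmod l + 1)))).
  assert (Pe2 : 0 < e2) by (apply Rmin_pos; [lra | apply Rdiv_lt_0_compat; lra]).
  assert (E1 : e1 * (Cmod v + 1) = eps / 2) by (unfold e1; field; lra).
  assert (E2 : e2 * (Cmod l + 1) <= eps / 2).
  { replace (eps / 2) with (eps / (2 * (Cmod l + 1)) * (Cmod l + 1)) by (field; lra).
    apply Rmult_le_compat_r; [lra | apply Rmin_r]. }
  assert (E3 : e2 <= 1) by apply Rmin_l.
  destruct (proj1 (is_derive_C G (u x) l) HG e1 Pe1) as [d1 [Hd1 L1]].
  destruct (Hu e2 Pe2) as [d2 [Hd2 L2]].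
  destruct (is_velocity_continuous u x v Hu d1 Hd1) as [d3 [Hd3 L3]].
  exists (Rmin d2 d3); split; [apply Rmin_pos; assumption |].
  intros y Hy.
  assert (M2 := L2 y (Rlt_le_trans _ _ _ Hy (Rmin_l _ _))).
  assert (M1 := L1 (u y) (L3 y (Rlt_le_trans _ _ _ Hy (Rmin_r _ _)))).
  assert (Pr := Rabs_pos (y - x)).
  assert (U : Cmod (u y - u x) <= (Cmod v + 1) * Rabs (y - x)).
  { replace (u y - u x)%C with ((u y - u x - v * RtoC (y - x)) + v * RtoC (y - x))%C by ring.
    apply Rle_trans with (1 := Cmod_triangle _ _).
    rewrite Cmod_mult, Cmod_R; nra. }
  replace (G (u y) - G (u x) - l * v * RtoC (y - x))%C
    with ((G (u y) - G (u x) - l * (u y - u x)) + l * (u y - u x - v * RtoC (y - x)))%C by ring.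
  apply Rle_trans with (1 := Cmod_triangle _ _).
  rewrite Cmod_mult.
  assert (A1 : e1 * Cmod (u y - u x) <= e1 * ((Cmod v + 1) * Rabs (y - x)))
    by (apply Rmult_le_compat_l; lra).
  rewrite <- Rmult_assoc, E1 in A1.
  nra.
Qed.

Definition path_int (f : R -> C) (p q : R) : C := RInt (V := C_R_CompleteNormedModule) f p q.

Lemma path_int_ex (f : R -> C) (p q : R) :
  p <= q -> (forall t, p <= t <= q -> continuous_path f t) ->
  ex_RInt (V := C_R_CompleteNormedModule) f p q.
Proof.
  intros L H; apply (ex_RInt_continuous (V := C_R_CompleteNormedModule)).
  rewrite Rmin_left, Rmax_right by exact L.
  intros t Ht; apply continuous_path_correct, H, Ht.
Qed.

Lemma path_int_Chasles (f : R -> C) (p q r : R) :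
  p <= q -> q <= r -> (forall t, p <= t <= r -> continuous_path f t) ->
  path_int f p r = (path_int f p q + path_int f q r)%C.
Proof.
  intros L1 L2 H; symmetry; apply (RInt_Chasles (V := C_R_CompleteNormedModule));
  apply path_int_ex; try assumption; intros t Ht; apply H; lra.
Qed.

Lemma path_int_ext (f g : R -> C) (p q : R) :
  p <= q -> (forall t, p <= t <= q -> f t = g t) -> path_int f p q = path_int g p q.
Proof.
  intros L H; apply (RInt_ext (V := C_R_CompleteNormedModule)).
  rewrite Rmin_left, Rmax_right by exact L; intros t Ht; apply H; lra.
Qed.

Lemma path_int_minus (f g : R -> C) (p q : R) :
  p <= q -> (forall t, p <= t <= q -> continuous_path f t) ->
  (forall t, p <= t <= q -> continuous_path g t) ->
  path_int (fun t => f t - g t)%C p q = (path_int f p q - path_int g p q)%C.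
Proof.
  intros L Hf Hg; apply (RInt_minus (V := C_R_CompleteNormedModule)); apply path_int_ex; assumption.
Qed.

Lemma path_int_le (f : R -> C) (p q M : R) :
  p <= q -> (forall t, p <= t <= q -> continuous_path f t) ->
  (forall t, p <= t <= q -> Cmod (f t) <= M) -> Cmod (path_int f p q) <= (q - p) * M.
Proof.
  intros L Hf HM; rewrite Cmod_norm.
  apply (norm_RInt_le_const (V := C_R_CompleteNormedModule) f p q); [exact L | |].
  - intros t Ht; specialize (HM t Ht); rewrite Cmod_norm in HM; exact HM.
  - apply (RInt_correct (V := C_R_CompleteNormedModule)), path_int_ex; assumption.
Qed.

Lemma path_int_derive (u v : R -> C) (p q : R) :
  p <= q -> (forall t, p <= t <= q -> is_velocity u t (v t)) ->
  (forall t, p <= t <= q -> continuous_path v t) -> path_int v p q = (u q - u p)%C.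
Proof.
  intros L Hu Hv; apply (is_RInt_unique (V := C_R_CompleteNormedModule)).
  apply (is_RInt_derive (V := C_R_CompleteNormedModule) u v p q);
  rewrite Rmin_left, Rmax_right by exact L; intros t Ht.
  - apply is_velocity_correct, Hu, Ht.
  - apply continuous_path_correct, Hv, Ht.
Qed.

Lemma continuous_path_const (c : C) (x : R) : continuous_path (fun _ => c) x.
Proof.
  intros eps He; exists 1; split; [lra |]; intros y _; rewrite Cmod_sub_self; exact He.
Qed.

Lemma path_int_const (c : C) (p q : R) : p <= q -> path_int (fun _ => c) p q = (c * RtoC (q - p))%C.
Proof.
  intros L.
  rewrite (path_int_derive (fun t => c * RtoC t)%C (fun _ => c)).
  - rewrite RtoC_minus; ring.
  - exact L.
  - intros t _ eps He; exists 1; split; [lra |]; intros y _.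
    replace (c * RtoC y - c * RtoC t - c * RtoC (y - t))%C with (RtoC 0) by (rewrite RtoC_minus; ring).
    rewrite Cmod_0; apply Rmult_le_pos; [lra | apply Rabs_pos].
  - intros t _; apply continuous_path_const.
Qed.

(** The integral lives in a module with real scalars, so a complex factor is pulled out through real
    and imaginary parts. *)
Lemma path_int_scal (c : C) (f : R -> C) (p q : R) :
  p <= q -> (forall t, p <= t <= q -> continuous_path f t) ->
  path_int (fun t => c * f t)%C p q = (c * path_int f p q)%C.
Proof.
  intros L Hf.
  assert (E := path_int_ex f p q L Hf).
  destruct E as [[l1 l2] E].
  unfold path_int; rewrite (is_RInt_unique _ _ _ _ E).
  apply (is_RInt_unique (V := C_R_CompleteNormedModule)).
  destruct c as [c1 c2].
  apply (is_RInt_fct_extend_pair (U := R_NormedModule) (V := R_NormedModule)).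
  - apply (is_RInt_ext (fun t => minus (scal c1 (fst (f t))) (scal c2 (snd (f t))))).
    { intros t _; reflexivity. }
    apply (is_RInt_minus (V := R_NormedModule)); apply (is_RInt_scal (V := R_NormedModule)).
    + exact (is_RInt_fct_extend_fst (U := R_NormedModule) (V := R_NormedModule) _ _ _ _ E).
    + exact (is_RInt_fct_extend_snd (U := R_NormedModule) (V := R_NormedModule) _ _ _ _ E).
  - apply (is_RInt_ext (fun t => plus (scal c1 (snd (f t))) (scal c2 (fst (f t))))).
    { intros t _; reflexivity. }
    apply (is_RInt_plus (V := R_NormedModule)); apply (is_RInt_scal (V := R_NormedModule)).
    + exact (is_RInt_fct_extend_snd (U := R_NormedModule) (V := R_NormedModule) _ _ _ _ E).
    + exact (is_RInt_fct_extend_fst (U := R_NormedModule) (V := R_NormedModule) _ _ _ _ E).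
Qed.

(** Meant for [g] the affine approximation of [F] at a point and [G] its quadratic primitive: the
    part coming from [g] depends only on the end points and cancels around a closed contour, leaving
    the error [F - g]. *)
Lemma path_int_primitive_error (F G g : C -> C) (u v : R -> C) (p q K L : R) :
  p <= q -> 0 <= K ->
  (forall t, p <= t <= q -> continuous F (u t)) ->
  (forall z, is_derive G z (g z)) -> (forall z, continuous g z) ->
  (forall t, p <= t <= q -> is_velocity u t (v t)) ->
  (forall t, p <= t <= q -> continuous_path v t) ->
  (forall t, p <= t <= q -> Cmod (F (u t) - g (u t)) <= K) ->
  (forall t, p <= t <= q -> Cmod (v t) <= L) ->
  Cmod (path_int (fun t => F (u t) * v t)%C p q - (G (u q) - G (u p))) <= (q - p) * (K * L).
Proof.
  intros Lpq PK HF HG Hg Hu Hv HK HL.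
  assert (Cu : forall t, p <= t <= q -> continuous_path u t).
  { intros t Ht; exact (is_velocity_continuous u t (v t) (Hu t Ht)). }
  assert (CF : forall t, p <= t <= q -> continuous_path (fun t => F (u t) * v t)%C t).
  { intros t Ht; apply continuous_path_mult; [apply continuous_path_comp |]; auto. }
  assert (Cg : forall t, p <= t <= q -> continuous_path (fun t => g (u t) * v t)%C t).
  { intros t Ht; apply continuous_path_mult; [apply continuous_path_comp |]; auto. }
  rewrite <- (path_int_derive (fun t => G (u t)) (fun t => g (u t) * v t)%C p q Lpq).
  2: intros t Ht; apply is_velocity_comp; auto.
  2: exact Cg.
  rewrite <- path_int_minus by assumption.
  apply path_int_le; [exact Lpq | |].
  - intros t Ht; apply continuous_path_minus; auto.
  - intros t Ht.
    replace (F (u t) * v t - g (u t) * v t)%C with ((F (u t) - g (u t)) * v t)%C by ring.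
    rewrite Cmod_mult; apply Rmult_le_compat; auto using Cmod_ge_0.
Qed.

(** * Circles, and integrals over them under homothety *)

Definition cis (x : R) : C := (cos x, sin x).

Lemma Cmod_cis (x : R) : Cmod (cis x) = 1.
Proof.
  unfold Cmod, cis; simpl.
  replace (cos x * (cos x * 1) + sin x * (sin x * 1)) with 1; [apply sqrt_1 |].
  assert (H := sin2_cos2 x); unfold Rsqr in H; lra.
Qed.

Lemma cis_neq_0 (x : R) : cis x <> 0.
Proof. apply Cmod_gt_0; rewrite Cmod_cis; lra. Qed.

Lemma cis_0 : cis 0 = 1.
Proof. unfold cis; rewrite cos_0, sin_0; reflexivity. Qed.

Lemma cis_2PI : cis (2 * PI) = 1.
Proof. unfold cis; rewrite cos_2PI, sin_2PI; reflexivity. Qed.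

Lemma is_derive_R_eps (f : R -> R) (x l : R) :
  is_derive f x l -> forall eps, 0 < eps -> exists del, 0 < del /\ forall y,
    Rabs (y - x) < del -> Rabs (f y - f x - l * (y - x)) <= eps * Rabs (y - x).
Proof.
  intros [_ H] eps He.
  assert (L : is_filter_lim (locally x) x) by (intros P HP; exact HP).
  destruct (H x L (mkposreal _ He)) as [d Hd].
  exists d; split; [apply cond_pos | intros w Hw].
  assert (E := Hd w Hw).
  change (Rabs ((f w - f x) - (w - x) * l) <= eps * Rabs (w - x)) in E.
  rewrite (Rmult_comm l); exact E.
Qed.

Lemma Cmod_le_Rabs (z : C) : Cmod z <= Rabs (fst z) + Rabs (snd z).
Proof.
  destruct z as [x y].
  assert (E : ((x, y) : C) = (RtoC x + Ci * RtoC y)%C)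
    by (apply injective_projections; simpl; ring).
  rewrite E at 1; apply Rle_trans with (1 := Cmod_triangle _ _).
  rewrite Cmod_mult, Cmod_Ci, !Cmod_R; simpl; lra.
Qed.

Lemma is_velocity_pair (u : R -> C) (x : R) (v : C) :
  is_derive (fun t => fst (u t)) x (fst v) -> is_derive (fun t => snd (u t)) x (snd v) ->
  is_velocity u x v.
Proof.
  intros H1 H2 eps He.
  destruct (is_derive_R_eps _ _ _ H1 (eps / 2)) as [d1 [P1 K1]]; [lra |].
  destruct (is_derive_R_eps _ _ _ H2 (eps / 2)) as [d2 [P2 K2]]; [lra |].
  exists (Rmin d1 d2); split; [apply Rmin_pos; assumption |].
  intros y Hy.
  destruct (Rmin_Rgt_l _ _ _ Hy) as [Hyl Hyr]; assert (N1 := K1 y Hyl); assert (N2 := K2 y Hyr).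
  apply Rle_trans with (1 := Cmod_le_Rabs _).
  replace (fst (u y - u x - v * RtoC (y - x))%C)
    with (fst (u y) - fst (u x) - fst v * (y - x)) by (simpl; ring).
  replace (snd (u y - u x - v * RtoC (y - x))%C)
    with (snd (u y) - snd (u x) - snd v * (y - x)) by (simpl; ring).
  lra.
Qed.

Lemma is_velocity_cis (x : R) : is_velocity cis x (Ci * cis x)%C.
Proof.
  apply is_velocity_pair; simpl; auto_derive; auto; ring.
Qed.

Lemma continuous_path_scal (c : C) (u : R -> C) (x : R) :
  continuous_path u x -> continuous_path (fun t => c * u t)%C x.
Proof. intros H; apply continuous_path_mult; [apply continuous_path_const | exact H]. Qed.

Lemma continuous_path_cis (x : R) : continuous_path cis x.
Proof. eapply is_velocity_continuous, is_velocity_cis. Qed.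

Lemma cis_lipschitz (x y : R) : x <= y -> Cmod (cis y - cis x) <= y - x.
Proof.
  intros L.
  rewrite <- (path_int_derive cis (fun t => Ci * cis t)%C x y L).
  - rewrite <- (Rmult_1_r (y - x)); apply path_int_le; [exact L | |].
    + intros t _; apply continuous_path_scal, continuous_path_cis.
    + intros t _; rewrite Cmod_mult, Cmod_Ci, Cmod_cis; lra.
  - intros t _; apply is_velocity_cis.
  - intros t _; apply continuous_path_scal, continuous_path_cis.
Qed.

Lemma cis_lipschitz_abs (x y : R) : Cmod (cis y - cis x) <= Rabs (y - x).
Proof.
  destruct (Rle_dec x y) as [L | L].
  - rewrite Rabs_pos_eq by lra; apply cis_lipschitz, L.
  - rewrite Cmod_sub_sym, Rabs_left by lra.
    assert (A := cis_lipschitz y x ltac:(lra)); lra.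
Qed.

Lemma is_velocity_ext (u w : R -> C) (x : R) (v : C) :
  (forall t, u t = w t) -> is_velocity u x v -> is_velocity w x v.
Proof.
  intros E H eps He; destruct (H eps He) as [d [Hd K]]; exists d; split; [exact Hd |].
  intros y Hy; rewrite <- !E; apply K, Hy.
Qed.

Lemma is_velocity_affine (p q : C) (u : R -> C) (x : R) (v : C) :
  is_velocity u x v -> is_velocity (fun t => p + q * u t)%C x (q * v)%C.
Proof.
  intros H; apply (is_velocity_comp (fun z => p + q * z)%C u); [| exact H].
  assert (E := is_derive_C_plus _ _ _ _ _ (is_derive_C_const p (u x))
     (is_derive_C_mult _ _ _ _ _ (is_derive_C_const q (u x)) (is_derive_C_id (u x)))).
  simpl in E; replace (RtoC 0 + (RtoC 0 * u x + q * RtoC 1))%C with q in E by ring; exact E.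
Qed.

Lemma is_velocity_RtoC (x : R) : is_velocity RtoC x 1.
Proof.
  intros eps He; exists 1; split; [lra |]; intros y _.
  replace (RtoC y - RtoC x - RtoC 1 * RtoC (y - x))%C with (RtoC 0) by (rewrite RtoC_minus; ring).
  rewrite Cmod_0; apply Rmult_le_pos; [lra | apply Rabs_pos].
Qed.

Definition circle (a : C) (r x : R) : C := (a + RtoC r * cis x)%C.

Lemma circle_period (a : C) (r : R) : circle a r (2 * PI) = circle a r 0.
Proof. unfold circle; rewrite cis_2PI, cis_0; reflexivity. Qed.

Lemma Cmod_circle (a : C) (r x : R) : 0 <= r -> Cmod (circle a r x - a) = r.
Proof.
  intros Hr; unfold circle; replace (a + RtoC r * cis x - a)%C with (RtoC r * cis x)%C by ring.
  rewrite Cmod_mult, Cmod_cis, Cmod_R, Rabs_pos_eq; lra.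
Qed.

(** The integral of [F] over a circle is unchanged by a homothety with centre [w], even when
    [F] is singular at [w]; Goursat's lemma is applied in the coordinates [(t, x)]. *)
Lemma circle_integral_homothety (F : C -> C) (a w : C) (r t0 : R) :
  0 < r -> Cmod (w - a) < r ->
  (forall z, Cmod (z - a) <= r -> z <> w -> ex_derive F z) ->
  0 < t0 <= 1 ->
  path_int (fun x => F (w + RtoC t0 * (circle a r x - w)) * (RtoC (t0 * r) * (Ci * cis x)))%C 0 (2 * PI) =
  path_int (fun x => F (circle a r x) * (RtoC r * (Ci * cis x)))%C 0 (2 * PI).
Proof.
  intros Hr Hw HF Ht0.
  set (Z := fun t x => (w + RtoC t * (circle a r x - w))%C).
  (* [A] and [B] are the coefficients of the form [F dz] pulled back by [Z], that is [A dt + B dx];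
     [I] below is its integral along the boundary of a rectangle. *)
  set (A := fun t x => (F (Z t x) * (circle a r x - w))%C).
  set (B := fun t x => (F (Z t x) * (RtoC (t * r) * (Ci * cis x)))%C).
  assert (HP := PI_RGT_0).
  (* The lower bound keeps [Z] away from [w] as long as [t >= t0 > 0]; the upper bound [2 * r] is
     the speed of [Z] in the direction [t]. *)
  assert (Cw : forall x, r - Cmod (w - a) <= Cmod (circle a r x - w) <= 2 * r).
  { intros x.
    replace (circle a r x - w)%C with ((circle a r x - a) - (w - a))%C by ring.
    assert (E1 := Cmod_sub_ge (circle a r x - a) (w - a)).
    assert (E2 := Cmod_sub_le (circle a r x - a) (w - a)).
    rewrite Cmod_circle in E1, E2 by lra; lra. }
  assert (Zw : forall t x, t0 <= t -> Z t x <> w).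
  { intros t x L E; assert (E' : (Z t x - w)%C = 0) by (rewrite E; ring).
    apply (f_equal Cmod) in E'; unfold Z in E'.
    replace (w + RtoC t * (circle a r x - w) - w)%C with (RtoC t * (circle a r x - w))%C in E' by ring.
    rewrite Cmod_mult, Cmod_0, Cmod_R, Rabs_pos_eq in E' by lra.
    specialize (Cw x); nra. }
  assert (Zr : forall t x, 0 <= t <= 1 -> Cmod (Z t x - a) <= r).
  { intros t x L; unfold Z.
    replace (w + RtoC t * (circle a r x - w) - a)%C
      with (RtoC (1 - t) * (w - a) + RtoC t * (circle a r x - a))%C by (rewrite RtoC_minus; ring).
    apply Rle_trans with (1 := Cmod_triangle _ _).
    rewrite !Cmod_mult, !Cmod_R, !Rabs_pos_eq, Cmod_circle by lra; nra. }
  assert (CF : forall t x, t0 <= t <= 1 -> continuous F (Z t x)).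
  { intros t x L; apply ex_derive_cont_C, HF; [apply Zr; lra | apply Zw; lra]. }
  assert (Vt : forall t x, is_velocity (fun t => Z t x) t (circle a r x - w)%C).
  { intros t x; unfold Z.
    assert (E := is_velocity_affine w (circle a r x - w) RtoC t 1 (is_velocity_RtoC t)).
    rewrite Cmult_1_r in E.
    apply is_velocity_ext with (2 := E); intros y; ring. }
  assert (Vx : forall t x, is_velocity (fun x => Z t x) x (RtoC (t * r) * (Ci * cis x))%C).
  { intros t x; unfold Z, circle.
    assert (E := is_velocity_affine (w + RtoC t * (a - w)) (RtoC (t * r)) cis x _ (is_velocity_cis x)).
    apply is_velocity_ext with (2 := E); intros y; rewrite RtoC_mult; ring. }
  assert (Cc : forall c x, continuous_path (fun x => RtoC c * (Ci * cis x))%C x).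
  { intros c x; apply continuous_path_scal, continuous_path_scal, continuous_path_cis. }
  assert (CA : forall x t, t0 <= t <= 1 -> continuous_path (fun t => A t x) t).
  { intros x t L; apply (continuous_path_mult (fun t => F (Z t x)) (fun _ => circle a r x - w)%C).
    - apply (continuous_path_comp F (fun t => Z t x)); [apply CF, L |].
      eapply is_velocity_continuous, Vt.
    - apply continuous_path_const. }
  assert (CB : forall t x, t0 <= t <= 1 -> continuous_path (fun x => B t x) x).
  { intros t x L; apply (continuous_path_mult (fun x => F (Z t x))); [| apply Cc].
    apply (continuous_path_comp F (fun x => Z t x)); [apply CF, L |].
    eapply is_velocity_continuous, Vx. }
  set (I := fun x0 x1 y0 y1 =>
    (path_int (fun t => A t y0) x0 x1 + path_int (fun x => B x1 x) y0 y1
     - path_int (fun t => A t y1) x0 x1 - path_int (fun x => B x0 x) y0 y1)%C).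
  assert (I0 : I t0 1 0 (2 * PI) = 0).
  { apply additive_rectangle_zero; [lra | lra | | |].
    - intros x0 x1 x2 y0 y1 L1 L2 L3 L4; unfold I.
      rewrite (path_int_Chasles (fun t => A t y0) x0 x1 x2), (path_int_Chasles (fun t => A t y1) x0 x1 x2);
        try lra; try (intros t Ht; apply CA; lra); ring.
    - intros x0 x1 y0 y1 y2 L1 L2 L3 L4; unfold I.
      rewrite (path_int_Chasles (fun x => B x1 x) y0 y1 y2), (path_int_Chasles (fun x => B x0 x) y0 y1 y2);
        try lra; try (intros t Ht; apply CB; lra); ring.
    - intros tp xp Ltp Lxp eps He.
      set (zp := Z tp xp).
      destruct (HF zp (Zr tp xp ltac:(lra)) (Zw tp xp ltac:(lra))) as [b Hb].
      (* The four sides together contribute at most [8 * r * r * e1 * sz^2]: one factor [2 * r]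
         bounds the speed of [Z], another its variation per unit of size, and there are two pairs of
         sides. *)
      set (e1 := eps / (8 * r * r + 1)).
      assert (Prr : 0 < r * r) by nra.
      assert (Pe1 : 0 < e1) by (apply Rdiv_lt_0_compat; lra).
      destruct (proj1 (is_derive_C F zp b) Hb e1 Pe1) as [d [Hd K]].
      assert (Lip : forall t x, t0 <= t <= 1 ->
        Cmod (Z t x - zp) <= 2 * r * (Rabs (t - tp) + Rabs (x - xp))).
      { intros t x Lt; unfold zp, Z.
        replace (w + RtoC t * (circle a r x - w) - (w + RtoC tp * (circle a r xp - w)))%C
          with (RtoC (t - tp) * (circle a r x - w) + RtoC (tp * r) * (cis x - cis xp))%C
          by (unfold circle; rewrite RtoC_minus, RtoC_mult; ring).
        apply Rle_trans with (1 := Cmod_triangle _ _).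
        rewrite !Cmod_mult, !Cmod_R, (Rabs_pos_eq (tp * r)) by nra.
        assert (Q1 := cis_lipschitz_abs xp x); assert (Q2 := Rabs_pos (t - tp)).
        assert (Q4 := Cmod_ge_0 (cis x - cis xp)).
        specialize (Cw x).
        assert (Rabs (t - tp) * Cmod (circle a r x - w) <= Rabs (t - tp) * (2 * r))
          by (apply Rmult_le_compat_l; lra).
        assert (tp * r * Cmod (cis x - cis xp) <= r * Rabs (x - xp)).
        { apply Rmult_le_compat; nra. }
        nra. }
      exists (d / (4 * r)); split; [apply Rdiv_lt_0_compat; lra |].
      intros x0 x1 y0 y1 L1 L2 L3 L4 S1 S2.
      set (sz := x1 - x0 + (y1 - y0)).
      assert (Hsz : 2 * r * sz < d).
      { unfold sz; apply Rlt_le_trans with (2 * r * (d / (4 * r) + d / (4 * r))).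
        - apply Rmult_lt_compat_l; lra.
        - apply Req_le; field; lra. }
      assert (Psz : 0 <= sz) by (unfold sz; lra).
      set (g := fun z => (F zp + b * (z - zp))%C).
      set (G := fun z => (F zp * z + b * ((z - zp) * (z - zp)) * / RtoC 2)%C).
      assert (HG : forall z, is_derive G z (g z)).
      { intros z; unfold G, g.
        assert (D1 := is_derive_C_plus _ _ _ _ _ (is_derive_C_id z) (is_derive_C_const (- zp)%C z)).
        assert (D2 := is_derive_C_mult _ _ _ _ _ D1 D1).
        assert (D3 := is_derive_C_mult _ _ _ _ _ (is_derive_C_mult _ _ _ _ _ (is_derive_C_const b z) D2)
          (is_derive_C_const (/ RtoC 2) z)).
        assert (D4 := is_derive_C_plus _ _ _ _ _
          (is_derive_C_mult _ _ _ _ _ (is_derive_C_const (F zp) z) (is_derive_C_id z)) D3).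
        simpl in D4.
        match type of D4 with is_derive _ _ ?l =>
          replace (F zp + b * (z - zp))%C with l by (field; exact two) end.
        exact D4. }
      assert (Cg : forall z, continuous g z).
      { intros z; apply ex_derive_cont_C.
        apply ex_derive_C_plus; [apply ex_derive_C_const |].
        apply ex_derive_C_mult; [apply ex_derive_C_const |].
        apply ex_derive_C_sub_const. }
      assert (Err : forall t x, x0 <= t <= x1 -> y0 <= x <= y1 ->
        Cmod (F (Z t x) - g (Z t x)) <= e1 * (2 * r * sz)).
      { intros t x Lt Lx.
        assert (Q := Lip t x ltac:(lra)).
        assert (Q' : Rabs (t - tp) + Rabs (x - xp) <= sz).
        { unfold sz; apply Rplus_le_compat; apply Rabs_le; lra. }
        assert (Q2 : Cmod (Z t x - zp) <= 2 * r * sz).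
        { apply Rle_trans with (1 := Q); apply Rmult_le_compat_l; lra. }
        unfold g; replace (F (Z t x) - (F zp + b * (Z t x - zp)))%C
          with (F (Z t x) - F zp - b * (Z t x - zp))%C by ring.
        apply Rle_trans with (e1 * Cmod (Z t x - zp)); [apply K; lra |].
        apply Rmult_le_compat_l; lra. }
      assert (PK : 0 <= e1 * (2 * r * sz)) by (apply Rmult_le_pos; nra).
      assert (ET : forall x, y0 <= x <= y1 ->
        Cmod (path_int (fun t => A t x) x0 x1 - (G (Z x1 x) - G (Z x0 x)))
          <= (x1 - x0) * (e1 * (2 * r * sz) * (2 * r))).
      { intros x Lx.
        apply (path_int_primitive_error F G g (fun t => Z t x) (fun _ => circle a r x - w)%C); auto; try lra.
        - intros t Lt; apply CF; lra.
        - intros t Lt; apply continuous_path_const.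
        - intros t Lt; apply Cw. }
      assert (EX : forall t, x0 <= t <= x1 ->
        Cmod (path_int (fun x => B t x) y0 y1 - (G (Z t y1) - G (Z t y0)))
          <= (y1 - y0) * (e1 * (2 * r * sz) * (2 * r))).
      { intros t Lt.
        apply (path_int_primitive_error F G g (fun x => Z t x) (fun x => RtoC (t * r) * (Ci * cis x))%C);
          auto; try lra.
        - intros x Lx; apply CF; lra.
        - intros x Lx; rewrite !Cmod_mult, Cmod_R, Cmod_Ci, Cmod_cis, Rabs_pos_eq; nra. }
      assert (B1 := ET y0 ltac:(lra)); assert (B2 := ET y1 ltac:(lra)).
      assert (B3 := EX x0 ltac:(lra)); assert (B4 := EX x1 ltac:(lra)).
      unfold I.
      match type of B1 with Cmod ?u <= _ => set (U1 := u) in * end.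
      match type of B2 with Cmod ?u <= _ => set (U2 := u) in * end.
      match type of B3 with Cmod ?u <= _ => set (U3 := u) in * end.
      match type of B4 with Cmod ?u <= _ => set (U4 := u) in * end.
      match goal with |- Cmod ?p <= _ => replace p with ((U1 + U4) - (U2 + U3))%C
        by (unfold U1, U2, U3, U4; ring) end.
      apply Rle_trans with (1 := Cmod_sub_le _ _).
      assert (T1 := Cmod_triangle U1 U4); assert (T2 := Cmod_triangle U2 U3).
      apply Rle_trans with (8 * r * r * e1 * (sz * sz)).
      { replace (8 * r * r * e1 * (sz * sz)) with (2 * (sz * (e1 * (2 * r * sz) * (2 * r)))) by ring.
        unfold sz at 1; lra. }
      replace (sz ^ 2) with (sz * sz) by ring.
      apply Rmult_le_compat_r; [apply Rle_0_sqr |].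
      apply Rle_trans with ((8 * r * r + 1) * e1); [nra |].
      unfold e1; apply Req_le; field; nra. }
  unfold I in I0.
  (* The sides [x = 0] and [x = 2 * PI] have the same image and cancel; the sides [t = t0] and
     [t = 1] are the two circles. *)
  assert (EA : path_int (fun t => A t (2 * PI)) t0 1 = path_int (fun t => A t 0) t0 1).
  { apply path_int_ext; [lra |]; intros t _; unfold A, Z; rewrite circle_period; reflexivity. }
  rewrite EA in I0.
  assert (EB : path_int (fun x => B 1 x) 0 (2 * PI) = path_int (fun x => B t0 x) 0 (2 * PI)).
  { match type of I0 with (?p + ?q - ?p - ?s)%C = _ =>
      replace q with ((p + q - p - s) + s)%C by ring end.
    rewrite I0; ring. }
  symmetry; etransitivity; [| exact EB].
  apply path_int_ext; [lra |]; intros x _; unfold B, Z.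
  rewrite Rmult_1_l; f_equal; f_equal; ring.
Qed.

(** * Cauchy's formula and Taylor expansion *)

Definition holo_disc (f : C -> C) (a : C) (R : R) : Prop :=
  forall z : C, Cmod (z - a) < R -> ex_derive f z.

Lemma Cmod_circle_sub_ge (a w : C) (r x : R) :
  0 <= r -> r - Cmod (w - a) <= Cmod (circle a r x - w).
Proof.
  intros Hr; replace (circle a r x - w)%C with ((circle a r x - a) - (w - a))%C by ring.
  assert (E := Cmod_sub_ge (circle a r x - a) (w - a)).
  rewrite Cmod_circle in E by lra; lra.
Qed.

Lemma continuous_path_circle (a : C) (r x : R) : continuous_path (circle a r) x.
Proof.
  unfold circle; eapply is_velocity_continuous, is_velocity_affine, is_velocity_cis.
Qed.

Lemma continuous_path_on_circle (f : C -> C) (a : C) (r R x : R) :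
  0 <= r < R -> holo_disc f a R -> continuous_path (fun x => f (circle a r x)) x.
Proof.
  intros Hr Hf; apply continuous_path_comp; [| apply continuous_path_circle].
  apply ex_derive_cont_C, Hf; rewrite Cmod_circle; lra.
Qed.

(** The form [dz / (z - w)] on the circle, divided by [Ci], so that its integral is [2 * PI]. *)
Definition cauchy_kernel (a w : C) (r x : R) : C := (RtoC r * cis x / (circle a r x - w))%C.

Lemma cauchy_kernel_continuous (a w : C) (r x : R) :
  0 <= r -> Cmod (w - a) < r -> continuous_path (cauchy_kernel a w r) x.
Proof.
  intros Hr Hw; unfold cauchy_kernel; apply continuous_path_mult.
  - apply continuous_path_scal, continuous_path_cis.
  - apply (continuous_path_comp (fun z => / (z - w))%C (circle a r)); [| apply continuous_path_circle].
    apply ex_derive_cont_C, ex_derive_C_inv.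
    + apply ex_derive_C_sub_const.
    + apply Cmod_gt_0; assert (H := Cmod_circle_sub_ge a w r x Hr); lra.
Qed.

Lemma cauchy_kernel_le (a w : C) (r x : R) :
  Cmod (w - a) < r -> Cmod (cauchy_kernel a w r x) <= r / (r - Cmod (w - a)).
Proof.
  intros Hw; assert (P := Cmod_ge_0 (w - a)).
  assert (H := Cmod_circle_sub_ge a w r x ltac:(lra)).
  unfold cauchy_kernel.
  rewrite Cmod_div by (apply Cmod_gt_0; lra).
  rewrite Cmod_mult, Cmod_cis, Cmod_R, Rabs_pos_eq, Rmult_1_r by lra.
  apply Rmult_le_compat_l; [lra |].
  apply Rinv_le_contravar; lra.
Qed.

(** The circle is contracted to [w], where [f] tends to [f w]. The integral of the kernel stays
    unevaluated here; it is computed later by expanding the constant function 1. *)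
Lemma cauchy_formula_kernel (f : C -> C) (a w : C) (r R : R) :
  r < R -> holo_disc f a R -> Cmod (w - a) < r ->
  path_int (fun x => f (circle a r x) * cauchy_kernel a w r x)%C 0 (2 * PI) =
  (f w * path_int (cauchy_kernel a w r) 0 (2 * PI))%C.
Proof.
  intros HrR Hf Hw.
  assert (P := Cmod_ge_0 (w - a)); assert (Pr : 0 < r) by lra.
  assert (HP := PI_RGT_0).
  set (K := cauchy_kernel a w r).
  set (J := path_int (fun x => f (circle a r x) * K x)%C 0 (2 * PI)).
  assert (CK : forall x, continuous_path K x) by (intros x; apply cauchy_kernel_continuous; lra).
  assert (Ne : forall x, (circle a r x - w)%C <> 0).
  { intros x; apply Cmod_gt_0; assert (H := Cmod_circle_sub_ge a w r x); lra. }
  assert (Fw : continuous f w) by (apply ex_derive_cont_C, Hf; lra).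
  (* The form [dz / (z - w)] is invariant under homotheties centred at [w], so only the argument of
     [f] is contracted. *)
  assert (Hom : forall t, 0 < t <= 1 ->
    path_int (fun x => f (w + RtoC t * (circle a r x - w)) * K x)%C 0 (2 * PI) = J).
  { intros t Ht.
    assert (Nt : RtoC t <> 0) by (apply RtoC_neq_0; lra).
    assert (NI : Ci <> 0) by (apply Cmod_gt_0; rewrite Cmod_Ci; lra).
    assert (E := circle_integral_homothety (fun z => f z / (z - w) * / Ci)%C a w r t Pr Hw).
    assert (E' : forall z, Cmod (z - a) <= r -> z <> w -> ex_derive (fun z => f z / (z - w) * / Ci)%C z).
    { intros z Hz Hzw; apply ex_derive_C_mult; [| apply ex_derive_C_const].
      apply ex_derive_C_div; [apply Hf; lra | | apply Csub_neq_0, Hzw].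
      apply ex_derive_C_sub_const. }
    specialize (E E' Ht); unfold J.
    etransitivity; [etransitivity; [| exact E] |]; apply path_int_ext; try lra;
      intros x _; unfold K, cauchy_kernel; [rewrite RtoC_mult |]; field; repeat split;
      try exact (Ne x); try assumption.
    intros E2; apply (Ne x).
    replace (w + RtoC t * (circle a r x - w) - w)%C with (RtoC t * (circle a r x - w))%C in E2 by ring.
    destruct (Cmult_integral _ _ E2); [contradiction | assumption]. }
  apply Cmod_sub_eq_0, Rnot_lt_le; intros Hlt.
  set (B := r / (r - Cmod (w - a))).
  assert (PB : 0 < B) by (apply Rdiv_lt_0_compat; lra).
  set (D := Cmod (J - f w * path_int K 0 (2 * PI))) in *.
  (* Over a period of length [2 * PI] an error [eps] in [f] costs at most
     [2 * PI * eps * B = D / 2], which is less than [D]. *)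
  set (eps := D / (4 * PI * B)).
  assert (Peps : 0 < eps) by (apply Rdiv_lt_0_compat; [exact Hlt | nra]).
  destruct (proj1 (continuous_C f w) Fw eps Peps) as [d [Hd Kd]].
  set (t := Rmin 1 (d / (4 * r))).
  assert (Pt : 0 < t) by (apply Rmin_pos; [lra | apply Rdiv_lt_0_compat; lra]).
  assert (T1 : t <= 1) by apply Rmin_l.
  assert (T2 : t * (2 * r) < d).
  { apply Rle_lt_trans with (d / (4 * r) * (2 * r)).
    - apply Rmult_le_compat_r; [lra | apply Rmin_r].
    - replace (d / (4 * r) * (2 * r)) with (d / 2) by (field; lra); lra. }
  assert (CZ : forall x, continuous_path (fun x => f (w + RtoC t * (circle a r x - w)))%C x).
  { intros x; apply (continuous_path_comp f).
    - apply ex_derive_cont_C, Hf.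
      replace (w + RtoC t * (circle a r x - w) - a)%C
        with (RtoC (1 - t) * (w - a) + RtoC t * (circle a r x - a))%C by (rewrite RtoC_minus; ring).
      apply Rle_lt_trans with (1 := Cmod_triangle _ _).
      rewrite !Cmod_mult, !Cmod_R, !Rabs_pos_eq, Cmod_circle by lra; nra.
    - apply (continuous_path_comp (fun z => w + RtoC t * (z - w))%C (circle a r));
        [| apply continuous_path_circle].
      apply ex_derive_cont_C, ex_derive_C_plus; [apply ex_derive_C_const |].
      apply ex_derive_C_mult; [apply ex_derive_C_const |].
      apply ex_derive_C_sub_const. }
  assert (Est : D <= (2 * PI - 0) * (eps * B)).
  { unfold D; rewrite <- (Hom t) by lra.
    rewrite <- path_int_scal by (try lra; auto).
    rewrite <- path_int_minus; try lra.
    2: intros x _; apply continuous_path_mult; auto.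
    2: intros x _; apply continuous_path_scal; auto.
    rewrite (path_int_ext _ (fun x => (f (w + RtoC t * (circle a r x - w)) + (- f w)) * K x)%C)
      by (try lra; intros x _; ring).
    apply path_int_le; [lra | |].
    - intros x _; apply continuous_path_mult; [| auto].
      apply (continuous_path_comp (fun z => z + - f w)%C).
      + apply ex_derive_cont_C, ex_derive_C_plus_const.
      + apply CZ.
    - intros x _; rewrite Cmod_mult.
      apply Rmult_le_compat; try apply Cmod_ge_0; [| apply cauchy_kernel_le; lra].
      apply Rlt_le, Kd.
      replace (w + RtoC t * (circle a r x - w) - w)%C with (RtoC t * (circle a r x - w))%C by ring.
      rewrite Cmod_mult, Cmod_R, Rabs_pos_eq by lra.
      apply Rle_lt_trans with (2 := T2), Rmult_le_compat_l; [lra |].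
      replace (circle a r x - w)%C with ((circle a r x - a) - (w - a))%C by ring.
      apply Rle_trans with (1 := Cmod_sub_le _ _); rewrite Cmod_circle; lra. }
  replace ((2 * PI - 0) * (eps * B)) with (D / 2) in Est by (unfold eps; field; split; lra).
  lra.
Qed.

(** Cauchy's integral for the Taylor coefficient of order [k]; [taylor_coeff_indep] removes the
    dependence on the radius. *)
Definition taylor_coeff (f : C -> C) (a : C) (r : R) (k : nat) : C :=
  (/ RtoC (2 * PI) * path_int (fun x => f (circle a r x) * / (RtoC r * cis x) ^ k) 0 (2 * PI))%C.

Lemma RtoC_cis_neq_0 (r x : R) : 0 < r -> (RtoC r * cis x)%C <> 0.
Proof.
  intros H; apply Cmult_neq_0; [| apply cis_neq_0].
  intros E; apply RtoC_inj in E; lra.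
Qed.

Lemma continuous_path_cis_pow (r x : R) (k : nat) :
  0 < r -> continuous_path (fun x => / (RtoC r * cis x) ^ k)%C x.
Proof.
  intros Hr; apply (continuous_path_comp (fun z => / (RtoC r * z) ^ k)%C cis);
    [| apply continuous_path_cis].
  apply ex_derive_cont_C, ex_derive_C_inv; [| apply Cpow_nz, RtoC_cis_neq_0, Hr].
  apply (ex_derive_C_pow (fun z => RtoC r * z)%C), ex_derive_C_mult;
    [apply ex_derive_C_const | apply ex_derive_C_id].
Qed.

Lemma Cmod_2PI_inv : Cmod (/ RtoC (2 * PI)) = / (2 * PI).
Proof.
  assert (HP := PI_RGT_0).
  rewrite Cmod_inv, Cmod_R, Rabs_pos_eq; [reflexivity | lra |].
  intros E; apply RtoC_inj in E; lra.
Qed.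

Lemma taylor_coeff_le (f : C -> C) (a : C) (r R M : R) (k : nat) :
  0 < r < R -> holo_disc f a R -> (forall z, Cmod (z - a) = r -> Cmod (f z) <= M) ->
  Cmod (taylor_coeff f a r k) * r ^ k <= M.
Proof.
  intros Hr Hf HM; assert (HP := PI_RGT_0).
  assert (Pk : 0 < r ^ k) by (apply pow_lt; lra).
  unfold taylor_coeff; rewrite Cmod_mult, Cmod_2PI_inv.
  match goal with |- _ * Cmod (path_int ?g _ _) * _ <= _ =>
    assert (E : Cmod (path_int g 0 (2 * PI)) <= (2 * PI - 0) * (M * / r ^ k)) end.
  { apply path_int_le; [lra | |].
    - intros x _; apply continuous_path_mult; [eapply continuous_path_on_circle; eauto; lra |].
      apply continuous_path_cis_pow; lra.
    - intros x _; rewrite Cmod_mult, Cmod_inv, Cmod_pow, Cmod_mult, Cmod_cis, Cmod_R, Rabs_pos_eq, Rmult_1_r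
        by (try lra; apply Cpow_nz, RtoC_cis_neq_0; lra).
      apply Rmult_le_compat_r; [apply Rlt_le, Rinv_0_lt_compat, Pk |].
      apply HM, Cmod_circle; lra. }
  apply Rmult_le_reg_r with (2 * PI * / r ^ k).
  { apply Rmult_lt_0_compat; [lra | apply Rinv_0_lt_compat, Pk]. }
  match goal with |- _ * ?c * _ * _ <= _ => replace (/ (2 * PI) * c * r ^ k * (2 * PI * / r ^ k)) with c end.
  - lra.
  - field; lra.
Qed.

(** The homothety is now centred at [a] and applied to [f z / (z - a)^(k + 1)]; the factor [/ Ci]
    compensates the [Ci] contained in [dz]. *)
Lemma taylor_coeff_shrink (f : C -> C) (a : C) (r R t : R) (k : nat) :
  0 < r < R -> holo_disc f a R -> 0 < t <= 1 ->
  taylor_coeff f a (t * r) k = taylor_coeff f a r k.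
Proof.
  intros Hr Hf Ht; unfold taylor_coeff; f_equal; assert (HP := PI_RGT_0).
  assert (NI : Ci <> 0) by (apply Cmod_gt_0; rewrite Cmod_Ci; lra).
  assert (Nt : RtoC t <> 0) by (apply RtoC_neq_0; lra).
  assert (Nr : RtoC r <> 0) by (apply RtoC_neq_0; lra).
  assert (E := circle_integral_homothety (fun z => f z * / (z - a) ^ (S k) * / Ci)%C a a r t).
  assert (E' : forall z, Cmod (z - a) <= r -> z <> a ->
    ex_derive (fun z => f z * / (z - a) ^ (S k) * / Ci)%C z).
  { intros z Hz Hza; apply ex_derive_C_mult; [| apply ex_derive_C_const].
    apply ex_derive_C_mult; [apply Hf; lra |].
    apply ex_derive_C_inv; [| apply Cpow_nz, Csub_neq_0, Hza].
    apply (ex_derive_C_pow (fun z => z - a)%C), ex_derive_C_minus;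
      [apply ex_derive_C_id | apply ex_derive_C_const]. }
  specialize (E ltac:(lra) ltac:(rewrite Cmod_sub_self; lra) E' Ht).
  etransitivity; [etransitivity; [| exact E] |]; apply path_int_ext; try lra; intros x _;
    assert (Nc := cis_neq_0 x); unfold circle; rewrite ?RtoC_mult.
  - replace (a + RtoC t * (a + RtoC r * cis x - a))%C with (a + RtoC t * RtoC r * cis x)%C by ring.
    replace (a + RtoC t * RtoC r * cis x - a)%C with (RtoC t * RtoC r * cis x)%C by ring.
    rewrite Cpow_S.
    assert (NP : (RtoC t * RtoC r * cis x)%C <> 0) by (repeat apply Cmult_neq_0; assumption).
    assert (NQ := Cpow_nz _ k NP); field; repeat split; assumption.
  - replace (a + RtoC r * cis x - a)%C with (RtoC r * cis x)%C by ring.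
    rewrite Cpow_S.
    assert (NP : (RtoC r * cis x)%C <> 0) by (repeat apply Cmult_neq_0; assumption).
    assert (NQ := Cpow_nz _ k NP); field; repeat split; assumption.
Qed.

Lemma taylor_coeff_indep (f : C -> C) (a : C) (r r' R : R) (k : nat) :
  0 < r < R -> 0 < r' < R -> holo_disc f a R -> taylor_coeff f a r k = taylor_coeff f a r' k.
Proof.
  assert (G : forall r r', 0 < r < R -> 0 < r' <= r -> holo_disc f a R ->
    taylor_coeff f a r k = taylor_coeff f a r' k).
  { intros s s' Hs Hs' Hf; rewrite <- (taylor_coeff_shrink f a s R (s' / s)); auto.
    - f_equal; field; lra.
    - split; [apply Rdiv_lt_0_compat; lra |].
      apply Rmult_le_reg_r with s; [lra |]; replace (s' / s * s) with s' by (field; lra); lra. }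
  intros Hr Hr' Hf; destruct (Rle_dec r' r).
  - apply G; auto; lra.
  - symmetry; apply G; auto; lra.
Qed.

Fixpoint power_sum (c : nat -> C) (v : C) (n : nat) : C :=
  match n with O => RtoC 0 | S n => (power_sum c v n + c n * v ^ n)%C end.

(** A finite geometric series: with [e = z - a] and [v = w - a], the kernel [e / (e - v)] is the sum
    of [(v / e)^k] for [k < n] plus [(v / e)^n] times the kernel. The exact remainder [Rem] avoids
    exchanging a series with the integral. *)
Lemma cauchy_kernel_expansion (f : C -> C) (a w : C) (r R M : R) (n : nat) :
  0 < r < R -> holo_disc f a R -> Cmod (w - a) < r ->
  (forall z, Cmod (z - a) = r -> Cmod (f z) <= M) ->
  Cmod (path_int (fun x => f (circle a r x) * cauchy_kernel a w r x)%C 0 (2 * PI)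
        - RtoC (2 * PI) * power_sum (taylor_coeff f a r) (w - a) n)%C
  <= 2 * PI * (M * (Cmod (w - a) / r) ^ n * (r / (r - Cmod (w - a)))).
Proof.
  intros Hr Hf Hw HM; assert (HP := PI_RGT_0).
  assert (Np : RtoC (2 * PI) <> 0) by (apply RtoC_neq_0; lra).
  set (v := (w - a)%C).
  set (Rem := fun n => path_int (fun x => f (circle a r x) *
    ((v * / (RtoC r * cis x)) ^ n * cauchy_kernel a w r x))%C 0 (2 * PI)).
  assert (Cf : forall x, continuous_path (fun x => f (circle a r x)) x).
  { intros x; eapply continuous_path_on_circle; eauto; lra. }
  assert (Ce : forall n x, continuous_path (fun x => (v * / (RtoC r * cis x)) ^ n)%C x).
  { intros m x; apply (continuous_path_comp (fun z => (v * z) ^ m)%C (fun x => / (RtoC r * cis x))%C).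
    - apply ex_derive_cont_C, (ex_derive_C_pow (fun z => v * z)%C), ex_derive_C_mult;
        [apply ex_derive_C_const | apply ex_derive_C_id].
    - intros eps He; destruct (continuous_path_cis_pow r x 1 ltac:(lra) eps He) as [d [Hd K]].
      exists d; split; [exact Hd |]; intros y Hy; specialize (K y Hy).
      rewrite !Cpow_1_r in K; exact K. }
  assert (CK : forall x, continuous_path (cauchy_kernel a w r) x).
  { intros x; apply cauchy_kernel_continuous; [lra | exact Hw]. }
  assert (Rec : forall n, (path_int (fun x => f (circle a r x) * cauchy_kernel a w r x)%C 0 (2 * PI)
        - RtoC (2 * PI) * power_sum (taylor_coeff f a r) v n)%C = Rem n).
  { intros n0; induction n0 as [| m IH].
    - change (power_sum (taylor_coeff f a r) v 0) with (RtoC 0); unfold Rem.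
      match goal with |- (?x - ?c * RtoC 0)%C = _ => replace (x - c * RtoC 0)%C with x by ring end.
      apply path_int_ext; [lra |]; intros x _; simpl; ring.
    - simpl power_sum.
      match goal with |- (?x - ?c * (?p + ?q))%C = _ =>
        replace (x - c * (p + q))%C with ((x - c * p) - c * q)%C by ring end.
      rewrite IH; unfold Rem, taylor_coeff.
      match goal with |- (_ - ?c * (/ ?c * ?i * ?p))%C = _ =>
        replace (c * (/ c * i * p))%C with (p * i)%C by (field; exact Np) end.
      rewrite <- path_int_scal; [| lra |].
      2: intros x _; apply continuous_path_mult; [apply Cf | apply continuous_path_cis_pow; lra].
      rewrite <- path_int_minus; [| lra | |].
      + apply path_int_ext; [lra |]; intros x _.
        assert (Ne := RtoC_cis_neq_0 r x ltac:(lra)).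
        assert (Nw : (circle a r x - w)%C <> 0).
        { apply Cmod_gt_0; assert (H := Cmod_circle_sub_ge a w r x ltac:(lra)); lra. }
        unfold cauchy_kernel.
        assert (Ev : (circle a r x - w)%C = (RtoC r * cis x - v)%C) by (unfold circle, v; ring).
        rewrite Ev in *.
        set (e := (RtoC r * cis x)%C) in *.
        rewrite !Cpow_mult_l, !Cpow_inv, !Cpow_S by exact Ne.
        assert (NQ := Cpow_nz e m Ne); field; repeat split; assumption.
      + intros x _; apply continuous_path_mult; [apply Cf |]; apply continuous_path_mult; [apply Ce | apply CK].
      + intros x _; apply continuous_path_scal, continuous_path_mult; [apply Cf | apply continuous_path_cis_pow; lra]. }
  fold v; rewrite Rec; unfold Rem.
  replace (2 * PI * (M * (Cmod v / r) ^ n * (r / (r - Cmod v))))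
    with ((2 * PI - 0) * (M * ((Cmod v / r) ^ n * (r / (r - Cmod v))))) by ring.
  apply path_int_le; [lra | |].
  - intros x _; apply continuous_path_mult; [apply Cf |]; apply continuous_path_mult; [apply Ce | apply CK].
  - intros x _; rewrite !Cmod_mult.
    apply Rmult_le_compat; [apply Cmod_ge_0 | | |].
    + apply Rmult_le_pos; apply Cmod_ge_0.
    + apply HM, Cmod_circle; lra.
    + apply Rmult_le_compat; try apply Cmod_ge_0.
      * rewrite Cmod_pow, Cmod_mult, Cmod_inv, Cmod_mult, Cmod_cis, Cmod_R, Rabs_pos_eq, Rmult_1_r
          by (try lra; apply RtoC_cis_neq_0; lra).
        apply Rle_refl.
      * apply cauchy_kernel_le, Hw.
Qed.

Lemma pow_small (q B eps : R) : 0 <= q < 1 -> 0 <= B -> 0 < eps -> exists n, B * q ^ n < eps.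
Proof.
  intros Hq HB He.
  destruct (pow_lt_1_zero q ltac:(rewrite Rabs_pos_eq; lra) (eps / (B + 1))
    ltac:(apply Rdiv_lt_0_compat; lra)) as [n Hn].
  exists n; specialize (Hn n (le_n n)).
  assert (P : 0 <= q ^ n) by (apply pow_le; lra).
  rewrite Rabs_pos_eq in Hn by exact P.
  assert (q ^ n * (B + 1) < eps).
  { apply Rmult_lt_reg_r with (/ (B + 1)); [apply Rinv_0_lt_compat; lra |].
    rewrite Rmult_assoc, Rinv_r, Rmult_1_r by lra; exact Hn. }
  nra.
Qed.

(** The expansion of the constant 1. A coefficient of positive order [k] vanishes, because halving
    the radius multiplies it by [2^k] and yet leaves it unchanged. *)
Lemma cauchy_kernel_integral (a w : C) (r : R) :
  0 < r -> Cmod (w - a) < r -> path_int (cauchy_kernel a w r) 0 (2 * PI) = RtoC (2 * PI).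
Proof.
  intros Hr Hw; assert (HP := PI_RGT_0).
  assert (Np : RtoC (2 * PI) <> 0) by (apply RtoC_neq_0; lra).
  set (one := fun _ : C => RtoC 1).
  assert (H1 : holo_disc one a (r + 1)) by (intros z _; apply ex_derive_C_const).
  assert (C0 : taylor_coeff one a r 0 = 1).
  { unfold taylor_coeff, one; rewrite (path_int_ext _ (fun _ => RtoC 1)).
    - rewrite path_int_const by lra; rewrite Rminus_0_r; field; exact Np.
    - lra.
    - intros x _; simpl; field. }
  assert (Ck : forall k, taylor_coeff one a r (S k) = 0).
  { intros k.
    assert (E := taylor_coeff_shrink one a r (r + 1) (/ 2) (S k) ltac:(lra) H1 ltac:(lra)).
    assert (E2 : taylor_coeff one a (/ 2 * r) (S k) = (RtoC 2 ^ (S k) * taylor_coeff one a r (S k))%C).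
    { unfold taylor_coeff, one.
      rewrite (path_int_ext (fun x => 1 * / (RtoC (/ 2 * r) * cis x) ^ S k)%C
         (fun x => RtoC 2 ^ (S k) * (1 * / (RtoC r * cis x) ^ S k))%C).
      - rewrite path_int_scal; [ring | lra |].
        intros x _; apply continuous_path_scal, continuous_path_cis_pow, Hr.
      - lra.
      - intros x _.
        assert (N2 : RtoC 2 <> 0) by (apply RtoC_neq_0; lra).
        replace (RtoC (/ 2 * r) * cis x)%C with (/ RtoC 2 * (RtoC r * cis x))%C
          by (rewrite RtoC_mult, RtoC_inv by lra; ring).
        rewrite (Cpow_mult_l (/ RtoC 2)), Cpow_inv by exact N2.
        assert (Ne := Cpow_nz _ (S k) (RtoC_cis_neq_0 r x Hr)).
        assert (N3 := Cpow_nz _ (S k) N2).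
        field; split; assumption. }
    rewrite E2 in E.
    assert (E4 : (RtoC 2 ^ S k * taylor_coeff one a r (S k) - taylor_coeff one a r (S k))%C = 0).
    { rewrite E; ring. }
    replace (RtoC 2 ^ S k * taylor_coeff one a r (S k) - taylor_coeff one a r (S k))%C
      with ((RtoC 2 ^ S k - 1) * taylor_coeff one a r (S k))%C in E4 by ring.
    destruct (Cmult_integral _ _ E4) as [E5 | E5]; [exfalso | exact E5].
    rewrite <- RtoC_pow, <- RtoC_minus in E5; apply RtoC_inj in E5.
    assert (1 < 2 ^ S k) by (apply Rlt_pow_R1; [lra | lia]); lra. }
  assert (PS : forall n, power_sum (taylor_coeff one a r) (w - a) (S n) = 1).
  { induction n as [| n IH].
    - simpl; rewrite C0; ring.
    - change (power_sum (taylor_coeff one a r) (w - a) (S (S n))) with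
        (power_sum (taylor_coeff one a r) (w - a) (S n) + taylor_coeff one a r (S n) * (w - a) ^ (S n))%C.
      rewrite IH, Ck; ring. }
  apply Cmod_sub_eq_0, Rnot_lt_le; intros Hlt.
  assert (P := Cmod_ge_0 (w - a)).
  set (q := Cmod (w - a) / r).
  assert (Hq : 0 <= q < 1).
  { apply Rdiv_unit_interval; lra. }
  assert (PB : 0 < r / (r - Cmod (w - a))) by (apply Rdiv_lt_0_compat; lra).
  destruct (pow_small q (2 * PI * (r / (r - Cmod (w - a)))) _ Hq ltac:(nra) Hlt) as [n Hn].
  assert (E := cauchy_kernel_expansion one a w r (r + 1) 1 (S n) ltac:(lra) H1 Hw).
  specialize (E ltac:(intros z _; unfold one; rewrite Cmod_1; lra)).
  rewrite PS, Cmult_1_r in E.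
  rewrite (path_int_ext _ (cauchy_kernel a w r)) in E by (try lra; intros x _; unfold one; ring).
  fold q in E.
  assert (q ^ S n <= q ^ n).
  { simpl; assert (0 <= q ^ n) by (apply pow_le; lra); nra. }
  assert (2 * PI * (1 * q ^ S n * (r / (r - Cmod (w - a)))) <= 2 * PI * (r / (r - Cmod (w - a))) * q ^ n).
  { replace (2 * PI * (1 * q ^ S n * (r / (r - Cmod (w - a)))))
      with (2 * PI * (r / (r - Cmod (w - a))) * q ^ S n) by ring.
    apply Rmult_le_compat_l; [nra | assumption]. }
  lra.
Qed.

(** * Bounds on circles and Taylor's formula *)

Lemma polar (z : C) : Cmod z = 1 -> exists x, 0 <= x <= 2 * PI /\ z = cis x.
Proof.
  destruct z as [p q]; intros H.
  assert (E : p * p + q * q = 1).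
  { assert (E := Cmod2_alt (p, q)); rewrite H in E; simpl in E; lra. }
  assert (Hp : -1 <= p <= 1) by nra.
  assert (B := acos_bound p).
  assert (Es : sin (acos p) * sin (acos p) = q * q).
  { assert (S := sin2_cos2 (acos p)); unfold Rsqr in S; rewrite cos_acos in S by exact Hp; lra. }
  assert (Ps : 0 <= sin (acos p)) by (apply sin_ge_0; lra).
  destruct (Rle_dec 0 q) as [L | L].
  - exists (acos p); split; [lra |]; unfold cis; rewrite cos_acos by exact Hp; f_equal; nra.
  - exists (2 * PI - acos p); split; [lra |].
    unfold cis; rewrite cos_minus, sin_minus, cos_2PI, sin_2PI, cos_acos by exact Hp.
    f_equal; nra.
Qed.

Lemma circle_surjective (a z : C) (r : R) :
  0 < r -> Cmod (z - a) = r -> exists x, 0 <= x <= 2 * PI /\ z = circle a r x.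
Proof.
  intros Hr Hz.
  assert (Nr : RtoC r <> 0) by (apply RtoC_neq_0; lra).
  destruct (polar ((z - a) / RtoC r)%C) as [x [Hx E]].
  { rewrite Cmod_div, Cmod_R, Rabs_pos_eq, Hz by (auto; lra); field; lra. }
  exists x; split; [exact Hx |]; unfold circle; rewrite <- E; field; exact Nr.
Qed.

Lemma circle_bound (f : C -> C) (a : C) (r : R) :
  0 < r -> (forall z, Cmod (z - a) = r -> ex_derive f z) ->
  exists M, 0 < M /\ forall z, Cmod (z - a) = r -> Cmod (f z) <= M.
Proof.
  intros Hr Hf; assert (HP := PI_RGT_0).
  destruct (continuity_ab_maj (fun x => Cmod (f (circle a r x))) 0 (2 * PI)) as [x [Hx Px]]; [lra | |].
  - intros x _; apply continuity_pt_filterlim.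
    apply filterlim_locally; intros eps.
    assert (Cp : continuous_path (fun x => f (circle a r x)) x).
    { apply continuous_path_comp; [apply ex_derive_cont_C, Hf, Cmod_circle; lra |].
      apply continuous_path_circle. }
    destruct (Cp eps (cond_pos eps)) as [d [Hd K]].
    exists (mkposreal d Hd); intros y Hy; specialize (K y Hy).
    apply Rle_lt_trans with (2 := K).
    assert (E1 := Cmod_sub_ge (f (circle a r y)) (f (circle a r x))).
    assert (E2 := Cmod_sub_ge (f (circle a r x)) (f (circle a r y))).
    rewrite Cmod_sub_sym in E2.
    apply Rabs_le; unfold minus, plus, opp; simpl; lra.
  - exists (Cmod (f (circle a r x)) + 1); split.
    { assert (A := Cmod_ge_0 (f (circle a r x))); lra. }
    intros z Hz; destruct (circle_surjective a z r Hr Hz) as [y [Hy ->]].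
    specialize (Hx y Hy); simpl in Hx; lra.
Qed.

(** The coefficients are computed at radius [R / 2], but the estimates hold at every radius [r < R]
    since the coefficients do not depend on it. The remainder of order 1 at [w = a] identifies
    [c O]. *)
Lemma taylor (f : C -> C) (a : C) (R : R) :
  0 < R -> holo_disc f a R -> exists c : nat -> C, c O = f a /\
    (forall r M k, 0 < r < R -> (forall z, Cmod (z - a) = r -> Cmod (f z) <= M) ->
       Cmod (c k) * r ^ k <= M) /\
    (forall r M w n, 0 < r < R -> (forall z, Cmod (z - a) = r -> Cmod (f z) <= M) ->
       Cmod (w - a) < r ->
       Cmod (f w - power_sum c (w - a) n) <= M * (Cmod (w - a) / r) ^ n * (r / (r - Cmod (w - a)))).
Proof.
  intros HR Hf; assert (HP := PI_RGT_0).
    assert (T : forall r M w n, 0 < r < R -> (forall z, Cmod (z - a) = r -> Cmod (f z) <= M) ->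
    Cmod (w - a) < r -> Cmod (f w - power_sum (taylor_coeff f a (R / 2)) (w - a) n)
      <= M * (Cmod (w - a) / r) ^ n * (r / (r - Cmod (w - a)))).
  { intros r M w n Hr HM Hw.
    assert (E : power_sum (taylor_coeff f a (R / 2)) (w - a) n = power_sum (taylor_coeff f a r) (w - a) n).
    { induction n as [| n IH]; [reflexivity |]; simpl; rewrite IH.
      rewrite (taylor_coeff_indep f a (R / 2) r R n) by (auto; lra); reflexivity. }
    rewrite E.
    assert (G := cauchy_kernel_expansion f a w r R M n Hr Hf Hw HM).
    rewrite (cauchy_formula_kernel f a w r R) in G by (auto; lra).
    rewrite cauchy_kernel_integral in G by lra.
    match type of G with Cmod (f w * ?c - ?c * ?p) <= _ =>
      replace (f w * c - c * p)%C with (c * (f w - p))%C in G by ring end.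
    rewrite Cmod_mult, Cmod_R, Rabs_pos_eq in G by lra.
    apply Rmult_le_reg_l with (2 * PI); [lra | exact G]. }
  exists (taylor_coeff f a (R / 2)); split; [| split; [| exact T]].
  - destruct (circle_bound f a (R / 2)) as [M [_ HM]]; [lra | intros z Hz; apply Hf; lra |].
    symmetry; apply Cmod_sub_eq_0.
    assert (E := T (R / 2) M a 1%nat ltac:(lra) HM ltac:(rewrite Cmod_sub_self; lra)).
    simpl in E; rewrite Cmod_sub_self in E.
    match type of E with Cmod (_ - (_ + ?c * _)) <= _ =>
      replace (f a - (RtoC 0 + c * RtoC 1))%C with (f a - c)%C in E by ring end.
    replace (M * (0 / (R / 2) * 1) * (R / 2 / (R / 2 - 0))) with 0 in E by (field; lra).
    exact E.
  - intros r M k Hr HM.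
    rewrite (taylor_coeff_indep f a (R / 2) r R k) by (auto; lra).
    apply (taylor_coeff_le f a r R); auto.
Qed.

Lemma taylor_half (f : C -> C) (a : C) (r M : R) :
  0 < r -> holo_disc f a (2 * r) -> (forall z, Cmod (z - a) = r -> Cmod (f z) <= M) ->
  exists c : nat -> C, c O = f a /\ forall w n, Cmod (w - a) <= r / 2 ->
    Cmod (f w - power_sum c (w - a) n) <= 2 * M * (Cmod (w - a) / r) ^ n.
Proof.
  intros Hr Hf HM.
  destruct (taylor f a (2 * r) ltac:(lra) Hf) as (c & C0 & _ & T).
  exists c; split; [exact C0 |]; intros w n Hw; assert (Pw := Cmod_ge_0 (w - a)).
  assert (PM : 0 <= M).
  { apply Rle_trans with (Cmod (f (circle a r 0))); [apply Cmod_ge_0 | apply HM, Cmod_circle; lra]. }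
  apply Rle_trans with (1 := T r M w n ltac:(lra) HM ltac:(lra)).
  replace (2 * M * (Cmod (w - a) / r) ^ n) with (M * (Cmod (w - a) / r) ^ n * 2) by ring.
  apply Rmult_le_compat_l.
  - apply Rmult_le_pos; [exact PM | apply pow_le, Rdiv_le_0_compat; lra].
  - apply Rmult_le_reg_r with (r - Cmod (w - a)); [lra |].
    replace (r / (r - Cmod (w - a)) * (r - Cmod (w - a))) with r by (field; lra); lra.
Qed.

(** * Division by a zero, maximum principle and identity theorem *)

Lemma circle_lower_bound (f : C -> C) (a : C) (r : R) :
  0 < r -> (forall z, Cmod (z - a) = r -> ex_derive f z /\ f z <> 0) ->
  exists m, 0 < m /\ forall z, Cmod (z - a) = r -> m <= Cmod (f z).
Proof.
  intros Hr Hf.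
  destruct (circle_bound (fun z => / f z)%C a r Hr) as [M [HM K]].
  { intros z Hz; apply ex_derive_C_inv; apply Hf, Hz. }
  exists (/ M); split; [apply Rinv_0_lt_compat, HM |].
  intros z Hz; specialize (K z Hz).
  destruct (Hf z Hz) as [_ N]; assert (P := proj1 (Cmod_gt_0 _) N).
  rewrite Cmod_inv in K by exact N.
  rewrite <- (Rinv_inv (Cmod (f z))); apply Rinv_le_contravar; [| exact K].
  apply Rinv_0_lt_compat, P.
Qed.

(** Terms up to order 2 are kept because the quotient [(f w - f a) / (w - a)] has to be
    differentiated at [a]. *)
Lemma taylor_second_order (f : C -> C) (a : C) (R : R) :
  0 < R -> holo_disc f a R ->
  exists c1 c2 K d, 0 < d /\ 0 < K /\ forall w, Cmod (w - a) < d ->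
    Cmod (f w - (f a + c1 * (w - a) + c2 * (w - a) ^ 2)) <= K * Cmod (w - a) ^ 3.
Proof.
  intros HR Hf.
  destruct (circle_bound f a (R / 2)) as [M [PM HM]]; [lra | |].
  { intros z Hz; apply Hf; lra. }
  destruct (taylor_half f a (R / 2) M) as (c & <- & T); [lra | | exact HM |].
  { intros z Hz; apply Hf; lra. }
  exists (c 1%nat), (c 2%nat), (2 * M / (R / 2) ^ 3), (R / 4).
  split; [lra | split; [apply Rdiv_lt_0_compat; [lra | apply pow_lt; lra] |]].
  intros w Hw; assert (E := T w 3%nat ltac:(lra)).
  replace (power_sum c (w - a) 3) with (c O + c 1%nat * (w - a) + c 2%nat * (w - a) ^ 2)%C in E
    by (simpl; ring).
  apply Rle_trans with (1 := E), Req_le; field; lra.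
Qed.

Lemma is_derive_second_order (f : C -> C) (a c0 c1 : C) (K d : R) :
  0 < d -> (forall w, Cmod (w - a) < d -> Cmod (f w - (c0 + c1 * (w - a))) <= K * Cmod (w - a) ^ 2) ->
  f a = c0 /\ is_derive f a c1.
Proof.
  intros Hd H.
  assert (E0 : f a = c0).
  { apply Cmod_sub_eq_0; specialize (H a); rewrite Cmod_sub_self in H.
    replace (f a - (c0 + c1 * (a - a)))%C with (f a - c0)%C in H by ring.
    specialize (H Hd); simpl in H; lra. }
  split; [exact E0 |].
  assert (PK : K <= Rabs K) by apply Rle_abs; assert (PK' := Rabs_pos K).
  apply is_derive_C; intros eps He.
  assert (P : 0 < eps / (Rabs K + 1)) by (apply Rdiv_lt_0_compat; lra).
  exists (Rmin d (eps / (Rabs K + 1))); split; [apply Rmin_pos; assumption |].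
  intros w Hw.
  assert (H1 := H w (Rlt_le_trans _ _ _ Hw (Rmin_l _ _))).
  assert (H2 := Rlt_le_trans _ _ _ Hw (Rmin_r _ _)).
  rewrite E0; replace (f w - c0 - c1 * (w - a))%C with (f w - (c0 + c1 * (w - a)))%C by ring.
  apply Rle_trans with (1 := H1).
  assert (Pw := Cmod_ge_0 (w - a)).
  assert (Cmod (w - a) * (Rabs K + 1) <= eps).
  { apply Rmult_le_reg_r with (/ (Rabs K + 1)); [apply Rinv_0_lt_compat; lra |].
    rewrite Rmult_assoc, Rinv_r, Rmult_1_r by lra; unfold Rdiv in H2; lra. }
  assert (K * Cmod (w - a) <= eps) by nra.
  simpl; nra.
Qed.

(** A removable singularity: the quotient [f z / (z - b)] gets the value [l] at [b], and its
    derivative there is the second Taylor coefficient [c2] of [f]. *)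
Lemma holo_disc_divide (f : C -> C) (a b l : C) (R : R) :
  holo_disc f a R -> Cmod (b - a) < R -> f b = 0 -> is_derive f b l ->
  exists u, holo_disc u a R /\ u b = l /\ forall z, f z = ((z - b) * u z)%C.
Proof.
  intros Hf Hb F0 Hl.
  set (u := fun z => if excluded_middle_informative (z = b) then l else (f z / (z - b))%C).
  assert (Eu : forall z, f z = ((z - b) * u z)%C).
  { intros z; unfold u; destruct (excluded_middle_informative (z = b)) as [-> | N].
    - rewrite F0; ring.
    - field; apply Csub_neq_0, N. }
  exists u; split; [| split; [| exact Eu]].
  2: unfold u; destruct (excluded_middle_informative (b = b)); congruence.
  intros z Hz; destruct (classic (z = b)) as [-> | N].
  - destruct (taylor_second_order f b (R - Cmod (b - a))) as (c1 & c2 & K & d & Pd & PK & T); [lra | |].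
    { intros w Hw; apply Hf; assert (A := Cmod_sub_triangle w b a); lra. }
    rewrite F0 in T.
    destruct (is_derive_second_order f b 0 c1 (Cmod c2 + K) (Rmin d 1)) as [_ D]; [apply Rmin_pos; lra | |].
    { intros w Hw.
      destruct (Rmin_Rgt_l _ _ _ Hw) as [H1 H2].
      specialize (T w H1).
      replace (f w - (RtoC 0 + c1 * (w - b)))%C
        with ((f w - (RtoC 0 + c1 * (w - b) + c2 * (w - b) ^ 2)) + c2 * (w - b) ^ 2)%C by ring.
      apply Rle_trans with (1 := Cmod_triangle _ _).
      rewrite Cmod_mult, Cmod_pow.
      assert (Cmod (w - b) ^ 3 <= Cmod (w - b) ^ 2).
      { replace (Cmod (w - b) ^ 3) with (Cmod (w - b) * Cmod (w - b) ^ 2) by ring.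
        assert (0 <= Cmod (w - b) ^ 2) by apply pow2_ge_0; nra. }
      nra. }
    assert (El : l = c1) by exact (is_derive_C_unique f b l c1 Hl D).
    exists c2; apply (is_derive_second_order u b l c2 K d Pd).
    intros w Hw; destruct (classic (w = b)) as [-> | N].
    + unfold u; destruct (excluded_middle_informative (b = b)); [| congruence].
      replace (l - (l + c2 * (b - b)))%C with (RtoC 0) by ring.
      rewrite Cmod_0; apply Rmult_le_pos; [lra | apply pow2_ge_0].
    + assert (Pw := Cmod_sub_pos w b N).
      apply Rmult_le_reg_l with (1 := Pw).
      rewrite <- Cmod_mult.
      replace ((w - b) * (u w - (l + c2 * (w - b))))%C
        with ((w - b) * u w - (RtoC 0 + c1 * (w - b) + c2 * (w - b) ^ 2))%C by (rewrite El; ring).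
      rewrite <- Eu; specialize (T w Hw).
      replace (Cmod (w - b) * (K * Cmod (w - b) ^ 2)) with (K * Cmod (w - b) ^ 3) by ring; exact T.
  - apply (ex_derive_C_eq_near (fun w => f w / (w - b))%C u z (Cmod (z - b))).
    + apply Cmod_sub_pos, N.
    + intros w Hw; unfold u; destruct (excluded_middle_informative (w = b)) as [-> | _]; [| reflexivity].
      rewrite Cmod_sub_sym in Hw; lra.
    + apply ex_derive_C_div; [apply Hf, Hz | | apply Csub_neq_0, N].
      apply ex_derive_C_sub_const.
Qed.

(** The crude Cauchy bound for [f ^ n], with [n] tending to infinity. *)
Lemma maximum_principle (f : C -> C) (a w : C) (r R M : R) :
  r < R -> holo_disc f a R -> (forall z, Cmod (z - a) = r -> Cmod (f z) <= M) ->
  Cmod (w - a) < r -> Cmod (f w) <= M.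
Proof.
  intros HrR Hf HM Hw; assert (Pw := Cmod_ge_0 (w - a)).
  assert (PM : 0 <= M).
  { apply Rle_trans with (Cmod (f (circle a r 0))); [apply Cmod_ge_0 | apply HM, Cmod_circle; lra]. }
  set (B := r / (r - Cmod (w - a))).
  assert (PB : 0 < B) by (apply Rdiv_lt_0_compat; lra).
  assert (E : forall n, Cmod (f w) ^ n <= M ^ n * B).
  { intros n.
    assert (Hn : holo_disc (fun z => f z ^ n)%C a R) by (intros z Hz; apply ex_derive_C_pow, Hf, Hz).
    destruct (taylor _ a R ltac:(lra) Hn) as (c & _ & _ & T).
    assert (G := T r (M ^ n) w O ltac:(lra)).
    assert (G' : forall z, Cmod (z - a) = r -> Cmod (f z ^ n) <= M ^ n).
    { intros z Hz; rewrite Cmod_pow; apply pow_incr; split; [apply Cmod_ge_0 | apply HM, Hz]. }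
    specialize (G G' Hw); simpl in G.
    replace (f w ^ n - RtoC 0)%C with (f w ^ n)%C in G by ring.
    rewrite Cmod_pow, Rmult_1_r in G; exact G. }
  apply Rnot_lt_le; intros Hlt.
  assert (Pf : 0 < Cmod (f w)) by lra.
  destruct (pow_small (M / Cmod (f w)) B 1) as [n Hn]; [| lra | lra |].
  { apply Rdiv_unit_interval; lra. }
  specialize (E n).
  assert (Pn : 0 < Cmod (f w) ^ n) by (apply pow_lt, Pf).
  unfold Rdiv in Hn; rewrite Rpow_mult_distr, pow_inv in Hn.
  apply (Rmult_lt_compat_r (Cmod (f w) ^ n)) in Hn; [| exact Pn].
  replace (B * (M ^ n * / Cmod (f w) ^ n) * Cmod (f w) ^ n) with (M ^ n * B) in Hn by (field; lra).
  lra.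
Qed.

Lemma power_sum_zero (c : nat -> C) (v : C) (n : nat) : (forall k, c k = 0) -> power_sum c v n = 0.
Proof.
  intros H; induction n as [| n IH]; simpl; [reflexivity |]; rewrite IH, H; ring.
Qed.

(** Cauchy's estimate with bound 0 on a circle inside the small disc kills all coefficients; the
    Taylor remainder on a circle beyond [z] then tends to 0. *)
Lemma identity_theorem (f : C -> C) (a : C) (d R : R) :
  0 < d -> holo_disc f a R -> (forall z, Cmod (z - a) < d -> f z = 0) ->
  forall z, Cmod (z - a) < R -> f z = 0.
Proof.
  intros Hd Hf Z z Hz; assert (Pz := Cmod_ge_0 (z - a)).
  assert (HR : 0 < R) by lra.
  destruct (taylor f a R HR Hf) as (c & _ & E & T).
  set (r := Rmin (d / 2) (R / 2)).
  assert (Pr : 0 < r) by (apply Rmin_pos; lra).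
  assert (R1 : r <= d / 2) by apply Rmin_l; assert (R2 : r <= R / 2) by apply Rmin_r.
  assert (Ck : forall k, c k = 0).
  { intros k; apply Cmod_eq_0, Rle_antisym; [| apply Cmod_ge_0].
    assert (G := E r 0 k ltac:(lra)).
    specialize (G ltac:(intros w Hw; rewrite Z, Cmod_0; lra)).
    assert (P : 0 < r ^ k) by (apply pow_lt, Pr); nra. }
  set (s := (Cmod (z - a) + R) / 2).
  destruct (circle_bound f a s) as [M [PM HM]]; [unfold s; lra | |].
  { intros w Hw; apply Hf; unfold s in *; lra. }
  apply Cmod_eq_0, Rle_antisym; [| apply Cmod_ge_0].
  apply Rnot_lt_le; intros Hlt.
  destruct (pow_small (Cmod (z - a) / s) (M * (s / (s - Cmod (z - a)))) (Cmod (f z))) as [n Hn].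
  - apply Rdiv_unit_interval; unfold s; lra.
  - apply Rmult_le_pos; [lra |]; apply Rlt_le, Rdiv_lt_0_compat; unfold s; lra.
  - exact Hlt.
  - assert (G := T s M z n ltac:(unfold s; lra) HM ltac:(unfold s; lra)).
    rewrite power_sum_zero in G by exact Ck.
    replace (f z - RtoC 0)%C with (f z) in G by ring; lra.
Qed.

(** * Schwarz-Pick, Harnack and Julia *)

Lemma Cmod_sub_0 (z : C) : Cmod (z - 0) = Cmod z.
Proof. f_equal; ring. Qed.

Lemma schwarz_lemma (f : C -> C) (z : C) :
  holo_disc f 0 1 -> (forall w, Cmod w < 1 -> Cmod (f w) <= 1) -> f 0 = 0 ->
  Cmod z < 1 -> Cmod (f z) <= Cmod z.
Proof.
  intros Hf H1 F0 Hz.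
  destruct (Hf 0) as [l Hl]; [rewrite Cmod_sub_0, Cmod_0; lra |].
  destruct (holo_disc_divide f 0 0 l 1) as (u & Hu & _ & Eu); auto.
  { rewrite Cmod_sub_0, Cmod_0; lra. }
  assert (Pz := Cmod_ge_0 z).
  assert (B : forall r, Cmod z < r < 1 -> Cmod (u z) <= / r).
  { intros r Hr; apply (maximum_principle u 0 z r 1); auto; [lra | | rewrite Cmod_sub_0; lra].
    intros w Hw; rewrite Cmod_sub_0 in Hw.
    specialize (H1 w ltac:(lra)); rewrite Eu, Cmod_mult, Cmod_sub_0, Hw in H1.
    apply Rmult_le_reg_l with r; [lra |]; rewrite Rinv_r; lra. }
  assert (U : Cmod (u z) <= 1).
  { apply Rnot_lt_le; intros Hlt.
    (* A radius below 1 that exceeds both [Cmod z] and [/ Cmod (u z)], so that [B] is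
       contradicted. *)
    set (r := Rmax ((1 + Cmod z) / 2) ((1 + / Cmod (u z)) / 2)).
    assert (Q : 0 < / Cmod (u z)) by (apply Rinv_0_lt_compat; lra).
    assert (Q' : / Cmod (u z) < 1) by (rewrite <- Rinv_1; apply Rinv_lt_contravar; lra).
    assert (R1 : r < 1) by (apply Rmax_lub_lt; lra).
    assert (R2 : (1 + Cmod z) / 2 <= r) by apply Rmax_l.
    assert (R3 : (1 + / Cmod (u z)) / 2 <= r) by apply Rmax_r.
    specialize (B r ltac:(lra)).
    assert (Q2 : / r < / / Cmod (u z)) by (apply Rinv_lt_contravar; [nra | lra]).
    rewrite Rinv_inv in Q2; lra. }
  rewrite Eu, Cmod_mult, Cmod_sub_0; nra.
Qed.

(** Dividing by [Cmod (1 - Cconj y * x)^2] gives one minus the squared pseudo-hyperbolic distance.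
    Hyperbolic estimates are stated without division below, as [Cmod (x - y) <= t * Cmod (1 - Cconj
    y * x)]. *)
Lemma pick_identity (x y : C) :
  Cmod (1 - Cconj y * x) ^ 2 - Cmod (x - y) ^ 2 = (1 - Cmod x ^ 2) * (1 - Cmod y ^ 2).
Proof. rewrite !Cmod2_alt; destruct x, y; simpl; ring. Qed.

Lemma one_sub_conj_ge (x y : C) : Cmod y <= 1 -> 1 - Cmod x <= Cmod (1 - Cconj y * x).
Proof.
  intros H; apply Rle_trans with (2 := Cmod_sub_ge _ _).
  rewrite Cmod_1, Cmod_mult, Cmod_conj; assert (A := Cmod_ge_0 x); nra.
Qed.

Lemma one_sub_conj_sym (x y : C) : Cmod (1 - Cconj y * x) = Cmod (1 - Cconj x * y).
Proof.
  rewrite <- Cmod_conj; f_equal; destruct x, y; apply injective_projections; simpl; ring.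
Qed.

Definition moebius (b z : C) : C := ((z + b) / (1 + Cconj b * z))%C.

Lemma moebius_den (b z : C) : Cmod b < 1 -> Cmod z < 1 -> (1 + Cconj b * z)%C <> 0.
Proof.
  intros Hb Hz; apply Cmod_gt_0.
  replace (1 + Cconj b * z)%C with (1 - Cconj (- b) * z)%C
    by (destruct b, z; apply injective_projections; simpl; ring).
  assert (A := one_sub_conj_ge z (- b)%C); rewrite Cmod_opp in A; lra.
Qed.

Lemma moebius_lt_1 (b z : C) : Cmod b < 1 -> Cmod z < 1 -> Cmod (moebius b z) < 1.
Proof.
  intros Hb Hz; assert (N := moebius_den b z Hb Hz).
  assert (P := proj1 (Cmod_gt_0 _) N).
  assert (E := pick_identity z (- b)%C).
  replace (1 - Cconj (- b) * z)%C with (1 + Cconj b * z)%C in E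
    by (destruct b, z; apply injective_projections; simpl; ring).
  replace (z - - b)%C with (z + b)%C in E by ring; rewrite Cmod_opp in E.
  unfold moebius; rewrite Cmod_div by exact N.
  apply Rmult_lt_reg_r with (1 := P).
  unfold Rdiv; rewrite Rmult_assoc, Rinv_l, Rmult_1_r, Rmult_1_l by lra.
  assert (P1 := Cmod_ge_0 b); assert (P2 := Cmod_ge_0 z).
  assert (0 < (1 - Cmod z ^ 2) * (1 - Cmod b ^ 2)) by (apply Rmult_lt_0_compat; nra).
  nra.
Qed.

Lemma moebius_0 (b : C) : moebius b 0 = b.
Proof. unfold moebius; rewrite Cmult_0_r; field; intros E; injection E; lra. Qed.

Lemma moebius_opp_self (b : C) : moebius (- b) b = 0.
Proof. unfold moebius; replace (b + - b)%C with (RtoC 0) by ring; unfold Cdiv; ring. Qed.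

Lemma moebius_opp_cancel (b z : C) : Cmod b < 1 -> Cmod z < 1 -> moebius b (moebius (- b) z) = z.
Proof.
  intros Hb Hz.
  assert (Hb' : Cmod (- b) < 1) by (rewrite Cmod_opp; exact Hb).
  assert (N1 := moebius_den (- b) z Hb' Hz).
  assert (N2 := moebius_den b _ Hb (moebius_lt_1 _ _ Hb' Hz)).
  unfold moebius in *.
  assert (Eo : Cconj (- b) = (- Cconj b)%C) by (destruct b; apply injective_projections; simpl; ring).
  rewrite Eo in *.
  assert (E : (1 + Cconj b * ((z + - b) / (1 + - Cconj b * z)))%C =
    ((1 - Cconj b * b) / (1 + - Cconj b * z))%C) by (field; exact N1).
  assert (E2 : ((z + - b) / (1 + - Cconj b * z) + b)%C =
    ((1 - Cconj b * b) * z / (1 + - Cconj b * z))%C) by (field; exact N1).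
  rewrite E in N2 |- *; rewrite E2.
  assert (N3 : (1 - Cconj b * b)%C <> 0).
  { intros E3; apply N2; rewrite E3; unfold Cdiv; ring. }
  field; split; assumption.
Qed.

Lemma ex_derive_moebius (b z : C) : Cmod b < 1 -> Cmod z < 1 -> ex_derive (moebius b) z.
Proof.
  intros Hb Hz; unfold moebius; apply ex_derive_C_div; [| | apply moebius_den; assumption].
  - apply ex_derive_C_plus_const.
  - apply ex_derive_C_affine.
Qed.

Lemma Cmod_moebius_opp (x y : C) :
  Cmod x < 1 -> Cmod y < 1 -> Cmod (moebius (- y) x) = Cmod (x - y) / Cmod (1 - Cconj y * x).
Proof.
  intros Hx Hy; unfold moebius; rewrite Cmod_div by (apply moebius_den; rewrite ?Cmod_opp; assumption).
  f_equal; f_equal; destruct x, y; apply injective_projections; simpl; ring.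
Qed.

Lemma schwarz_pick (f : C -> C) (x y : C) :
  holo_disc f 0 1 -> (forall w, Cmod w < 1 -> Cmod (f w) < 1) -> Cmod x < 1 -> Cmod y < 1 ->
  Cmod (f x - f y) * Cmod (1 - Cconj y * x) <= Cmod (x - y) * Cmod (1 - Cconj (f y) * f x).
Proof.
  intros Hf H1 Hx Hy.
  assert (Hfx := H1 x Hx); assert (Hfy := H1 y Hy).
  assert (Hfy' : Cmod (- f y) < 1) by (rewrite Cmod_opp; exact Hfy).
  assert (Hy' : Cmod (- y) < 1) by (rewrite Cmod_opp; exact Hy).
  assert (E := schwarz_lemma (fun z => moebius (- f y) (f (moebius y z))) (moebius (- y) x)).
  cbv beta in E; rewrite moebius_opp_cancel, moebius_0, moebius_opp_self in E by assumption.
  rewrite !Cmod_moebius_opp in E by assumption.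
  assert (E' : Cmod (f x - f y) / Cmod (1 - Cconj (f y) * f x) <= Cmod (x - y) / Cmod (1 - Cconj y * x)).
  { apply E; [| | reflexivity |].
    - intros z Hz; rewrite Cmod_sub_0 in Hz.
      apply (ex_derive_C_comp (moebius (- f y)) (fun z => f (moebius y z))).
      + apply ex_derive_moebius; [exact Hfy' | apply H1, moebius_lt_1; assumption].
      + apply (ex_derive_C_comp f (moebius y)); [| apply ex_derive_moebius; assumption].
        apply Hf; rewrite Cmod_sub_0; apply moebius_lt_1; assumption.
    - intros w Hw; apply Rlt_le, moebius_lt_1; [exact Hfy' | apply H1, moebius_lt_1; assumption].
    - rewrite <- Cmod_moebius_opp by assumption; apply moebius_lt_1; assumption. }
  assert (P1 : 0 < Cmod (1 - Cconj y * x)) by (assert (A := one_sub_conj_ge x y); lra).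
  assert (P2 : 0 < Cmod (1 - Cconj (f y) * f x)) by (assert (A := one_sub_conj_ge (f x) (f y)); lra).
  apply (Rmult_le_compat_r (Cmod (1 - Cconj y * x) * Cmod (1 - Cconj (f y) * f x))) in E'; [| nra].
  match type of E' with ?p <= ?q =>
    replace p with (Cmod (f x - f y) * Cmod (1 - Cconj y * x)) in E' by (field; lra);
    replace q with (Cmod (x - y) * Cmod (1 - Cconj (f y) * f x)) in E' by (field; lra) end.
  exact E'.
Qed.

(** Schwarz-Pick in terms of the defects [1 - Cmod^2], the form that remains informative when one of
    the points tends to the unit circle. *)
Lemma schwarz_pick_defect (f : C -> C) (x y : C) :
  holo_disc f 0 1 -> (forall w, Cmod w < 1 -> Cmod (f w) < 1) -> Cmod x < 1 -> Cmod y < 1 ->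
  (1 - Cmod x ^ 2) * (1 - Cmod y ^ 2) * Cmod (1 - Cconj (f y) * f x) ^ 2 <=
  (1 - Cmod (f x) ^ 2) * (1 - Cmod (f y) ^ 2) * Cmod (1 - Cconj y * x) ^ 2.
Proof.
  intros Hf H1 Hx Hy.
  assert (E := schwarz_pick f x y Hf H1 Hx Hy).
  rewrite <- !pick_identity.
  assert (P1 := Cmod_ge_0 (f x - f y)); assert (P2 := Cmod_ge_0 (1 - Cconj y * x)).
  assert (E2 : (Cmod (f x - f y) * Cmod (1 - Cconj y * x)) ^ 2 <=
    (Cmod (x - y) * Cmod (1 - Cconj (f y) * f x)) ^ 2).
  { apply pow_incr; split; [apply Rmult_le_pos; assumption | exact E]. }
  rewrite !Rpow_mult_distr in E2; lra.
Qed.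

(** Schwarz-Pick for [q], the Cayley transform of the half-plane that sends [g y] to 0; the
    denominator of [q x] is at most [Cmod (g x - g y) + 2 * Re (g y)]. *)
Lemma harnack (f : C -> C) (x y : C) (t : R) :
  holo_disc f 0 1 -> (forall w, Cmod w < 1 -> 0 <= Re (f w)) -> Cmod x < 1 -> Cmod y < 1 ->
  Cmod (x - y) <= t * Cmod (1 - Cconj y * x) -> 0 <= t ->
  Cmod (f x - f y) * (1 - t) <= 2 * t * Re (f y).
Proof.
  intros Hf Hre Hx Hy Ht Pt.
  destruct (Rle_lt_dec 1 t) as [L | L].
  { assert (A := Hre y Hy); assert (B := Cmod_ge_0 (f x - f y)); nra. }
  apply le_epsilon; intros eps He.
  (* The shift by [e] makes the real part strictly positive and costs [2 * t * e <= eps]. *)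
  set (e := eps / 2).
  set (g := fun z => (f z + RtoC e)%C).
  assert (Rg : forall z, Cmod z < 1 -> 0 < Re (g z)).
  { intros z Hz; specialize (Hre z Hz); unfold g; rewrite re_plus, re_RtoC; unfold e; lra. }
  set (q := fun z => ((g z - g y) / (g z + Cconj (g y)))%C).
  assert (Ny : forall z, Cmod z < 1 -> Cmod (g z - g y) < Cmod (g z + Cconj (g y))).
  { intros z Hz.
    assert (E : Cmod (g z + Cconj (g y)) ^ 2 - Cmod (g z - g y) ^ 2 = 4 * Re (g z) * Re (g y)).
    { rewrite !Cmod2_alt; destruct (g z), (g y); simpl; ring. }
    assert (P1 := Rg z Hz); assert (P2 := Rg y Hy).
    assert (P4 := Cmod_ge_0 (g z + Cconj (g y))).
    assert (0 < 4 * Re (g z) * Re (g y)) by (repeat apply Rmult_lt_0_compat; lra).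
    nra. }
  assert (Nq : forall z, Cmod z < 1 -> (g z + Cconj (g y))%C <> 0).
  { intros z Hz; apply Cmod_gt_0; assert (P := Cmod_ge_0 (g z - g y)); specialize (Ny z Hz); lra. }
  assert (Hq : holo_disc q 0 1).
  { intros z Hz; rewrite Cmod_sub_0 in Hz.
    assert (Dg : ex_derive g z).
    { apply ex_derive_C_plus; [apply Hf; rewrite Cmod_sub_0; exact Hz | apply ex_derive_C_const]. }
    apply ex_derive_C_div; [| | apply Nq, Hz].
    - apply ex_derive_C_minus; [exact Dg | apply ex_derive_C_const].
    - apply ex_derive_C_plus; [exact Dg | apply ex_derive_C_const]. }
  assert (Q1 : forall z, Cmod z < 1 -> Cmod (q z) < 1).
  { intros z Hz; unfold q; rewrite Cmod_div by (apply Nq, Hz).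
    assert (P := proj1 (Cmod_gt_0 _) (Nq z Hz)).
    apply Rmult_lt_reg_r with (1 := P).
    unfold Rdiv; rewrite Rmult_assoc, Rinv_l, Rmult_1_r, Rmult_1_l by lra; apply Ny, Hz. }
  assert (E := schwarz_pick q x y Hq Q1 Hx Hy).
  assert (Qy : q y = 0) by (unfold q; replace (g y - g y)%C with (RtoC 0) by ring; unfold Cdiv; ring).
  rewrite Qy, Cmod_sub_0 in E.
  replace (1 - Cconj 0 * q x)%C with (RtoC 1) in E
    by (destruct (q x); apply injective_projections; simpl; ring).
  rewrite Cmod_1, Rmult_1_r in E.
  assert (P1 : 0 < Cmod (1 - Cconj y * x)) by (assert (A := one_sub_conj_ge x y); lra).
  assert (Qx : Cmod (q x) <= t).
  { apply Rmult_le_reg_r with (1 := P1); lra. }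
  unfold q in Qx; rewrite Cmod_div in Qx by (apply Nq, Hx).
  assert (Pd := proj1 (Cmod_gt_0 _) (Nq x Hx)).
  apply (Rmult_le_compat_r _ _ _ (Rlt_le _ _ Pd)) in Qx.
  unfold Rdiv in Qx; rewrite Rmult_assoc, Rinv_l, Rmult_1_r in Qx by lra.
  assert (T : Cmod (g x + Cconj (g y)) <= Cmod (g x - g y) + 2 * Re (g y)).
  { replace (g x + Cconj (g y))%C with ((g x - g y) + RtoC (2 * Re (g y)))%C
      by (destruct (g x), (g y); apply injective_projections; simpl; ring).
    apply Rle_trans with (1 := Cmod_triangle _ _); rewrite Cmod_R, Rabs_pos_eq; [lra |].
    specialize (Rg y Hy); lra. }
  assert (Eg : (g x - g y)%C = (f x - f y)%C) by (unfold g; ring).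
  assert (Er : Re (g y) = Re (f y) + e) by (unfold g; rewrite re_plus, re_RtoC; reflexivity).
  rewrite Eg, Er in *.
  assert (2 * t * e <= eps) by (unfold e; nra).
  nra.
Qed.

(** The numerator carries the factor [1 - Cmod a^2 <= 2 * (1 - Cmod a)] and the denominator is at
    least [1 - Cmod a], so the bound is uniform in [a]. *)
Lemma moebius_dist_center (a z : C) :
  Cmod a < 1 -> Cmod z < 1 -> Cmod (moebius a z - a) <= 2 * Cmod z.
Proof.
  intros Ha Hz; assert (N := moebius_den a z Ha Hz).
  assert (Pa := Cmod_ge_0 a); assert (Pz := Cmod_ge_0 z).
  replace (moebius a z - a)%C with (z * (1 - Cconj a * a) / (1 + Cconj a * z))%C
    by (unfold moebius; field; exact N).
  rewrite Cmod_div, Cmod_mult by exact N.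
  assert (P := proj1 (Cmod_gt_0 _) N).
  assert (E1 : Cmod (1 - Cconj a * a) = 1 - Cmod a ^ 2).
  { assert (E := pick_identity a a); rewrite Cmod_sub_self in E.
    assert (P1 := Cmod_ge_0 (1 - Cconj a * a)).
    assert (0 <= 1 - Cmod a ^ 2) by nra.
    apply Rsqr_inj; [exact P1 | assumption | unfold Rsqr; lra]. }
  assert (E2 : 1 - Cmod a <= Cmod (1 + Cconj a * z)).
  { replace (1 + Cconj a * z)%C with (1 - (- Cconj a * z))%C by ring.
    apply Rle_trans with (2 := Cmod_sub_ge _ _).
    rewrite Cmod_1, Cmod_mult, Cmod_opp, Cmod_conj; nra. }
  rewrite E1; apply Rmult_le_reg_r with (1 := P).
  unfold Rdiv; rewrite Rmult_assoc, Rinv_l, Rmult_1_r by lra.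
  apply Rle_trans with (2 * Cmod z * (1 - Cmod a)).
  { rewrite (Rmult_comm 2), Rmult_assoc; apply Rmult_le_compat_l; [exact Pz |].
    assert (A := pow2_ge_0 (1 - Cmod a)); lra. }
  apply Rmult_le_compat_l; lra.
Qed.

Lemma power_sum_le (c : nat -> C) (v : C) (e q : R) (n : nat) :
  0 < q <= 1 -> Cmod v <= 1 -> 0 <= e -> (forall k, Cmod (c k) * q ^ k <= e) ->
  Cmod (power_sum c v n) * q ^ n <= INR n * e.
Proof.
  intros Hq Hv He Hc; induction n as [| n IH].
  - simpl; rewrite Cmod_0; lra.
  - rewrite S_INR; simpl power_sum.
    assert (Pq : 0 < q ^ n) by (apply pow_lt; lra).
    apply Rle_trans with ((Cmod (power_sum c v n) + Cmod (c n * v ^ n)%C) * q ^ S n).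
    + apply Rmult_le_compat_r; [apply pow_le; lra | apply Cmod_triangle].
    + rewrite Cmod_mult, Cmod_pow.
      assert (V : Cmod v ^ n <= 1).
      { rewrite <- (pow1 n); apply pow_incr; split; [apply Cmod_ge_0 | exact Hv]. }
      assert (V0 : 0 <= Cmod v ^ n) by (apply pow_le, Cmod_ge_0).
      assert (Hc' := Hc n); assert (P1 := Cmod_ge_0 (c n)); assert (P2 := Cmod_ge_0 (power_sum c v n)).
      replace ((Cmod (power_sum c v n) + Cmod (c n) * Cmod v ^ n) * q ^ S n)
        with (q * (Cmod (power_sum c v n) * q ^ n) + (q * Cmod v ^ n) * (Cmod (c n) * q ^ n)) by (simpl; ring).
      assert (0 <= Cmod (power_sum c v n) * q ^ n) by (apply Rmult_le_pos; lra).
      assert (0 <= Cmod (c n) * q ^ n) by (apply Rmult_le_pos; lra).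
      assert (q * Cmod v ^ n <= 1) by nra.
      assert (0 <= q * Cmod v ^ n) by (apply Rmult_le_pos; lra).
      nra.
Qed.

(** A quantitative Vitali theorem: move [a] to the origin by a disc automorphism; the Taylor
    coefficients there are controlled by the bound on the small disc. *)
Lemma small_on_small_disc (a : C) (r r1 eps : R) :
  Cmod a < 1 -> 0 < r -> r1 < 1 -> 0 < eps ->
  exists eta, 0 < eta /\ forall f : C -> C, holo_disc f 0 1 ->
    (forall z, Cmod z < 1 -> Cmod (f z) <= 2) ->
    (forall z, Cmod z < 1 -> Cmod (z - a) < r -> Cmod (f z) <= eta) ->
    forall z, Cmod z <= r1 -> Cmod (f z) <= eps.
Proof.
  intros Ha Hr Hr1 He; assert (Pa := Cmod_ge_0 a).
  destruct (Rlt_le_dec r1 0) as [L0 | L0].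
  { exists 1; split; [lra |]; intros f _ _ _ z Hz; assert (P := Cmod_ge_0 z); lra. }
  (* For [Cmod z <= r1], as [Cmod (1 - Cconj a * z) <= 2], [pick_identity] bounds the squared
     modulus of [moebius (- a) z] by [1 - kap], hence its modulus by [1 - kap / 2]. *)
  set (kap := (1 - r1 ^ 2) * (1 - Cmod a ^ 2) / 4).
  assert (A1 : 0 < 1 - r1 ^ 2 <= 1) by (simpl; nra).
  assert (A2 : 0 < 1 - Cmod a ^ 2 <= 1) by (simpl; nra).
  assert (Pk : 0 < kap <= / 4) by (unfold kap; nra).
  (* A circle strictly between radius [1 - kap / 2] and the unit circle: on it [f] is bounded by 2,
     and the Taylor remainder decays like [q^n]. *)
  set (r3 := 1 - kap / 4).
  set (q := (1 - kap / 2) / r3).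
  assert (Hq : 0 <= q < 1).
  { apply Rdiv_unit_interval; unfold r3; lra. }
  set (B := r3 / (kap / 4)).
  assert (PB : 0 < B) by (apply Rdiv_lt_0_compat; unfold r3; lra).
  destruct (pow_small q (2 * B) (eps / 2) Hq ltac:(lra) ltac:(lra)) as [n Hn].
  (* [moebius a] maps the circle of radius [d] into the disc of radius [r] around [a], so Cauchy's
     estimate on it sees the bound [eta]. The value of [eta] below keeps the first [n] Taylor terms
     under [eps / 2]. *)
  set (d := Rmin (r / 4) (/ 2)).
  assert (Pd : 0 < d) by (apply Rmin_pos; lra).
  assert (D1 : d <= r / 4) by apply Rmin_l; assert (D2 : d <= / 2) by apply Rmin_r.
  assert (Pdn : 0 < d ^ n) by (apply pow_lt, Pd).
  assert (PI := pos_INR n).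
  exists (eps / 2 * d ^ n / (INR n + 1)); split.
  { apply Rdiv_lt_0_compat; [nra | lra]. }
  intros f Hf F2 Fe z Hz; assert (Pz := Cmod_ge_0 z).
  set (F := fun u => f (moebius a u)).
  assert (HF : holo_disc F 0 1).
  { intros u Hu; rewrite Cmod_sub_0 in Hu.
    apply (ex_derive_C_comp f (moebius a)); [| apply ex_derive_moebius; assumption].
    apply Hf; rewrite Cmod_sub_0; apply moebius_lt_1; assumption. }
  set (u := moebius (- a) z).
  assert (Ef : F u = f z) by (unfold F, u; rewrite moebius_opp_cancel; auto; lra).
  assert (Hu : Cmod u <= 1 - kap / 2).
  { unfold u; rewrite Cmod_moebius_opp by lra.
    assert (P1 : 0 < Cmod (1 - Cconj a * z)) by (assert (A := one_sub_conj_ge z a); lra).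
    assert (E := pick_identity z a).
    assert (U2 : Cmod (1 - Cconj a * z) <= 2).
    { apply Rle_trans with (1 := Cmod_sub_le _ _); rewrite Cmod_1, Cmod_mult, Cmod_conj; nra. }
    assert (Ez : 4 * kap <= (1 - Cmod z ^ 2) * (1 - Cmod a ^ 2)).
    { unfold kap; replace (4 * ((1 - r1 ^ 2) * (1 - Cmod a ^ 2) / 4)) with ((1 - r1 ^ 2) * (1 - Cmod a ^ 2)) by field.
      apply Rmult_le_compat_r; [lra | simpl; nra]. }
    apply Rmult_le_reg_r with (1 := P1).
    replace (Cmod (z - a) / Cmod (1 - Cconj a * z) * Cmod (1 - Cconj a * z)) with (Cmod (z - a)) by (field; lra).
    set (X := Cmod (z - a)) in *; set (Y := Cmod (1 - Cconj a * z)) in *.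
    apply Rnot_lt_le; intros Hlt.
    assert (((1 - kap / 2) * Y) ^ 2 < X ^ 2).
    { simpl; assert (0 <= (1 - kap / 2) * Y) by (apply Rmult_le_pos; lra); nra. }
    assert (Y ^ 2 <= 4) by (simpl; nra).
    assert (X ^ 2 <= Y ^ 2 * (1 - kap)) by nra.
    assert (Y ^ 2 * (1 - kap) <= ((1 - kap / 2) * Y) ^ 2).
    { rewrite Rpow_mult_distr, Rmult_comm; apply Rmult_le_compat_r; [apply pow2_ge_0 | simpl; nra]. }
    lra. }
  destruct (taylor F 0 1 Rlt_0_1 HF) as (c & _ & E & T).
  assert (Hc : forall k, Cmod (c k) * d ^ k <= eps / 2 * d ^ n / (INR n + 1)).
  { intros k; apply E; [lra |].
    intros v Hv; rewrite Cmod_sub_0 in Hv; apply Fe.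
    - apply moebius_lt_1; lra.
    - apply Rle_lt_trans with (1 := moebius_dist_center a v Ha ltac:(lra)); lra. }
  assert (Pe : 0 <= eps / 2 * d ^ n / (INR n + 1)) by (apply Rdiv_le_0_compat; nra).
  assert (S1 := power_sum_le c u _ d n ltac:(lra) ltac:(lra) Pe Hc).
  assert (S2 : Cmod (power_sum c u n) <= eps / 2).
  { apply Rmult_le_reg_r with (1 := Pdn); apply Rle_trans with (1 := S1).
    replace (INR n * (eps / 2 * d ^ n / (INR n + 1))) with (eps / 2 * d ^ n * (INR n / (INR n + 1))) by (field; lra).
    rewrite <- (Rmult_1_r (eps / 2 * d ^ n)) at 2.
    apply Rmult_le_compat_l; [nra |].
    apply Rmult_le_reg_r with (INR n + 1); [lra |].
    replace (INR n / (INR n + 1) * (INR n + 1)) with (INR n) by (field; lra); lra. }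
  assert (G := T r3 2 u n ltac:(unfold r3; lra)).
  assert (G' : forall z0, Cmod (z0 - 0) = r3 -> Cmod (F z0) <= 2).
  { intros v Hv; rewrite Cmod_sub_0 in Hv; apply F2, moebius_lt_1; unfold r3 in *; lra. }
  specialize (G G' ltac:(rewrite Cmod_sub_0; unfold r3; lra)).
  rewrite Cmod_sub_0 in G.
  replace (u - RtoC 0)%C with u in G by ring.
  assert (Pu := Cmod_ge_0 u).
  assert (Q1 : (Cmod u / r3) ^ n <= q ^ n).
  { apply pow_incr; split; [apply Rdiv_le_0_compat; unfold r3; lra |].
    unfold q; apply Rmult_le_compat_r; [apply Rlt_le, Rinv_0_lt_compat; unfold r3; lra | exact Hu]. }
  assert (Q2 : r3 / (r3 - Cmod u) <= B).
  { unfold B; apply Rmult_le_compat_l; [unfold r3; lra |].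
    apply Rinv_le_contravar; unfold r3; lra. }
  assert (Q3 : 0 <= r3 / (r3 - Cmod u)) by (apply Rdiv_le_0_compat; unfold r3; lra).
  assert (Q4 : 0 <= (Cmod u / r3) ^ n) by (apply pow_le, Rdiv_le_0_compat; unfold r3; lra).
  rewrite <- Ef.
  replace (F u) with ((F u - power_sum c u n) + power_sum c u n)%C by ring.
  apply Rle_trans with (1 := Cmod_triangle _ _); nra.
Qed.

Lemma one_sub_sq_le (x y : C) :
  Cmod x <= 1 -> 1 - Cmod x ^ 2 <= Cmod (1 - Cconj y * x) + Cmod (x - y).
Proof.
  intros Hx; assert (P := Cmod_ge_0 x).
  replace (1 - Cmod x ^ 2) with (Cmod (RtoC (1 - Cmod x ^ 2)))
    by (rewrite Cmod_R, Rabs_pos_eq; [reflexivity | simpl; nra]).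
  assert (E : RtoC (1 - Cmod x ^ 2) = (1 - Cconj y * x - Cconj (x - y) * x)%C).
  { assert (E := Cmod2_conj x); rewrite RtoC_minus, E.
    destruct x, y; apply injective_projections; simpl; ring. }
  rewrite E; apply Rle_trans with (1 := Cmod_sub_le _ _).
  rewrite Cmod_mult, Cmod_conj; assert (Q := Cmod_ge_0 (x - y)); nra.
Qed.

(** Hyperbolically close points have comparable distances to the unit circle, with a ratio tending
    to 1 as [t] tends to 0. This is what gives Julia's inequality the constant 1. *)
Lemma one_sub_sq_ratio (x y : C) (t : R) :
  Cmod x < 1 -> Cmod y < 1 -> 0 <= t < 1 -> Cmod (x - y) <= t * Cmod (1 - Cconj y * x) ->
  (1 - t) * (1 - Cmod x ^ 2) <= (1 + t) * (1 - Cmod y ^ 2).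
Proof.
  intros Hx Hy Ht H.
  assert (E := pick_identity x y).
  assert (A := one_sub_sq_le x y ltac:(lra)).
  assert (Px := Cmod_ge_0 x); assert (Py := Cmod_ge_0 y).
  assert (P1 := Cmod_ge_0 (x - y)).
  set (D := Cmod (1 - Cconj y * x)) in *; set (X := 1 - Cmod x ^ 2) in *; set (Y := 1 - Cmod y ^ 2) in *.
  set (s := Cmod (x - y)) in *.
  assert (PX : 0 < X) by (unfold X; simpl; nra).
  assert (A' : X <= (1 + t) * D) by lra.
  assert (B : (1 - t * t) * (D * D) <= X * Y).
  { rewrite <- E; simpl; nra. }
  assert (F : X * X <= (1 + t) * (1 + t) * (D * D)).
  { replace ((1 + t) * (1 + t) * (D * D)) with (((1 + t) * D) * ((1 + t) * D)) by ring.
    apply Rmult_le_compat; lra. }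
  assert (G : (1 - t) * (X * X) <= (1 + t) * (X * Y)).
  { apply Rle_trans with ((1 - t) * ((1 + t) * (1 + t) * (D * D))).
    - apply Rmult_le_compat_l; lra.
    - replace ((1 - t) * ((1 + t) * (1 + t) * (D * D))) with ((1 + t) * ((1 - t * t) * (D * D))) by ring.
      apply Rmult_le_compat_l; lra. }
  apply Rmult_le_reg_l with (1 := PX); lra.
Qed.

Lemma Cmod_one_sub_conj_unit (tau z : C) : Cmod tau = 1 -> Cmod (1 - Cconj tau * z) = Cmod (tau - z).
Proof.
  intros H; apply Rsqr_inj; try apply Cmod_ge_0.
  assert (E := Cmod2_alt tau); rewrite H in E.
  assert (E1 := Cmod2_alt (1 - Cconj tau * z)); assert (E2 := Cmod2_alt (tau - z)).
  unfold Rsqr; simpl in *; rewrite Rmult_1_r in E1, E2; rewrite E1, E2.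
  destruct tau as [p q], z as [a b]; simpl in *.
  ring_simplify; replace (q ^ 2) with (1 - p * p) by (simpl; lra); ring.
Qed.

Lemma is_lim_seq_Cmod_one_sub_conj (u : nat -> C) (tau p : C) :
  Cmod tau = 1 -> Cmod p <= 1 -> is_lim_seq (fun n => Cmod (u n - tau)) 0 ->
  is_lim_seq (fun n => Cmod (1 - Cconj (u n) * p)) (Cmod (tau - p)).
Proof.
  intros Ht Hp H.
  assert (B : forall n, Rabs (Cmod (1 - Cconj (u n) * p) - Cmod (tau - p)) <= Cmod (u n - tau)).
  { intros n; rewrite <- (Cmod_one_sub_conj_unit tau p Ht).
    assert (E1 := Cmod_sub_ge (1 - Cconj (u n) * p) (1 - Cconj tau * p)).
    assert (E2 := Cmod_sub_ge (1 - Cconj tau * p) (1 - Cconj (u n) * p)).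
    rewrite (Cmod_sub_sym (1 - Cconj tau * p)) in E2.
    assert (E : (1 - Cconj (u n) * p - (1 - Cconj tau * p))%C = (- (Cconj (u n - tau) * p))%C)
      by (destruct (u n), tau, p; apply injective_projections; simpl; ring).
    rewrite E, Cmod_opp, Cmod_mult, Cmod_conj in E1, E2.
    assert (P := Cmod_ge_0 (u n - tau)).
    apply Rabs_le; nra. }
  apply (is_lim_seq_le_le (fun n => Cmod (tau - p) - Cmod (u n - tau)) _
    (fun n => Cmod (tau - p) + Cmod (u n - tau))).
  - intros n; specialize (B n); apply Rabs_le_between in B; lra.
  - replace (Finite (Cmod (tau - p))) with (Finite (Cmod (tau - p) - 0)) by (f_equal; ring).
    apply is_lim_seq_minus'; [apply is_lim_seq_const | exact H].
  - replace (Finite (Cmod (tau - p))) with (Finite (Cmod (tau - p) + 0)) by (f_equal; ring).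
    apply is_lim_seq_plus'; [apply is_lim_seq_const | exact H].
Qed.

(** Julia's inequality at a boundary point [tau] reached by a sequence that [f] moves by a
    hyperbolic distance tending to [0]. *)
Lemma julia (f : C -> C) (tau : C) (u : nat -> C) (t : nat -> R) :
  holo_disc f 0 1 -> (forall w, Cmod w < 1 -> Cmod (f w) < 1) -> Cmod tau = 1 ->
  (forall n, Cmod (u n) < 1) -> is_lim_seq (fun n => Cmod (u n - tau)) 0 ->
  (forall n, 0 <= t n < 1) -> is_lim_seq t 0 ->
  (forall n, Cmod (f (u n) - u n) <= t n * Cmod (1 - Cconj (u n) * f (u n))) ->
  forall z, Cmod z < 1 ->
    Cmod (tau - f z) ^ 2 * (1 - Cmod z ^ 2) <= Cmod (tau - z) ^ 2 * (1 - Cmod (f z) ^ 2).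
Proof.
  intros Hf H1 Ht Hu Lu Ht1 Lt Hd z Hz.
  assert (Hfz := H1 z Hz).
  assert (Lfu : is_lim_seq (fun n => Cmod (f (u n) - tau)) 0).
  { apply (is_lim_seq_le_le (fun _ => 0) _ (fun n => 2 * t n + Cmod (u n - tau))).
    - intros n; split; [apply Cmod_ge_0 |].
      assert (A := Cmod_sub_triangle (f (u n)) (u n) tau).
      assert (B : Cmod (1 - Cconj (u n) * f (u n)) <= 2).
      { apply Rle_trans with (1 := Cmod_sub_le _ _); rewrite Cmod_1, Cmod_mult, Cmod_conj.
        assert (P2 := Cmod_ge_0 (f (u n))).
        assert (Q1 := Hu n); assert (Q2 := H1 _ (Hu n)); nra. }
      specialize (Hd n); specialize (Ht1 n); nra.
    - apply is_lim_seq_const.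
    - replace (Finite 0) with (Finite (2 * 0 + 0)) by (f_equal; ring).
      apply is_lim_seq_plus'; [| exact Lu].
      apply is_lim_seq_mult'; [apply is_lim_seq_const | exact Lt]. }
  (* Schwarz-Pick for [z] and [u n], in which the ratio of the defects of [f (u n)] and [u n] is
     replaced by its bound; the claim is the limit as [n] grows. *)
  assert (I : forall n,
    (1 - t n) * ((1 - Cmod z ^ 2) * Cmod (1 - Cconj (f (u n)) * f z) ^ 2) <=
    (1 + t n) * ((1 - Cmod (f z) ^ 2) * Cmod (1 - Cconj (u n) * z) ^ 2)).
  { intros n.
    assert (A := schwarz_pick_defect f z (u n) Hf H1 Hz (Hu n)).
    assert (B := one_sub_sq_ratio (f (u n)) (u n) (t n) (H1 _ (Hu n)) (Hu n) (Ht1 n) (Hd n)).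
    specialize (Ht1 n).
    assert (P1 : 0 < 1 - Cmod (u n) ^ 2).
    { assert (P := Cmod_ge_0 (u n)); assert (Q := Hu n); simpl; nra. }
    assert (P2 : 0 < 1 - Cmod (f z) ^ 2).
    { assert (P := Cmod_ge_0 (f z)); simpl; nra. }
    set (X := 1 - Cmod z ^ 2) in *; set (Y := 1 - Cmod (u n) ^ 2) in *.
    set (X' := 1 - Cmod (f z) ^ 2) in *; set (Y' := 1 - Cmod (f (u n)) ^ 2) in *.
    set (L := Cmod (1 - Cconj (f (u n)) * f z) ^ 2) in *; set (M := Cmod (1 - Cconj (u n) * z) ^ 2) in *.
    assert (PM : 0 <= M) by apply pow2_ge_0.
    apply Rmult_le_reg_l with (1 := P1).
    apply Rle_trans with ((1 - t n) * (X' * Y' * M)).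
    - replace (Y * ((1 - t n) * (X * L))) with ((1 - t n) * (X * Y * L)) by ring.
      apply Rmult_le_compat_l; lra.
    - replace ((1 - t n) * (X' * Y' * M)) with ((1 - t n) * Y' * (X' * M)) by ring.
      replace (Y * ((1 + t n) * (X' * M))) with ((1 + t n) * Y * (X' * M)) by ring.
      apply Rmult_le_compat_r; [apply Rmult_le_pos; lra | exact B]. }
  assert (sq : forall (v : nat -> R) (l : R), is_lim_seq v l -> is_lim_seq (fun n => v n ^ 2) (l ^ 2)).
  { intros v l Hv; apply (is_lim_seq_ext (fun n => v n * v n)); [intros n; ring |].
    replace (l ^ 2) with (l * l) by ring; apply is_lim_seq_mult'; exact Hv. }
  assert (L1 : is_lim_seq (fun n => (1 - t n) * ((1 - Cmod z ^ 2) * Cmod (1 - Cconj (f (u n)) * f z) ^ 2))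
    ((1 - 0) * ((1 - Cmod z ^ 2) * Cmod (tau - f z) ^ 2))).
  { apply is_lim_seq_mult'; [apply is_lim_seq_minus'; [apply is_lim_seq_const | exact Lt] |].
    apply is_lim_seq_mult'; [apply is_lim_seq_const |].
    apply sq, (is_lim_seq_Cmod_one_sub_conj (fun n => f (u n))); auto; lra. }
  assert (L2 : is_lim_seq (fun n => (1 + t n) * ((1 - Cmod (f z) ^ 2) * Cmod (1 - Cconj (u n) * z) ^ 2))
    ((1 + 0) * ((1 - Cmod (f z) ^ 2) * Cmod (tau - z) ^ 2))).
  { apply is_lim_seq_mult'; [apply is_lim_seq_plus'; [apply is_lim_seq_const | exact Lt] |].
    apply is_lim_seq_mult'; [apply is_lim_seq_const |].
    apply sq, is_lim_seq_Cmod_one_sub_conj; auto; lra. }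
  assert (G := is_lim_seq_le _ _ _ _ I L1 L2); simpl in G |- *; lra.
Qed.

(** Turns pseudo-hyperbolic closeness into Euclidean closeness relative to the distance to the unit
    circle and to [tau]. One of the ten copies of [Cmod (x - y)] is spent in replacing
    [Cmod (1 - Cconj y * x)] by [1 - Cmod y^2]. *)
Lemma hyperbolically_close (x y tau : C) :
  Cmod x < 1 -> Cmod y < 1 -> Cmod tau = 1 -> 10 * Cmod (x - y) <= Cmod (1 - Cconj y * x) ->
  9 * Cmod (x - y) <= 1 - Cmod y ^ 2 /\ 9 * Cmod (x - y) <= 2 * Cmod (tau - y).
Proof.
  intros Hx Hy Ht H.
  assert (E : Cmod (1 - Cconj y * x) <= 1 - Cmod y ^ 2 + Cmod (x - y)).
  { assert (Py := Cmod_ge_0 y).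
    replace (1 - Cconj y * x)%C with (RtoC (1 - Cmod y ^ 2) - Cconj y * (x - y))%C.
    - apply Rle_trans with (1 := Cmod_sub_le _ _).
      rewrite Cmod_mult, Cmod_conj, Cmod_R, Rabs_pos_eq by (simpl; nra).
      assert (Q := Cmod_ge_0 (x - y)); nra.
    - assert (E := Cmod2_conj y); rewrite RtoC_minus, E; ring. }
  assert (F := Cmod_sub_ge tau y); rewrite Ht in F.
  split; [lra |].
  assert (1 - Cmod y ^ 2 <= 2 * (1 - Cmod y)) by (simpl; nra); lra.
Qed.

(** With [P z = (tau + z) / (tau - z)], the function [P o f - P] has nonnegative real part, so
    by Harnack's inequality it varies less than [P] where [f] is hyperbolically close to the
    identity. *)
Lemma injective_where_close_to_id (f : C -> C) (tau x y : C) :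
  holo_disc f 0 1 -> (forall w, Cmod w < 1 -> Cmod (f w) < 1) -> Cmod tau = 1 ->
  (forall z, Cmod z < 1 ->
    Cmod (tau - f z) ^ 2 * (1 - Cmod z ^ 2) <= Cmod (tau - z) ^ 2 * (1 - Cmod (f z) ^ 2)) ->
  Cmod x < 1 -> Cmod y < 1 ->
  10 * Cmod (x - y) <= Cmod (1 - Cconj y * x) ->
  10 * Cmod (f y - y) <= Cmod (1 - Cconj y * f y) ->
  f x = f y -> x = y.
Proof.
  intros Hf H1 Ht J Hx Hy Hxy Hfy E.
  assert (Nt : forall z, Cmod z < 1 -> (tau - z)%C <> 0).
  { intros z Hz; apply Cmod_gt_0; assert (A := Cmod_sub_ge tau z); lra. }
  set (P := fun z => ((tau + z) / (tau - z))%C).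
  (* The real part of [P] is the Poisson kernel with pole [tau], so [J] says that
     [Re (P z) <= Re (P (f z))]. *)
  assert (RP : forall z, Cmod z < 1 -> Re (P z) = (1 - Cmod z ^ 2) / Cmod (tau - z) ^ 2).
  { intros z Hz; assert (N := Nt z Hz).
    assert (Q : P z = ((tau + z) * Cconj (tau - z) * / RtoC (Cmod (tau - z) ^ 2))%C).
    { unfold P; assert (Q := Cmod2_conj (tau - z)); rewrite Q.
      assert (N' : Cconj (tau - z) <> 0) by (apply Cmod_gt_0; rewrite Cmod_conj; apply Cmod_gt_0, N).
      field; split; assumption. }
    assert (P2 : Cmod (tau - z) ^ 2 <> 0).
    { apply pow_nonzero; assert (A := proj1 (Cmod_gt_0 _) N); lra. }
    rewrite Q, <- RtoC_inv by exact P2; rewrite re_scal_r; unfold Rdiv; f_equal.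
    replace (1 - Cmod z ^ 2) with (Cmod tau ^ 2 - Cmod z ^ 2) by (rewrite Ht; ring).
    rewrite !Cmod2_alt; destruct tau, z; simpl; ring. }
  set (p := fun z => (P (f z) - P z)%C).
  assert (Hp : holo_disc p 0 1).
  { intros z Hz; rewrite Cmod_sub_0 in Hz.
    assert (DP : forall w, Cmod w < 1 -> ex_derive P w).
    { intros w Hw; apply ex_derive_C_div; [| | apply Nt, Hw].
      - apply ex_derive_C_plus; [apply ex_derive_C_const | apply ex_derive_C_id].
      - apply ex_derive_C_minus; [apply ex_derive_C_const | apply ex_derive_C_id]. }
    apply ex_derive_C_minus; [| apply DP, Hz].
    apply (ex_derive_C_comp P f); [apply DP, H1, Hz | apply Hf; rewrite Cmod_sub_0; exact Hz]. }
  assert (Rp : forall z, Cmod z < 1 -> 0 <= Re (p z)).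
  { intros z Hz; unfold p; unfold Cminus; rewrite re_plus, re_opp, !RP by auto.
    assert (A := proj1 (Cmod_gt_0 _) (Nt z Hz)); assert (B := proj1 (Cmod_gt_0 _) (Nt (f z) (H1 z Hz))).
    assert (A2 : 0 < Cmod (tau - z) ^ 2) by (apply pow_lt, A).
    assert (B2 : 0 < Cmod (tau - f z) ^ 2) by (apply pow_lt, B).
    specialize (J z Hz).
    apply Rmult_le_reg_r with (Cmod (tau - z) ^ 2 * Cmod (tau - f z) ^ 2); [nra |].
    rewrite Rmult_0_l.
    match goal with |- _ <= ?g => replace g with (Cmod (tau - z) ^ 2 * (1 - Cmod (f z) ^ 2) -
      Cmod (tau - f z) ^ 2 * (1 - Cmod z ^ 2)) by (field; lra) end.
    lra. }
  assert (PD : forall v w, Cmod v < 1 -> Cmod w < 1 ->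
    Cmod (P v - P w) = 2 * Cmod (v - w) / (Cmod (tau - v) * Cmod (tau - w))).
  { intros v w Hv Hw; assert (N1 := Nt v Hv); assert (N2 := Nt w Hw).
    replace (P v - P w)%C with (RtoC 2 * tau * (v - w) / ((tau - v) * (tau - w)))%C
      by (unfold P; field; split; assumption).
    rewrite Cmod_div by (apply Cmult_neq_0; assumption).
    rewrite !Cmod_mult, Ht, Cmod_R, Rabs_pos_eq by lra; f_equal; ring. }
  apply NNPP; intros Nxy.
  assert (Pxy := Cmod_sub_pos x y Nxy).
  set (D := Cmod (1 - Cconj y * x)) in *; set (s := Cmod (x - y)) in *.
  assert (PDD : 0 < D) by lra.
  assert (Ts : s / D <= / 10).
  { apply Rmult_le_reg_r with D; [exact PDD |]; replace (s / D * D) with s by (field; lra); lra. }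
  assert (Pts : 0 < s / D) by (apply Rdiv_lt_0_compat; assumption).
  assert (Hk := harnack p x y (s / D) Hp Rp Hx Hy).
  fold s D in Hk.
  specialize (Hk ltac:(apply Req_le; field; lra) ltac:(lra)).
  (* Since [f x = f y], the terms [P (f x)] and [P (f y)] cancel and the full variation of [P]
     remains. *)
  assert (Ep : Cmod (p x - p y) = 2 * s / (Cmod (tau - x) * Cmod (tau - y))).
  { assert (Q := PD x y Hx Hy); fold s in Q; rewrite <- Q, <- Cmod_opp.
    f_equal; unfold p; rewrite E; ring. }
  destruct (hyperbolically_close x y tau Hx Hy Ht Hxy) as [K1 K2].
  destruct (hyperbolically_close (f y) y tau (H1 y Hy) Hy Ht Hfy) as [K3 K4].
  fold s in K1, K2.
  set (a := Cmod (tau - y)) in *; set (b := Cmod (tau - x)) in *.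
  set (c := Cmod (tau - f y)).
  assert (Pa : 0 < a) by (apply Cmod_gt_0, Nt, Hy).
  assert (Pb : 0 < b) by (apply Cmod_gt_0, Nt, Hx).
  assert (Bb : b <= 11 / 9 * a).
  { assert (T := Cmod_sub_triangle tau y x); fold a b in T.
    rewrite (Cmod_sub_sym y x) in T; fold s in T; lra. }
  assert (Bc : 7 / 9 * a <= c).
  { assert (T := Cmod_sub_triangle tau (f y) y); fold a c in T; lra. }
  set (Y := 1 - Cmod y ^ 2) in *.
  assert (BY : Y <= 11 / 10 * D).
  { assert (A := one_sub_sq_le y x ltac:(lra)); fold Y in A.
    rewrite one_sub_conj_sym, (Cmod_sub_sym y x) in A; fold D s in A; lra. }
  (* From [Cmod (f y - y) <= Y / 9] and [c >= 7 / 9 * a]. *)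
  assert (Rpy : Re (p y) <= 2 / 7 * (Y / (a * a))).
  { apply Rle_trans with (Cmod (p y)).
    { apply Rle_trans with (2 := re_le_Cmod _), Rle_abs. }
    unfold p; rewrite PD by auto; fold a c.
    assert (Pc : 0 < c) by lra.
    apply Rmult_le_reg_r with (c * a * a); [repeat apply Rmult_lt_0_compat; assumption |].
    replace (2 * Cmod (f y - y) / (c * a) * (c * a * a)) with (2 * Cmod (f y - y) * a) by (field; lra).
    replace (2 / 7 * (Y / (a * a)) * (c * a * a)) with (2 / 7 * Y * c) by (field; lra).
    apply Rle_trans with (2 * (Y / 9) * a); [apply Rmult_le_compat_r; lra |].
    apply Rle_trans with (2 / 7 * Y * (7 / 9 * a)); [apply Req_le; field |].
    apply Rmult_le_compat_l; lra. }
  rewrite Ep in Hk.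
  assert (Hk2 : D * (9 / 10) <= Re (p y) * (a * b)).
  { apply (Rmult_le_compat_r (a * b * D / (2 * s))) in Hk.
    2: apply Rdiv_le_0_compat; [repeat apply Rmult_le_pos; lra | lra].
    replace (2 * s / (b * a) * (1 - s / D) * (a * b * D / (2 * s))) with (D * (1 - s / D)) in Hk
      by (field; lra).
    replace (2 * (s / D) * Re (p y) * (a * b * D / (2 * s))) with (Re (p y) * (a * b)) in Hk by (field; lra).
    nra. }
  assert (Hk3 : Re (p y) * (a * b) <= 2 / 7 * Y * (11 / 9)).
  { apply Rle_trans with (2 / 7 * (Y / (a * a)) * (a * b)).
    - apply Rmult_le_compat_r; [nra | exact Rpy].
    - replace (2 / 7 * (Y / (a * a)) * (a * b)) with (2 / 7 * Y * (b / a)) by (field; lra).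
      apply Rmult_le_compat_l; [lra |].
      apply Rmult_le_reg_r with a; [exact Pa |]; replace (b / a * a) with b by (field; lra); lra. }
  (* The bounds combine to [9 / 10 * D <= 2 / 7 * (11 / 9) * (11 / 10) * D], which is impossible for
     [D > 0]. *)
  lra.
Qed.

(** * Injective holomorphic functions *)

(** If [f] omitted a value [b] close to [f a], then [/ (f z - b)] would be larger at [a] than on the
    circle, against the maximum principle. *)
Lemma open_mapping (f : C -> C) (a : C) (r R : R) :
  0 < r < R -> holo_disc f a R -> (forall z, Cmod (z - a) = r -> f z <> f a) ->
  exists d, 0 < d /\ forall b, Cmod (b - f a) < d -> exists z, Cmod (z - a) < R /\ f z = b.
Proof.
  intros Hr Hf Hc.
  destruct (circle_lower_bound (fun z => f z - f a)%C a r) as [m [Pm Hm]]; [lra | |].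
  { intros z Hz; split; [| apply Csub_neq_0, Hc, Hz].
    apply ex_derive_C_minus; [apply Hf; lra | apply ex_derive_C_const]. }
  exists (m / 2); split; [lra |]; intros b Hb.
  apply NNPP; intros No.
  assert (Nb : forall z, Cmod (z - a) < R -> (f z - b)%C <> 0).
  { intros z Hz; apply Csub_neq_0; intros E; apply No; exists z; split; assumption. }
  assert (G : Cmod (/ (f a - b)) <= / (m / 2)).
  { apply (maximum_principle (fun z => / (f z - b))%C a a r R); [lra | | | rewrite Cmod_sub_self; lra].
    - intros z Hz; apply ex_derive_C_inv; [| apply Nb, Hz].
      apply ex_derive_C_minus; [apply Hf, Hz | apply ex_derive_C_const].
    - intros z Hz; rewrite Cmod_inv by (apply Nb; lra).
      apply Rinv_le_contravar; [lra |].
      assert (A := Cmod_sub_triangle (f z) b (f a)); specialize (Hm z Hz); lra. }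
  assert (Na : (f a - b)%C <> 0) by (apply Nb; rewrite Cmod_sub_self; lra).
  assert (Pa := proj1 (Cmod_gt_0 _) Na).
  rewrite Cmod_inv in G by exact Na.
  rewrite (Cmod_sub_sym b) in Hb.
  assert (/ (m / 2) < / Cmod (f a - b)) by (apply Rinv_lt_contravar; [nra | exact Hb]).
  lra.
Qed.

Lemma constant_of_derive_zero (f : C -> C) (a b : C) (R : R) :
  (forall z, Cmod (z - a) < R -> is_derive f z (RtoC 0)) -> Cmod (b - a) < R -> f b = f a.
Proof.
  intros Hf Hb.
  set (u := fun t => (a + (b - a) * RtoC t)%C).
  assert (E := eq_is_derive (V := C_R_CompleteNormedModule) (fun t => f (u t)) 0 1).
  cbv beta in E; unfold u in E at 2 3.
  replace (a + (b - a) * RtoC 0)%C with a in E by ring.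
  replace (a + (b - a) * RtoC 1)%C with b in E by ring.
  symmetry; apply E; [| lra].
  intros t Ht; apply is_velocity_correct.
  assert (V : is_derive f (u t) (RtoC 0)).
  {   apply Hf; unfold u; replace (a + (b - a) * RtoC t - a)%C with ((b - a) * RtoC t)%C by ring.
  rewrite Cmod_mult, Cmod_R, Rabs_pos_eq by lra; assert (P := Cmod_ge_0 (b - a)); nra. }
  assert (W := is_velocity_comp f u t _ _ V (is_velocity_affine a (b - a) _ _ _ (is_velocity_RtoC t))).
  rewrite Cmult_0_l in W; exact W.
Qed.

(** Hurwitz's argument: the difference quotients of [f] based at points [z] near [a] with
    [f' z <> 0] have no zeros, so their limit at [a] cannot vanish. *)
Lemma injective_derive_neq_0 (f : C -> C) (a l : C) (R : R) :
  0 < R -> holo_disc f a R ->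
  (forall x y, Cmod (x - a) < R -> Cmod (y - a) < R -> f x = f y -> x = y) ->
  is_derive f a l -> l <> 0.
Proof.
  intros HR Hf Inj Hl El; subst l.
  assert (Ca : Cmod (a - a) < R) by (rewrite Cmod_sub_self; exact HR).
  set (r := R / 2).
  destruct (circle_lower_bound (fun z => f z - f a)%C a r) as [m [Pm Hm]]; [unfold r; lra | |].
  { intros z Hz; split.
    - apply ex_derive_C_minus; [apply Hf; unfold r in *; lra | apply ex_derive_C_const].
    - apply Csub_neq_0; intros E; apply Inj in E; [| unfold r in *; lra | exact Ca].
      subst z; rewrite Cmod_sub_self in Hz; unfold r in *; lra. }
  (* Half of [m / (4 * r)], the lower bound for [Cmod (u a)] that the maximum principle for [/ u]
     gives below. *)
  assert (Pe : 0 < m / (8 * r)) by (apply Rdiv_lt_0_compat; unfold r; lra).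
  destruct (proj1 (is_derive_C f a 0) Hl _ Pe) as [d1 [Pd1 K1]].
  destruct (ex_derive_C_continuous f a (Hf a Ca) (m / 2)) as [d2 [Pd2 K2]]; [lra |].
  set (d := Rmin (Rmin d1 d2) (r / 2)).
  assert (Pd : 0 < d) by (repeat apply Rmin_pos; unfold r; lra).
  assert (D1 : d <= d1) by (apply Rle_trans with (1 := Rmin_l _ _), Rmin_l).
  assert (D2 : d <= d2) by (apply Rle_trans with (1 := Rmin_l _ _), Rmin_r).
  assert (D3 : d <= r / 2) by apply Rmin_r.
  (* Otherwise the derivative would vanish on a whole disc and [f] would be constant there. *)
  assert (Ex : exists z l : C, Cmod (z - a) < d /\ is_derive f z l /\ l <> 0).
  { apply NNPP; intros No.
    set (b := (a + RtoC (d / 2))%C).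
    assert (Hb : Cmod (b - a) = d / 2).
    { unfold b; replace (a + RtoC (d / 2) - a)%C with (RtoC (d / 2)) by ring.
      rewrite Cmod_R, Rabs_pos_eq; lra. }
    assert (E : f b = f a).
    { apply (constant_of_derive_zero f a b d); [| lra].
      intros z Hz; destruct (Hf z) as [l Hz']; [unfold r in *; lra |].
      destruct (classic (l = RtoC 0)) as [-> | N]; [exact Hz' |].
      exfalso; apply No; exists z, l; split; [exact Hz | split; assumption]. }
    apply Inj in E; [| unfold r in *; lra | exact Ca].
    rewrite E, Cmod_sub_self in Hb; lra. }
  destruct Ex as (z & l & Hz & Hl' & Nl).
  assert (Hza : z <> a).
  { intros ->; apply Nl; exact (is_derive_C_unique f a l 0 Hl' Hl). }
  assert (Hz' : Cmod (z - a) < R) by (unfold r in *; lra).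
  destruct (holo_disc_divide (fun w => f w - f z)%C a z l R) as (u & Hu & Uz & Eu).
  - intros w Hw; apply ex_derive_C_minus; [apply Hf, Hw | apply ex_derive_C_const].
  - exact Hz'.
  - ring.
  - assert (A := is_derive_C_plus f (fun _ => - f z)%C z l 0 Hl' (is_derive_C_const _ z)).
    rewrite Cplus_0_r in A; exact A.
  - assert (Nu : forall w, Cmod (w - a) < R -> u w <> 0).
    { intros w Hw E0; destruct (classic (w = z)) as [-> | N]; [congruence |].
      apply N, Inj; auto.
      specialize (Eu w); rewrite E0 in Eu.
      replace (f w) with ((f w - f z) + f z)%C by ring; rewrite Eu; ring. }
    assert (Pr : 0 < m / (4 * r)) by (apply Rdiv_lt_0_compat; unfold r; lra).
    assert (G : Cmod (/ u a) <= / (m / (4 * r))).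
    { apply (maximum_principle (fun w => / u w)%C a a r R); [unfold r; lra | | |].
      - intros w Hw; apply ex_derive_C_inv; [apply Hu, Hw | apply Nu, Hw].
      - intros w Hw.
        assert (Hw' : Cmod (w - a) < R) by (unfold r in *; lra).
        rewrite Cmod_inv by (apply Nu, Hw').
        apply Rinv_le_contravar; [exact Pr |].
        assert (E := Eu w); apply (f_equal Cmod) in E; rewrite Cmod_mult in E.
        assert (A := Cmod_sub_triangle (f w) (f z) (f a)).
        specialize (Hm w Hw); specialize (K2 z ltac:(lra)).
        assert (B := Cmod_sub_triangle w a z); rewrite (Cmod_sub_sym a z) in B.
        assert (Pu := Cmod_ge_0 (u w)).
        assert (Q : m / 2 <= 2 * r * Cmod (u w)).
        { apply Rle_trans with (Cmod (w - z) * Cmod (u w)); [lra |].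
          apply Rmult_le_compat_r; lra. }
        apply Rmult_le_reg_l with (2 * r); [unfold r; lra |].
        replace (2 * r * (m / (4 * r))) with (m / 2) by (field; unfold r; lra); exact Q.
      - rewrite Cmod_sub_self; unfold r; lra. }
    assert (Na := Nu a Ca); assert (Pa := proj1 (Cmod_gt_0 _) Na).
    rewrite Cmod_inv in G by exact Na.
    assert (G2 : m / (4 * r) <= Cmod (u a)).
    { rewrite <- (Rinv_inv (m / (4 * r))), <- (Rinv_inv (Cmod (u a))).
      apply Rinv_le_contravar; [apply Rinv_0_lt_compat, Pa | exact G]. }
    specialize (K1 z ltac:(lra)).
    replace (f z - f a - RtoC 0 * (z - a))%C with (- (f a - f z))%C in K1 by ring.
    assert (E := Eu a); cbv beta in E; rewrite E in K1.
    rewrite Cmod_opp, Cmod_mult, (Cmod_sub_sym a z) in K1.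
    assert (Pz := Cmod_sub_pos z a Hza).
    assert (m / (8 * r) = m / (4 * r) / 2) by (field; unfold r; lra).
    nra.
Qed.

(** [open_mapping] on small discs makes the inverse continuous, and the nonvanishing of [f'] makes
    it differentiable. Off the image of [V] the values of [s] are arbitrary. *)
Lemma holomorphic_inverse (f : C -> C) (V : C -> Prop) :
  (forall z, V z -> exists d, 0 < d /\ forall w, Cmod (w - z) < d -> V w) ->
  (forall z, V z -> ex_derive f z) ->
  (forall x y, V x -> V y -> f x = f y -> x = y) ->
  exists s : C -> C,
    (forall z, V z -> s (f z) = z) /\
    (forall z, V z -> exists d, 0 < d /\ forall b, Cmod (b - f z) < d ->
       exists z', V z' /\ f z' = b) /\
    (forall z, V z -> ex_derive s (f z)).
Proof.
  intros Op Hf Inj.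
  set (s := fun w => epsilon (inhabits (RtoC 0)) (fun z => V z /\ f z = w)).
  assert (Sf : forall z, V z -> s (f z) = z).
  { intros z Hz.
    destruct (epsilon_spec (inhabits (RtoC 0)) (fun y => V y /\ f y = f z)) as [A B].
    - exists z; split; [exact Hz | reflexivity].
    - apply Inj; assumption. }
  assert (OM : forall z, V z -> forall e, 0 < e -> exists d, 0 < d /\ forall b, Cmod (b - f z) < d ->
     exists z', V z' /\ Cmod (z' - z) < e /\ f z' = b).
  { intros z Hz e He.
    destruct (Op z Hz) as [d0 [Pd0 K]].
    set (R := Rmin d0 e).
    assert (PR : 0 < R) by (apply Rmin_pos; assumption).
    assert (R1 : R <= d0) by apply Rmin_l; assert (R2 : R <= e) by apply Rmin_r.
    destruct (open_mapping f z (R / 2) R) as [d [Pd M]]; [lra | | |].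
    - intros w Hw; apply Hf, K; lra.
    - intros w Hw E; apply Inj in E; [| apply K; lra | exact Hz].
      subst w; rewrite Cmod_sub_self in Hw; lra.
    - exists d; split; [exact Pd |]; intros b Hb.
      destruct (M b Hb) as [z' [H1 H2]]; exists z'; split; [apply K; lra | split; [lra | exact H2]]. }
  exists s; split; [exact Sf | split].
  - intros z Hz; destruct (OM z Hz 1 Rlt_0_1) as [d [Pd K]]; exists d; split; [exact Pd |].
    intros b Hb; destruct (K b Hb) as (z' & A & _ & B); exists z'; split; assumption.
  - intros z Hz.
    destruct (Hf z Hz) as [l Hl].
    destruct (Op z Hz) as [d0 [Pd0 K0]].
    assert (Nl : l <> RtoC 0).
    { apply (injective_derive_neq_0 f z l d0); auto.
      intros w Hw; apply Hf, K0, Hw. }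
    assert (Pl := proj1 (Cmod_gt_0 _) Nl).
    exists (/ l)%C; apply is_derive_C; intros eps He.
    (* The first bound gives [Cmod q <= 2 * Cmod p / Cmod l]; the second one makes the error small
       relative to [p] instead of [q]. *)
    set (e1 := Rmin (Cmod l / 2) (eps * (Cmod l * Cmod l) / 2)).
    assert (Pe1 : 0 < e1).
    { apply Rmin_pos; [lra |]; apply Rdiv_lt_0_compat; [| lra]; repeat apply Rmult_lt_0_compat; lra. }
    assert (E1 : e1 <= Cmod l / 2) by apply Rmin_l.
    assert (E2 : e1 <= eps * (Cmod l * Cmod l) / 2) by apply Rmin_r.
    destruct (proj1 (is_derive_C f z l) Hl e1 Pe1) as [d1 [Pd1 K1]].
    destruct (OM z Hz d1 Pd1) as [d2 [Pd2 K2]].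
    exists d2; split; [exact Pd2 |]; intros b Hb.
    destruct (K2 b Hb) as (z' & Hz' & Hd & <-).
    rewrite !Sf by assumption.
    specialize (K1 z' Hd).
    set (q := (z' - z)%C) in *; set (p := (f z' - f z)%C) in *.
    replace (q - / l * p)%C with (- (/ l * (p - l * q)))%C by (field; exact Nl).
    rewrite Cmod_opp, Cmod_mult, Cmod_inv by exact Nl.
    assert (A := Cmod_sub_ge (l * q) (l * q - p)).
    rewrite (Cmod_sub_sym (l * q) p) in A.
    replace (l * q - (l * q - p))%C with p in A by ring.
    rewrite Cmod_mult in A.
    assert (Pq : 0 <= Cmod q) by apply Cmod_ge_0.
    apply Rmult_le_reg_l with (Cmod l); [exact Pl |].
    rewrite <- Rmult_assoc, Rinv_r, Rmult_1_l by lra.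
    apply Rle_trans with (1 := K1).
    assert (Q : Cmod l / 2 * Cmod q <= Cmod p) by nra.
    apply Rle_trans with (eps * (Cmod l * Cmod l) / 2 * Cmod q).
    { apply Rmult_le_compat_r; assumption. }
    replace (eps * (Cmod l * Cmod l) / 2 * Cmod q) with (Cmod l * (eps * (Cmod l / 2 * Cmod q))) by field.
    apply Rmult_le_compat_l; [lra |]; apply Rmult_le_compat_l; [lra | exact Q].
Qed.

(** * Entire functions *)

(** Liouville's argument: at linear growth the Taylor remainder of order 2 on a circle of radius [r]
    is of order [1 / r]. The remainder at 1 identifies the slope. *)
Lemma entire_linear_growth (k : C -> C) (A : R) :
  (forall z : C, ex_derive k z) -> 0 < A -> (forall z, 1 <= Cmod z -> Cmod (k z) <= A * Cmod z) ->
  forall w, k w = (k 0 + (k 1 - k 0) * w)%C.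
Proof.
  intros Hk PA Hg w; assert (Pw := Cmod_ge_0 w).
  apply Cmod_sub_eq_0, le_epsilon; intros eps He; rewrite Rplus_0_l.
  set (B := 2 * A * (Cmod w ^ 2 + Cmod w)).
  assert (PB : 0 <= B) by (unfold B; nra).
  (* Both remainders together are [B / r <= eps], and [w] and 1 lie within radius [r / 2]. *)
  set (r := 2 + 2 * Cmod w + B / eps).
  assert (PBe : 0 <= B / eps) by (apply Rdiv_le_0_compat; lra).
  assert (Pr : 2 <= r) by (unfold r; lra).
  destruct (taylor_half k 0 r (A * r)) as (c & C0 & T); [lra | intros z _; apply Hk | |].
  { intros z Hz; rewrite Cmod_sub_0 in Hz; rewrite <- Hz; apply Hg; lra. }
  assert (E1 := T 1 2%nat ltac:(rewrite Cmod_sub_0, Cmod_1; lra)).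
  assert (E2 := T w 2%nat ltac:(rewrite Cmod_sub_0; unfold r; lra)).
  rewrite Cmod_sub_0, Cmod_1 in E1; rewrite Cmod_sub_0 in E2.
  replace (power_sum c (1 - 0) 2) with (c O + c 1%nat)%C in E1 by (simpl; ring).
  replace (power_sum c (w - 0) 2) with (c O + c 1%nat * w)%C in E2 by (simpl; ring).
  rewrite <- C0.
  replace (k w - (c O + (k 1 - c O) * w))%C
    with ((k w - (c O + c 1%nat * w)) - (k 1 - (c O + c 1%nat)) * w)%C by ring.
  apply Rle_trans with (1 := Cmod_sub_le _ _); rewrite Cmod_mult.
  apply Rle_trans with (2 * (A * r) * (Cmod w / r) ^ 2 + 2 * (A * r) * (1 / r) ^ 2 * Cmod w).
  { apply Rplus_le_compat; [exact E2 | apply Rmult_le_compat_r; assumption]. }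
  replace (2 * (A * r) * (Cmod w / r) ^ 2 + 2 * (A * r) * (1 / r) ^ 2 * Cmod w) with (B / r)
    by (unfold B; field; lra).
  apply Rmult_le_reg_r with r; [lra |].
  replace (B / r * r) with B by (field; lra).
  replace B with (eps * (B / eps)) at 1 by (field; lra).
  apply Rmult_le_compat_l; unfold r; lra.
Qed.

(** The quotient [u w = (g w - g 0) / w] has no zeros, and by openness and injectivity [g] stays
    away from [g 0] outside the unit disc. So [/ u] is entire of at most linear growth, hence
    affine, and, having no zeros, constant. *)
Lemma entire_injective_affine (g : C -> C) :
  (forall z : C, ex_derive g z) -> (forall x y, g x = g y -> x = y) ->
  exists a : C, a <> 0 /\ forall w : C, g w = (g 0 + a * w)%C.
Proof.
  intros Hg Inj.
  assert (Hd : forall a R, holo_disc g a R) by (intros a R z _; apply Hg).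
  destruct (Hg (RtoC 0)) as [l Hl].
  assert (Nl : l <> RtoC 0).
  { apply (injective_derive_neq_0 g 0 l 1); auto; lra. }
  destruct (holo_disc_divide (fun z => g z - g 0)%C 0 0 l 1) as (u & Hu & U0 & Eu).
  - intros w Hw; apply ex_derive_C_minus; [apply Hg | apply ex_derive_C_const].
  - rewrite Cmod_sub_self; lra.
  - ring.
  - assert (A := is_derive_C_plus g (fun _ => - g 0)%C 0 l 0 Hl (is_derive_C_const _ 0)).
    rewrite Cplus_0_r in A; exact A.
  - assert (Du : forall w : C, ex_derive u w).
    { intros w; destruct (classic (w = 0)) as [-> | N]; [apply Hu; rewrite Cmod_sub_self; lra |].
      apply (ex_derive_C_eq_near (fun z => (g z - g 0) / z)%C u w (Cmod w)).
      - apply Cmod_gt_0, N.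
      - intros z Hz; assert (Nz : z <> 0).
        { intros ->; rewrite Cmod_sub_sym, Cmod_sub_0 in Hz; lra. }
        rewrite Eu; field; exact Nz.
      - apply ex_derive_C_div; [| apply ex_derive_C_id | exact N].
        apply ex_derive_C_minus; [apply Hg | apply ex_derive_C_const]. }
    assert (Nu : forall w, u w <> 0).
    { intros w E; destruct (classic (w = 0)) as [-> | N]; [congruence |].
      apply N, Inj; replace (g w) with ((g w - g 0) + g 0)%C by ring.
      rewrite Eu, E; ring. }
    destruct (open_mapping g 0 (/ 2) 1) as [d [Pd K]]; [lra | apply Hd | |].
    { intros z Hz E; apply Inj in E; subst z; rewrite Cmod_sub_self in Hz; lra. }
    assert (Far : forall w, 1 <= Cmod w -> d <= Cmod (g w - g 0)).
    { intros w Hw; apply Rnot_lt_le; intros Hlt.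
      destruct (K (g w) Hlt) as [z [Hz E]]; apply Inj in E; subst z.
      rewrite Cmod_sub_0 in Hz; lra. }
    set (k := fun w => (/ u w)%C).
    assert (Lin := entire_linear_growth k (/ d)).
    assert (Hk : forall w, k w = (k 0 + (k 1 - k 0) * w)%C).
    { apply Lin; [| apply Rinv_0_lt_compat, Pd |].
      - intros z; apply ex_derive_C_inv; [apply Du | apply Nu].
      - intros z Hz; unfold k; rewrite Cmod_inv by apply Nu.
        specialize (Far z Hz); rewrite Eu, Cmod_mult, Cmod_sub_0 in Far.
        assert (Pu := proj1 (Cmod_gt_0 _) (Nu z)).
        apply Rmult_le_reg_r with (d * Cmod (u z)); [nra |].
        replace (/ Cmod (u z) * (d * Cmod (u z))) with d by (field; lra).
        replace (/ d * Cmod z * (d * Cmod (u z))) with (Cmod z * Cmod (u z)) by (field; lra).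
        exact Far. }
    assert (Nk : forall w, k w <> 0).
    { intros w E; apply (Nu w); rewrite <- (Cmult_1_r (u w)).
      replace (RtoC 1) with (u w * k w)%C by (unfold k; field; apply Nu); rewrite E; ring. }
    assert (E1 : (k 1 - k 0)%C = 0).
    { apply NNPP; intros N; apply (Nk (- k 0 / (k 1 - k 0))%C).
      rewrite Hk; field; exact N. }
    exists (u 0); split; [apply Nu |]; intros w.
    assert (Ew : u w = u 0).
    { assert (A : k w = k 0) by (rewrite Hk, E1; ring).
      unfold k in A; replace (u w) with (/ / u w)%C by (field; apply Nu).
      rewrite A; field; apply Nu. }
    replace (g w) with ((g w - g 0) + g 0)%C by ring.
    rewrite Eu, Ew; ring.
Qed.

(** * Maps commuting with [phi] *)

(** [h] is a Koenigs function, [V] the absorbing set and [s] the inverse of [h] on [V]. *)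
Record koenigs_model (phi h : C -> C) (V : C -> Prop) (s : C -> C) : Prop := {
  km_phi_holo : holo_disc phi 0 1;
  km_phi_disc : forall z, Cmod z < 1 -> Cmod (phi z) < 1;
  km_h_holo : holo_disc h 0 1;
  km_h_phi : forall z, Cmod z < 1 -> h (phi z) = (h z + 1)%C;
  km_cover : forall w, exists n z, Cmod z < 1 /\ w = (h z - RtoC (INR n))%C;
  km_V_disc : forall z, V z -> Cmod z < 1;
  km_V_open : forall z, V z -> exists d, 0 < d /\ forall w, Cmod (w - z) < d -> V w;
  km_V_phi : forall z, V z -> V (phi z);
  km_absorb : forall z, Cmod z < 1 -> exists n, V (Nat.iter n phi z);
  km_s_h : forall z, V z -> s (h z) = z;
  km_image_open : forall z, V z -> exists d, 0 < d /\ forall b, Cmod (b - h z) < d ->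
    exists z', V z' /\ h z' = b;
  km_s_holo : forall z, V z -> ex_derive s (h z) }.

Arguments km_phi_holo {phi h V s}.
Arguments km_phi_disc {phi h V s}.
Arguments km_h_holo {phi h V s}.
Arguments km_h_phi {phi h V s}.
Arguments km_cover {phi h V s}.
Arguments km_V_disc {phi h V s}.
Arguments km_V_open {phi h V s}.
Arguments km_V_phi {phi h V s}.
Arguments km_absorb {phi h V s}.
Arguments km_s_h {phi h V s}.
Arguments km_image_open {phi h V s}.
Arguments km_s_holo {phi h V s}.

Definition image (h : C -> C) (V : C -> Prop) (w : C) : Prop := exists z, V z /\ h z = w.

Lemma image_s {phi h V s} (M : koenigs_model phi h V s) (w : C) :
  image h V w -> V (s w) /\ h (s w) = w.
Proof. intros [z [Hz <-]]; rewrite (km_s_h M) by exact Hz; split; [exact Hz | reflexivity]. Qed.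

Lemma image_open {phi h V s} (M : koenigs_model phi h V s) (w : C) :
  image h V w -> exists d, 0 < d /\ forall b, Cmod (b - w) < d -> image h V b.
Proof. intros [z [Hz <-]]; exact (km_image_open M z Hz). Qed.

Lemma ex_derive_s {phi h V s} (M : koenigs_model phi h V s) (w : C) :
  image h V w -> ex_derive s w.
Proof. intros [z [Hz <-]]; exact (km_s_holo M z Hz). Qed.

Lemma iter_phi_disc {phi h V s} (M : koenigs_model phi h V s) (n : nat) (z : C) :
  Cmod z < 1 -> Cmod (Nat.iter n phi z) < 1.
Proof.
  intros Hz; induction n as [| n IH]; [exact Hz |]; simpl; apply (km_phi_disc M), IH.
Qed.

Lemma h_iter_phi {phi h V s} (M : koenigs_model phi h V s) (n : nat) (z : C) :
  Cmod z < 1 -> h (Nat.iter n phi z) = (h z + RtoC (INR n))%C.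
Proof.
  intros Hz; induction n as [| n IH].
  - simpl; ring.
  - rewrite S_INR, RtoC_plus; simpl.
    rewrite (km_h_phi M) by (apply (iter_phi_disc M), Hz).
    rewrite IH; ring.
Qed.

Lemma V_iter_phi {phi h V s} (M : koenigs_model phi h V s) (n : nat) (z : C) :
  V z -> V (Nat.iter n phi z).
Proof. intros Hz; induction n as [| n IH]; [exact Hz |]; simpl; apply (km_V_phi M), IH. Qed.

Lemma image_plus {phi h V s} (M : koenigs_model phi h V s) (n : nat) (w : C) :
  image h V w ->
  image h V (w + RtoC (INR n))%C /\ s (w + RtoC (INR n))%C = Nat.iter n phi (s w).
Proof.
  intros Hw; destruct (image_s M w Hw) as [A B].
  assert (D := km_V_disc M _ A).
  assert (E := V_iter_phi M n _ A).
  assert (F := h_iter_phi M n _ D); rewrite B in F.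
  split; [exists (Nat.iter n phi (s w)); split; assumption |].
  rewrite <- F; apply (km_s_h M), E.
Qed.

Lemma image_plus_le {phi h V s} (M : koenigs_model phi h V s) (n m : nat) (w : C) :
  (n <= m)%nat -> image h V (w + RtoC (INR n))%C -> image h V (w + RtoC (INR m))%C.
Proof.
  intros L H; destruct (image_plus M (m - n) _ H) as [A _].
  replace (w + RtoC (INR m))%C with (w + RtoC (INR n) + RtoC (INR (m - n)))%C; [exact A |].
  rewrite minus_INR, RtoC_minus by exact L; ring.
Qed.

(** From some time on every orbit lies in [V], where [s] turns iteration of [phi] into translation
    by 1. *)
Lemma iter_phi_s {phi h V s} (M : koenigs_model phi h V s) (z : C) :
  Cmod z < 1 -> exists N, forall n, (N <= n)%nat ->
    image h V (h z + RtoC (INR n))%C /\ s (h z + RtoC (INR n))%C = Nat.iter n phi z.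
Proof.
  intros Hz; destruct (km_absorb M z Hz) as [N HN].
  exists N; intros n L.
  assert (A : V (Nat.iter n phi z)).
  { replace n with ((n - N) + N)%nat by lia; rewrite Nat.iter_add.
    apply (V_iter_phi M), HN. }
  rewrite <- (h_iter_phi M n z Hz).
  split; [exists (Nat.iter n phi z); split; [exact A | reflexivity] | apply (km_s_h M), A].
Qed.

Lemma image_absorbs {phi h V s} (M : koenigs_model phi h V s) (w : C) :
  exists n, image h V (w + RtoC (INR n))%C.
Proof.
  destruct (km_cover M w) as (n & z & Hz & ->).
  destruct (iter_phi_s M z Hz) as [N HN].
  exists (N + n)%nat; destruct (HN N (le_n N)) as [A _].
  replace (h z - RtoC (INR n) + RtoC (INR (N + n)))%C with (h z + RtoC (INR N))%C; [exact A |].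
  rewrite plus_INR, RtoC_plus; ring.
Qed.

(** A compactness argument: each [w] has a neighbourhood that a single translation moves into the
    open set [h V], and later translations keep it there. *)
Lemma image_absorbs_disc {phi h V s} (M : koenigs_model phi h V s) (rho : R) :
  exists N, forall w n, Cmod w <= rho -> (N <= n)%nat -> image h V (w + RtoC (INR n))%C.
Proof.
  (* The radius is coupled to the translation by [(INR n + 1) * d <= 1], so the lower bound on radii
     that [compactness_value_2d] yields is also an upper bound on [n]. *)
  assert (D : forall u v : R, {d : posreal | exists n, (INR n + 1) * d <= 1 /\
    forall w : C, Rabs (fst w - u) < d -> Rabs (snd w - v) < d -> image h V (w + RtoC (INR n))%C}).
  { intros u v; apply constructive_indefinite_description.
    destruct (image_absorbs M (u, v)) as [n Hn].
    destruct (image_open M _ Hn) as [d [Pd K]].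
    assert (PI := pos_INR n).
    assert (Pm : 0 < Rmin (d / 2) (/ (INR n + 1))).
    { apply Rmin_pos; [lra | apply Rinv_0_lt_compat; lra]. }
    exists (mkposreal _ Pm), n; simpl; split.
    - apply Rle_trans with ((INR n + 1) * / (INR n + 1)); [| apply Req_le; field; lra].
      apply Rmult_le_compat_l; [lra | apply Rmin_r].
    - intros w H1 H2; apply K.
      assert (Q := Rmin_l (d / 2) (/ (INR n + 1))).
      apply Rle_lt_trans with (1 := Cmod_le_Rabs _).
      replace (fst (w + RtoC (INR n) - ((u, v) + RtoC (INR n)))%C) with (fst w - u) by (simpl; ring).
      replace (snd (w + RtoC (INR n) - ((u, v) + RtoC (INR n)))%C) with (snd w - v) by (simpl; ring).
      lra. }
  destruct (compactness_value_2d (- rho) rho (- rho) rho (fun u v => proj1_sig (D u v))) as [d Hd].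
  destruct (INR_unbounded (/ d)) as [N HN].
  exists N; intros w n Hw Ln.
  assert (B := Rmax_Cmod w).
  assert (B1 := Rle_trans _ _ _ (Rmax_l _ _) B); assert (B2 := Rle_trans _ _ _ (Rmax_r _ _) B).
  assert (B3 : - rho <= fst w <= rho) by (apply Rabs_le_between; lra).
  assert (B4 : - rho <= snd w <= rho) by (apply Rabs_le_between; lra).
  destruct (NNPP _ (Hd (fst w) (snd w) B3 B4)) as (u & v & _ & _ & H1 & H2 & H3).
  destruct (D u v) as [e (k & K1 & K2)]; simpl in H1, H2, H3.
  apply (image_plus_le M k); [| apply K2; assumption].
  apply INR_le; apply Rle_trans with (2 := le_INR _ _ Ln).
  apply Rle_trans with (/ d); [| lra].
  assert (Pd := cond_pos d); assert (PI := pos_INR k).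
  apply Rmult_le_reg_r with d; [exact Pd |]; rewrite Rinv_l by lra.
  apply Rle_trans with ((INR k + 1) * e); [| exact K1].
  apply Rmult_le_compat; lra.
Qed.

(** After rescaling, [s] is a self-map of the unit disc sending the centre to [s w], so it contracts
    by the factor [Cmod (v - w) / R]. *)
Lemma schwarz_pick_s {phi h V s} (M : koenigs_model phi h V s) (w v : C) (R : R) :
  (forall u, Cmod (u - w) < R -> image h V u) -> Cmod (v - w) < R ->
  R * Cmod (s v - s w) <= Cmod (v - w) * Cmod (1 - Cconj (s w) * s v).
Proof.
  intros HR Hv; assert (Pv := Cmod_ge_0 (v - w)).
  assert (PR : 0 < R) by lra.
  assert (NR : RtoC R <> 0) by (apply RtoC_neq_0; lra).
  set (f := fun u => s (w + RtoC R * u)%C).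
  assert (Im : forall u, Cmod u < 1 -> image h V (w + RtoC R * u)%C).
  { intros u Hu; apply HR; replace (w + RtoC R * u - w)%C with (RtoC R * u)%C by ring.
    rewrite Cmod_mult, Cmod_R, Rabs_pos_eq by lra; nra. }
  assert (E := schwarz_pick f ((v - w) / RtoC R) 0).
  assert (A1 : Cmod ((v - w) / RtoC R) = Cmod (v - w) / R).
  { rewrite Cmod_div, Cmod_R, Rabs_pos_eq by (auto; lra); reflexivity. }
  assert (A2 : f ((v - w) / RtoC R)%C = s v).
  { unfold f; f_equal; field; exact NR. }
  assert (A3 : f 0 = s w) by (unfold f; f_equal; ring).
  rewrite A2, A3, Cmod_sub_0, A1 in E.
  replace (1 - Cconj 0 * ((v - w) / RtoC R))%C with (RtoC 1) in E
    by (apply injective_projections; simpl; ring).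
  rewrite Cmod_1 in E.
  assert (G : Cmod (s v - s w) * 1 <= Cmod (v - w) / R * Cmod (1 - Cconj (s w) * s v)).
  { apply E.
    - intros u Hu; rewrite Cmod_sub_0 in Hu.
      apply (ex_derive_C_comp s (fun u => w + RtoC R * u)%C).
      + apply (ex_derive_s M), Im, Hu.
      + apply ex_derive_C_affine.
    - intros u Hu; apply (km_V_disc M), (image_s M), Im, Hu.
    - apply Rmult_lt_reg_r with R; [exact PR |].
      replace (Cmod (v - w) / R * R) with (Cmod (v - w)) by (field; lra); lra.
    - rewrite Cmod_0; lra. }
  apply (Rmult_le_compat_l R) in G; [| lra].
  replace (R * (Cmod (v - w) / R * Cmod (1 - Cconj (s w) * s v)))
    with (Cmod (v - w) * Cmod (1 - Cconj (s w) * s v)) in G by (field; lra).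
  lra.
Qed.

(** For large [n], [h V] contains a disc around [h y + n] so large that [s] contracts the
    distance from [h y + n] to [h x + n] by a factor [eps]. *)
Lemma orbits_merge {phi h V s} (M : koenigs_model phi h V s) (x y : C) (eps : R) :
  Cmod x < 1 -> Cmod y < 1 -> 0 < eps -> exists N, forall n, (N <= n)%nat ->
    Cmod (Nat.iter n phi x - Nat.iter n phi y) <=
    eps * Cmod (1 - Cconj (Nat.iter n phi y) * Nat.iter n phi x).
Proof.
  intros Hx Hy He.
  set (L := Cmod (h x - h y)); assert (PL : 0 <= L) by apply Cmod_ge_0.
  (* [R > L] puts [h x + n] inside the disc around [h y + n], and [L <= eps * R] gives the factor
     [eps]. *)
  set (R := L + 1 + L / eps).
  assert (PLe : 0 <= L / eps) by (apply Rdiv_le_0_compat; lra).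
  destruct (image_absorbs_disc M (Cmod (h y) + R)) as [N0 H0].
  destruct (iter_phi_s M x Hx) as [N1 H1].
  destruct (iter_phi_s M y Hy) as [N2 H2].
  exists (N0 + N1 + N2)%nat; intros n Ln.
  destruct (H1 n ltac:(lia)) as [I1 <-]; destruct (H2 n ltac:(lia)) as [I2 <-].
  assert (E := schwarz_pick_s M (h y + RtoC (INR n)) (h x + RtoC (INR n)) R).
  replace (h x + RtoC (INR n) - (h y + RtoC (INR n)))%C with (h x - h y)%C in E by ring.
  fold L in E.
  assert (G : R * Cmod (s (h x + RtoC (INR n))%C - s (h y + RtoC (INR n))%C) <=
    L * Cmod (1 - Cconj (s (h y + RtoC (INR n))%C) * s (h x + RtoC (INR n))%C)).
  { apply E; [| unfold R; lra].
    intros u Hu; replace u with ((u - RtoC (INR n)) + RtoC (INR n))%C by ring.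
    apply H0; [| lia].
    replace (u - RtoC (INR n))%C with ((u - (h y + RtoC (INR n))) + h y)%C by ring.
    apply Rle_trans with (1 := Cmod_triangle _ _); lra. }
  set (D := Cmod (1 - Cconj (s (h y + RtoC (INR n))%C) * s (h x + RtoC (INR n))%C)) in *.
  assert (PD : 0 <= D) by apply Cmod_ge_0.
  assert (PR : 0 < R) by (unfold R; lra).
  apply Rmult_le_reg_l with (1 := PR); apply Rle_trans with (1 := G).
  replace (R * (eps * D)) with (eps * R * D) by ring.
  apply Rmult_le_compat_r; [exact PD |].
  unfold R; replace (eps * (L + 1 + L / eps)) with (eps * (L + 1) + L) by (field; lra); nra.
Qed.

(** * The coefficient of a commuting map *)

Definition commuting_map (phi psi : C -> C) : Prop :=
  holo_disc psi 0 1 /\ (forall z, Cmod z < 1 -> Cmod (psi z) < 1) /\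
  (forall z, Cmod z < 1 -> psi (phi z) = phi (psi z)).

Lemma commuting_iter {phi h V s} (M : koenigs_model phi h V s) (psi : C -> C) (n : nat) (z : C) :
  commuting_map phi psi -> Cmod z < 1 ->
  psi (Nat.iter n phi z) = Nat.iter n phi (psi z).
Proof.
  intros (_ & _ & Hc) Hz; induction n as [| n IH]; [reflexivity |]; simpl.
  rewrite Hc, IH; [reflexivity | apply (iter_phi_disc M), Hz].
Qed.

(** [psi] sends the orbit of 0 to the orbit of [psi 0], with which it merges; [t n] is the
    pseudo-hyperbolic distance between the two at time [n]. *)
Lemma julia_commuting {phi h V s} (M : koenigs_model phi h V s) (psi : C -> C) (tau : C) :
  commuting_map phi psi -> Cmod tau = 1 ->
  is_lim_seq (fun n => Cmod (Nat.iter n phi 0 - tau)) 0 ->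
  forall z, Cmod z < 1 ->
    Cmod (tau - psi z) ^ 2 * (1 - Cmod z ^ 2) <= Cmod (tau - z) ^ 2 * (1 - Cmod (psi z) ^ 2).
Proof.
  intros Hpsi Ht Hlim.
  assert (C0 : Cmod 0 < 1) by (rewrite Cmod_0; lra).
  generalize Hpsi; intros (P1 & P2 & P3).
  set (u := fun n => Nat.iter n phi 0).
  assert (Hu : forall n, Cmod (u n) < 1) by (intros n; apply (iter_phi_disc M), C0).
  set (t := fun n => Cmod (psi (u n) - u n) / Cmod (1 - Cconj (u n) * psi (u n))).
  assert (Pd : forall n, 0 < Cmod (1 - Cconj (u n) * psi (u n))).
  { intros n; assert (A := one_sub_conj_ge (psi (u n)) (u n)).
    assert (A1 := Hu n); assert (A2 := P2 _ A1); lra. }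
  apply (julia psi tau u t); auto.
  - intros n; split.
    + apply Rdiv_le_0_compat; [apply Cmod_ge_0 | apply Pd].
    + unfold t; rewrite <- Cmod_moebius_opp by auto; apply moebius_lt_1; rewrite ?Cmod_opp; auto.
  - apply is_lim_seq_spec; intros eps.
    assert (Pe := cond_pos eps).
    destruct (orbits_merge M (psi 0) 0 (eps / 2) (P2 _ C0) C0 ltac:(lra)) as [N HN].
    exists N; intros n Ln; specialize (HN n Ln).
    rewrite <- (commuting_iter M psi n 0 Hpsi C0) in HN; fold (u n) in HN.
    rewrite Rminus_0_r, Rabs_pos_eq by (apply Rdiv_le_0_compat; [apply Cmod_ge_0 | apply Pd]).
    unfold t; specialize (Pd n).
    apply Rmult_lt_reg_r with (1 := Pd).
    unfold Rdiv; rewrite Rmult_assoc, Rinv_l, Rmult_1_r by lra; nra.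
  - intros n; unfold t; apply Req_le; field; specialize (Pd n); lra.
Qed.

(** Late points of the orbits of [psi x] and [psi y] are values of [s] at the same arguments, so
    they coincide; as [psi] separates late points of the merged orbits of [x] and [y], these
    coincide as well. *)
Lemma h_commuting_injective {phi h V s} (M : koenigs_model phi h V s) (psi : C -> C) (tau x y : C) :
  commuting_map phi psi -> Cmod tau = 1 ->
  is_lim_seq (fun n => Cmod (Nat.iter n phi 0 - tau)) 0 ->
  Cmod x < 1 -> Cmod y < 1 -> h (psi x) = h (psi y) -> h x = h y.
Proof.
  intros Hpsi Ht Hlim Hx Hy E.
  assert (J := julia_commuting M psi tau Hpsi Ht Hlim).
  generalize Hpsi; intros (P1 & P2 & P3).
  destruct (iter_phi_s M _ (P2 x Hx)) as [N1 H1].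
  destruct (iter_phi_s M _ (P2 y Hy)) as [N2 H2].
  (* The threshold of [injective_where_close_to_id], both for the pair of orbits and for the
     displacement by [psi]. *)
  destruct (orbits_merge M x y (/ 10) Hx Hy ltac:(lra)) as [N3 H3].
  destruct (orbits_merge M (psi y) y (/ 10) (P2 y Hy) Hy ltac:(lra)) as [N4 H4].
  set (n := (N1 + N2 + N3 + N4)%nat).
  destruct (H1 n ltac:(lia)) as [_ I1]; destruct (H2 n ltac:(lia)) as [_ I2].
  specialize (H3 n ltac:(lia)); specialize (H4 n ltac:(lia)).
  rewrite E, I2 in I1.
  rewrite <- !(commuting_iter M psi n) in * by auto.
  assert (F : Nat.iter n phi x = Nat.iter n phi y).
  { apply (injective_where_close_to_id psi tau); auto.
    - apply (iter_phi_disc M), Hx.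
    - apply (iter_phi_disc M), Hy.
    - lra.
    - lra. }
  apply (f_equal h) in F; rewrite !(h_iter_phi M) in F by assumption.
  replace (h x) with (h x + RtoC (INR n) - RtoC (INR n))%C by ring; rewrite F; ring.
Qed.

(** [h o psi = g o h] for an entire function [g], which is injective and satisfies
    [g (w + 1) = g w + 1], hence is a translation. *)
Lemma h_commuting_translation {phi h V s} (M : koenigs_model phi h V s) (psi : C -> C) (tau : C) :
  commuting_map phi psi -> Cmod tau = 1 ->
  is_lim_seq (fun n => Cmod (Nat.iter n phi 0 - tau)) 0 ->
  exists c : C, forall z, Cmod z < 1 -> h (psi z) = (h z + c)%C.
Proof.
  intros Hpsi Ht Hlim.
  generalize Hpsi; intros (P1 & P2 & P3).
  (* Move [w] into [h V] by a translation, apply [psi] in the coordinate [h], and translate back; by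
     [Step] the result does not depend on [n]. *)
  set (lift := fun (w : C) n => (h (psi (s (w + RtoC (INR n)))) - RtoC (INR n))%C).
  assert (Step : forall w n k, image h V (w + RtoC (INR n))%C -> lift w (n + k)%nat = lift w n).
  { intros w n k Hw; destruct (image_plus M k _ Hw) as [A B].
    destruct (image_s M _ Hw) as [A1 _]; apply (km_V_disc M) in A1.
    unfold lift; rewrite plus_INR, RtoC_plus.
    replace (w + (RtoC (INR n) + RtoC (INR k)))%C with (w + RtoC (INR n) + RtoC (INR k))%C by ring.
    rewrite B, (commuting_iter M), (h_iter_phi M) by auto; ring. }
  set (g := fun w => epsilon (inhabits (RtoC 0))
    (fun v => exists n, image h V (w + RtoC (INR n))%C /\ v = lift w n)).
  assert (Gl : forall w n, image h V (w + RtoC (INR n))%C -> g w = lift w n).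
  { intros w n Hn.
    destruct (epsilon_spec (inhabits (RtoC 0))
      (fun v => exists n, image h V (w + RtoC (INR n))%C /\ v = lift w n)) as [m [Hm Em]].
    { exists (lift w n), n; split; [exact Hn | reflexivity]. }
    fold (g w) in Em; rewrite Em.
    rewrite <- (Step w m n Hm), <- (Step w n m Hn); f_equal; lia. }
  assert (Dg : forall w : C, ex_derive g w).
  { intros w; destruct (image_absorbs M w) as [n Hn].
    destruct (image_open M _ Hn) as [d [Pd K]].
    destruct (image_s M _ Hn) as [A1 _]; apply (km_V_disc M) in A1.
    apply (ex_derive_C_eq_near (fun v => lift v n) g w d Pd).
    - intros v Hv; symmetry; apply Gl, K.
      replace (v + RtoC (INR n) - (w + RtoC (INR n)))%C with (v - w)%C by ring; exact Hv.
    - unfold lift; apply ex_derive_C_minus; [| apply ex_derive_C_const].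
      apply (ex_derive_C_comp h (fun v => psi (s (v + RtoC (INR n))))%C).
      { apply (km_h_holo M); rewrite Cmod_sub_0; auto. }
      apply (ex_derive_C_comp psi (fun v => s (v + RtoC (INR n)))%C).
      { apply P1; rewrite Cmod_sub_0; auto. }
      apply (ex_derive_C_comp s (fun v => v + RtoC (INR n))%C).
      { apply (ex_derive_s M), Hn. }
      apply ex_derive_C_plus_const. }
  assert (Ig : forall v w, g v = g w -> v = w).
  { intros v w E.
    destruct (image_absorbs M v) as [n1 N1].
    destruct (image_absorbs M w) as [n2 N2].
    set (n := (n1 + n2)%nat).
    apply (image_plus_le M n1 n) in N1; [| lia].
    apply (image_plus_le M n2 n) in N2; [| lia].
    rewrite (Gl v n N1), (Gl w n N2) in E; unfold lift in E.
    destruct (image_s M _ N1) as [A1 B1]; destruct (image_s M _ N2) as [A2 B2].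
    assert (F : h (s (v + RtoC (INR n))%C) = h (s (w + RtoC (INR n))%C)).
    { apply (h_commuting_injective M psi tau); auto; try (apply (km_V_disc M); assumption).
      match goal with |- ?p = ?q => replace p with (p - RtoC (INR n) + RtoC (INR n))%C by ring end.
      rewrite E; ring. }
    rewrite B1, B2 in F.
    replace v with (v + RtoC (INR n) - RtoC (INR n))%C by ring; rewrite F; ring. }
  destruct (entire_injective_affine g Dg Ig) as (a & Na & Ha).
  assert (G1 : g 1 = (g 0 + 1)%C).
  { destruct (image_absorbs M 1) as [n Hn].
    assert (En : (1 + RtoC (INR n))%C = (0 + RtoC (INR (S n)))%C) by (rewrite S_INR, RtoC_plus; ring).
    rewrite (Gl 1 n Hn); assert (Hn' := Hn); rewrite En in Hn'; rewrite (Gl 0 (S n) Hn').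
    unfold lift; rewrite En, S_INR, RtoC_plus; ring. }
  assert (Ea : a = 1).
  { rewrite Ha in G1; replace a with (g 0 + a * 1 - g 0)%C by ring; rewrite G1; ring. }
  exists (g 0); intros z Hz.
  destruct (iter_phi_s M z Hz) as [N HN].
  destruct (HN N (le_n N)) as [A B].
  assert (E := Gl (h z) N A); unfold lift in E.
  rewrite B, (commuting_iter M), (h_iter_phi M) in E by auto.
  rewrite Ha, Ea in E.
  replace (h (psi z)) with (h (psi z) + RtoC (INR N) - RtoC (INR N))%C by ring; rewrite <- E; ring.
Qed.

(** Both sides are holomorphic near the half-line [n + w], [n] large, on which they agree far
    to the right; the identity theorem brings the equality back along overlapping discs. *)
Lemma commuting_on_discs {phi h V s} (M : koenigs_model phi h V s) (psi : C -> C) (c : C) (N : nat) :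
  commuting_map phi psi -> (forall z, Cmod z < 1 -> h (psi z) = (h z + c)%C) ->
  (forall w n, Cmod w <= Cmod c + 2 -> (N <= n)%nat -> image h V (w + RtoC (INR n))%C) ->
  forall w, Cmod w < 2 -> psi (s (w + RtoC (INR N))%C) = s (w + c + RtoC (INR N))%C.
Proof.
  intros Hpsi Hc HN; generalize Hpsi; intros (P1 & P2 & P3).
  assert (Pc := Cmod_ge_0 c).
  assert (Im : forall n w, (N <= n)%nat -> Cmod w < 2 -> image h V (w + RtoC (INR n))%C).
  { intros n w Ln Hw; apply HN; [lra | exact Ln]. }
  assert (Imc : forall n w, (N <= n)%nat -> Cmod w < 2 -> image h V (w + c + RtoC (INR n))%C).
  { intros n w Ln Hw; apply HN; [| exact Ln].
    apply Rle_trans with (1 := Cmod_triangle _ _); lra. }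
  assert (Sd : forall w, image h V w -> Cmod (s w) < 1).
  { intros w Hw; apply (km_V_disc M), (image_s M), Hw. }
  set (f := fun n w => (psi (s (w + RtoC (INR n))) - s (w + c + RtoC (INR n)))%C).
  assert (Hf : forall n, (N <= n)%nat -> holo_disc (f n) 0 2).
  { intros n Ln w Hw; rewrite Cmod_sub_0 in Hw; unfold f; apply ex_derive_C_minus.
    - apply (ex_derive_C_comp psi (fun w => s (w + RtoC (INR n)))%C).
      { apply P1; rewrite Cmod_sub_0; apply Sd, Im; assumption. }
      apply (ex_derive_C_comp s (fun w => w + RtoC (INR n))%C).
      { apply (ex_derive_s M), Im; assumption. }
      apply ex_derive_C_plus_const.
    - apply (ex_derive_C_comp s (fun w => w + c + RtoC (INR n))%C).
      { apply (ex_derive_s M), Imc; assumption. }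
      apply ex_derive_C_plus; [| apply ex_derive_C_const].
      apply ex_derive_C_plus_const. }
  assert (I0 : image h V (0 + RtoC (INR N))%C) by (apply Im; [lia | rewrite Cmod_0; lra]).
  (* After [k] more steps this point is in [V], and so are its neighbours by continuity; there [s]
     inverts [h] and the identity is immediate. *)
  destruct (km_absorb M (psi (s (0 + RtoC (INR N))%C))) as [k Hk]; [auto |].
  destruct (km_V_open M _ Hk) as [e [Pe Ke]].
  assert (Cont : forall j, ex_derive (Nat.iter j phi) (psi (s (0 + RtoC (INR N))%C))).
  { induction j as [| j IH]; [apply ex_derive_C_id |]; simpl.
    apply (ex_derive_C_comp phi (Nat.iter j phi)); [| exact IH].
    apply (km_phi_holo M); rewrite Cmod_sub_0; apply (iter_phi_disc M); auto. }
  assert (D0 : ex_derive (fun w => Nat.iter k phi (psi (s (w + RtoC (INR N))%C))) (RtoC 0)).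
  { apply (ex_derive_C_comp (Nat.iter k phi) (fun w => psi (s (w + RtoC (INR N))%C))); [apply Cont |].
    apply (ex_derive_C_comp psi (fun w => s (w + RtoC (INR N)))%C).
    { apply P1; rewrite Cmod_sub_0; auto. }
    apply (ex_derive_C_comp s (fun w => w + RtoC (INR N))%C).
    { apply (ex_derive_s M), I0. }
    apply ex_derive_C_plus_const. }
  destruct (ex_derive_C_continuous _ _ D0 e Pe) as [d [Pd Kd]].
  assert (Top : forall w, Cmod (w - 0) < 2 -> f (N + k)%nat w = 0).
  { apply (identity_theorem (f (N + k)%nat) 0 (Rmin d 2) 2); [apply Rmin_pos; lra | apply Hf; lia |].
    intros w Hw.
    assert (W1 := Rlt_le_trans _ _ _ Hw (Rmin_l _ _)).
    assert (W2 := Rlt_le_trans _ _ _ Hw (Rmin_r _ _)); rewrite Cmod_sub_0 in W2.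
    specialize (Kd w W1); apply Ke in Kd.
    assert (Iw := Im N w (le_n N) W2).
    destruct (image_plus M k _ Iw) as [_ Es].
    destruct (image_s M _ Iw) as [_ Eh].
    assert (Eq : (w + RtoC (INR (N + k)))%C = (w + RtoC (INR N) + RtoC (INR k))%C)
      by (rewrite plus_INR, RtoC_plus; ring).
    unfold f; rewrite Eq, Es, (commuting_iter M) by auto.
    assert (Es2 := km_s_h M _ Kd).
    rewrite (h_iter_phi M), Hc, Eh in Es2 by auto.
    rewrite <- Es2; replace (w + c + RtoC (INR (N + k)))%C with (w + RtoC (INR N) + c + RtoC (INR k))%C
      by (rewrite plus_INR, RtoC_plus; ring); ring. }
  assert (Down : forall j, (j <= k)%nat -> forall w, Cmod (w - 0) < 2 -> f (N + (k - j))%nat w = 0).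
  { induction j as [| j IH]; intros Lj.
    - rewrite Nat.sub_0_r; exact Top.
    (* [f (n + 1)] at [w - 1] equals [f n] at [w], so vanishing on the disc of radius 2 at one level
       gives vanishing on the unit disc at the level below. This is why radius 2 is used. *)
    - apply (identity_theorem (f (N + (k - S j))%nat) 0 1 2); [lra | apply Hf; lia |].
      intros w Hw; rewrite Cmod_sub_0 in Hw.
      specialize (IH ltac:(lia) (w - 1)%C).
      rewrite Cmod_sub_0 in IH.
      assert (B := Cmod_sub_le w 1); rewrite Cmod_1 in B.
      rewrite <- (IH ltac:(lra)); unfold f.
      replace (N + (k - j))%nat with (S (N + (k - S j))) by lia.
      rewrite S_INR, RtoC_plus; f_equal; [f_equal |]; f_equal; ring. }
  intros w Hw.
  assert (E := Down k (le_n k) w ltac:(rewrite Cmod_sub_0; exact Hw)).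
  rewrite Nat.sub_diag, Nat.add_0_r in E; unfold f in E.
  match type of E with (?p - ?q)%C = _ => replace p with (p - q + q)%C by ring end.
  rewrite E; ring.
Qed.

(** On a fixed small disc [psi = s o (h + c)], and [s] is Lipschitz there, uniformly in [c]. *)
Lemma commuting_maps_close {phi h V s} (M : koenigs_model phi h V s) (B r eps : R) :
  0 <= B -> r < 1 -> 0 < eps -> exists eta, 0 < eta /\ forall (f g : C -> C) (b c : C),
    commuting_map phi f -> (forall z, Cmod z < 1 -> h (f z) = (h z + b)%C) ->
    commuting_map phi g -> (forall z, Cmod z < 1 -> h (g z) = (h z + c)%C) ->
    Cmod b <= B -> Cmod c <= B -> Cmod (b - c) <= eta ->
    forall z, Cmod z <= r -> Cmod (f z - g z) <= eps.
Proof.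
  intros PB Hr He.
  (* Leaves room for [w + c] with [Cmod w < 1] together with the unit disc around it, and for the
     radius [Cmod c + 2] of [commuting_on_discs]. *)
  destruct (image_absorbs_disc M (B + 4)) as [N HN].
  assert (I0 : image h V (0 + RtoC (INR N))%C) by (apply HN; [rewrite Cmod_0; lra | lia]).
  set (a := s (0 + RtoC (INR N))%C).
  destruct (image_s M _ I0) as [Va Ha]; fold a in Va, Ha.
  assert (Da := km_V_disc M _ Va).
  destruct (km_V_open M _ Va) as [d1 [Pd1 K1]].
  (* Close to [a] the number [w = h z - INR N] has modulus less than 1. *)
  destruct (ex_derive_C_continuous h a) with (eps := 1) as [d2 [Pd2 K2]]; [| lra |].
  { apply (km_h_holo M); rewrite Cmod_sub_0; exact Da. }
  destruct (small_on_small_disc a (Rmin d1 d2) r eps Da) as [eta [Peta Keta]]; auto.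
  { apply Rmin_pos; assumption. }
  (* [eta / 2] offsets the bound 2 for [Cmod (1 - Cconj (g z) * f z)]; [/ 2] keeps [b - c] inside
     the unit disc on which Schwarz-Pick for [s] is applied. *)
  exists (Rmin (eta / 2) (/ 2)); split; [apply Rmin_pos; lra |].
  intros f g b c Hf Hb Hg Hc Bb Bc Hbc.
  assert (E1 := Rle_trans _ _ _ Hbc (Rmin_l _ _)); assert (E2 := Rle_trans _ _ _ Hbc (Rmin_r _ _)).
  assert (Hf' := Hf); destruct Hf' as (F1 & F2 & _).
  assert (Hg' := Hg); destruct Hg' as (G1 & G2 & _).
  apply Keta.
  - intros z Hz; apply ex_derive_C_minus; [apply F1, Hz | apply G1, Hz].
  - intros z Hz; apply Rle_trans with (1 := Cmod_sub_le _ _).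
    specialize (F2 z Hz); specialize (G2 z Hz); lra.
  - intros z Hz Hza.
    assert (Vz := K1 z (Rlt_le_trans _ _ _ Hza (Rmin_l _ _))).
    assert (Hh := K2 z (Rlt_le_trans _ _ _ Hza (Rmin_r _ _))); rewrite Ha in Hh.
    set (w := (h z - RtoC (INR N))%C).
    replace (h z - (0 + RtoC (INR N)))%C with w in Hh by (unfold w; ring).
    assert (Ez : z = s (w + RtoC (INR N))%C).
    { replace (w + RtoC (INR N))%C with (h z) by (unfold w; ring); symmetry; apply (km_s_h M), Vz. }
    assert (Ef : f z = s (w + b + RtoC (INR N))%C).
    { rewrite Ez; apply (commuting_on_discs M f b N); auto; [| lra].
      intros v n Hv Ln; apply HN; [lra | exact Ln]. }
    assert (Eg : g z = s (w + c + RtoC (INR N))%C).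
    { rewrite Ez; apply (commuting_on_discs M g c N); auto; [| lra].
      intros v n Hv Ln; apply HN; [lra | exact Ln]. }
    assert (SP := schwarz_pick_s M (w + c + RtoC (INR N)) (w + b + RtoC (INR N)) 1).
    replace (w + b + RtoC (INR N) - (w + c + RtoC (INR N)))%C with (b - c)%C in SP by ring.
    assert (Q : 1 * Cmod (f z - g z) <= Cmod (b - c) * Cmod (1 - Cconj (g z) * f z)).
    { rewrite Ef, Eg; apply SP; [| lra].
      intros u Hu; replace u with ((u - RtoC (INR N)) + RtoC (INR N))%C by ring.
      apply HN; [| lia].
      replace (u - RtoC (INR N))%C with ((u - (w + c + RtoC (INR N))) + (w + c))%C by ring.
      assert (T1 := Cmod_triangle (u - (w + c + RtoC (INR N))) (w + c)).
      assert (T2 := Cmod_triangle w c); lra. }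
    assert (Q2 : Cmod (1 - Cconj (g z) * f z) <= 2).
    { apply Rle_trans with (1 := Cmod_sub_le _ _); rewrite Cmod_1, Cmod_mult, Cmod_conj.
      specialize (F2 z Hz); specialize (G2 z Hz).
      assert (P2 := Cmod_ge_0 (f z)); nra. }
    assert (P4 := Cmod_ge_0 (1 - Cconj (g z) * f z)); nra.
Qed.

(** * Limits of commuting maps *)

Definition tends_to (u : nat -> C) (l : C) : Prop :=
  forall eps, 0 < eps -> exists N, forall n, (N <= n)%nat -> Cmod (u n - l) < eps.

Lemma tends_to_unique (u : nat -> C) (l l' : C) : tends_to u l -> tends_to u l' -> l = l'.
Proof.
  intros H H'; apply Cmod_sub_eq_0, le_epsilon; intros eps He; rewrite Rplus_0_l.
  destruct (H (eps / 2)) as [N K]; [lra |]; destruct (H' (eps / 2)) as [N' K']; [lra |].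
  specialize (K (N + N')%nat ltac:(lia)); specialize (K' (N + N')%nat ltac:(lia)).
  rewrite Cmod_sub_sym in K.
  assert (A := Cmod_sub_triangle l (u (N + N')%nat) l'); lra.
Qed.

Lemma tends_to_ext (u v : nat -> C) (l : C) : (forall n, u n = v n) -> tends_to u l -> tends_to v l.
Proof.
  intros E H eps He; destruct (H eps He) as [N K]; exists N; intros n Hn; rewrite <- E; apply K, Hn.
Qed.

Lemma tends_to_map (f : C -> C) (u : nat -> C) (l : C) :
  ex_derive f l -> tends_to u l -> tends_to (fun n => f (u n)) (f l).
Proof.
  intros Hf H eps He; destruct (ex_derive_C_continuous f l Hf eps He) as [d [Pd K]].
  destruct (H d Pd) as [N L]; exists N; intros n Hn; apply K, L, Hn.
Qed.

Lemma tends_to_plus (b : C) (u : nat -> C) (l : C) :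
  tends_to u l -> tends_to (fun n => b + u n)%C (b + l)%C.
Proof.
  apply (tends_to_map (fun z => b + z)%C).
  apply ex_derive_C_plus; [apply ex_derive_C_const | apply ex_derive_C_id].
Qed.

Lemma C_complete (u : nat -> C) :
  (forall eps, 0 < eps -> exists N, forall n m, (N <= n)%nat -> (N <= m)%nat -> Cmod (u n - u m) < eps) ->
  exists l, tends_to u l.
Proof.
  intros H.
  assert (G : forall p : C -> R, (forall x y : C, Rabs (p x - p y) <= Cmod (x - y)) ->
    exists l, forall eps, 0 < eps -> exists N, forall n, (N <= n)%nat -> Rabs (p (u n) - l) < eps).
  { intros p Hp; destruct (Rcomplete.R_complete (fun n => p (u n))) as [l Hl].
    - intros eps He; destruct (H eps He) as [N HN]; exists N; intros n m Hn Hm.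
      apply Rle_lt_trans with (1 := Hp _ _), HN; assumption.
    - exists l; intros eps He; destruct (Hl eps He) as [N HN]; exists N; intros n Hn; apply HN, Hn. }
  destruct (G fst) as [l1 H1].
  { intros x y; apply Rle_trans with (2 := Rmax_Cmod (x - y)%C), Rmax_l. }
  destruct (G snd) as [l2 H2].
  { intros x y; apply Rle_trans with (2 := Rmax_Cmod (x - y)%C), Rmax_r. }
  exists (l1, l2); intros eps He.
  destruct (H1 (eps / 2)) as [N1 K1]; [lra |]; destruct (H2 (eps / 2)) as [N2 K2]; [lra |].
  exists (N1 + N2)%nat; intros n Hn.
  specialize (K1 n ltac:(lia)); specialize (K2 n ltac:(lia)).
  apply Rle_lt_trans with (1 := Cmod_le_Rabs _).
  replace (fst (u n - (l1, l2))%C) with (fst (u n) - l1) by (simpl; ring).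
  replace (snd (u n - (l1, l2))%C) with (snd (u n) - l2) by (simpl; ring); lra.
Qed.

(** The error constant depends on [r] only, so it serves all members of a bounded sequence at
    once. *)
Lemma derive_bounded_second_order (f : C -> C) (b : C) (r : R) :
  0 < r -> holo_disc f b (2 * r) -> (forall z, Cmod (z - b) < 2 * r -> Cmod (f z) <= 1) ->
  exists c : C, forall w, Cmod (w - b) <= r / 2 ->
    Cmod (f w - f b - c * (w - b)) <= 2 / r ^ 2 * Cmod (w - b) ^ 2.
Proof.
  intros Hr Hf H1.
  destruct (taylor_half f b r 1 Hr Hf) as (c & C0 & T).
  { intros z Hz; apply H1; lra. }
  exists (c 1%nat); intros w Hw; assert (E := T w 2%nat Hw).
  replace (f w - power_sum c (w - b) 2)%C with (f w - f b - c 1%nat * (w - b))%C in E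
    by (rewrite <- C0; simpl; ring).
  apply Rle_trans with (1 := E), Req_le; field; lra.
Qed.

(** Pointwise convergence suffices for a bounded sequence: the second-order expansions at [b] have a
    common error constant, so the derivatives [c n] form a Cauchy sequence and the expansion passes
    to the limit. *)
Lemma holo_disc_limit (f : nat -> C -> C) (F : C -> C) :
  (forall n, holo_disc (f n) 0 1) -> (forall n z, Cmod z < 1 -> Cmod (f n z) <= 1) ->
  (forall z, Cmod z < 1 -> tends_to (fun n => f n z) (F z)) ->
  holo_disc F 0 1.
Proof.
  intros Hf H1 Hlim b Hb; rewrite Cmod_sub_0 in Hb.
  set (r := (1 - Cmod b) / 2).
  assert (Pr : 0 < r) by (unfold r; lra).
  assert (In : forall w, Cmod (w - b) < 2 * r -> Cmod w < 1).
  { intros w Hw; replace w with ((w - b) + b)%C by ring.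
    apply Rle_lt_trans with (1 := Cmod_triangle _ _); unfold r in Hw; lra. }
  set (K := 2 / r ^ 2).
  assert (PK : 0 < K) by (apply Rdiv_lt_0_compat; [lra | apply pow_lt, Pr]).
  assert (Ex : forall n, exists c : C, forall w, Cmod (w - b) <= r / 2 ->
    Cmod (f n w - f n b - c * (w - b)) <= K * Cmod (w - b) ^ 2).
  { intros n; apply derive_bounded_second_order; [exact Pr | |].
    - intros w Hw; apply Hf; rewrite Cmod_sub_0; apply In, Hw.
    - intros w Hw; apply H1, In, Hw. }
  destruct (choice _ Ex) as [c Hc].
  destruct (C_complete c) as [l Hl].
  { intros eps He.
    (* [c n] is compared with a difference quotient over the step [t]: the quadratic errors cost
       [2 * K * t <= eps / 4], and the values at [b] and [b + t] are then taken close enough for the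
       rest. *)
    set (t := Rmin (r / 2) (eps / (8 * K))).
    assert (Pt : 0 < t) by (apply Rmin_pos; [lra | apply Rdiv_lt_0_compat; lra]).
    assert (T1 : t <= r / 2) by apply Rmin_l.
    assert (T2 : t * (8 * K) <= eps).
    { apply Rle_trans with (eps / (8 * K) * (8 * K)); [| apply Req_le; field; lra].
      apply Rmult_le_compat_r; [lra | apply Rmin_r]. }
    set (w := (b + RtoC t)%C).
    assert (Ew : (w - b)%C = RtoC t) by (unfold w; ring).
    assert (Mw : Cmod (w - b) = t) by (rewrite Ew, Cmod_R, Rabs_pos_eq; lra).
    assert (Pq : 0 < t * eps / 16) by (apply Rdiv_lt_0_compat; [nra | lra]).
    destruct (Hlim b Hb (t * eps / 16) Pq) as [N1 L1].
    destruct (Hlim w ltac:(apply In; lra) (t * eps / 16) Pq) as [N2 L2].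
    exists (N1 + N2)%nat; intros n m Hn Hm.
    assert (A1 := L1 n ltac:(lia)); assert (A2 := L1 m ltac:(lia)).
    assert (A3 := L2 n ltac:(lia)); assert (A4 := L2 m ltac:(lia)).
    assert (B1 := Hc n w ltac:(lra)); assert (B2 := Hc m w ltac:(lra)).
    rewrite Mw in B1, B2.
    assert (Q : t * Cmod (c n - c m) <= 2 * (K * t ^ 2) + 4 * (t * eps / 16)).
    { replace t with (Cmod (w - b)) at 1.
      rewrite <- Cmod_mult.
      replace ((w - b) * (c n - c m))%C with
        (((f m w - f m b - c m * (w - b)) - (f n w - f n b - c n * (w - b)))
         + (((f n w - F w) - (f m w - F w)) - ((f n b - F b) - (f m b - F b))))%C by ring.
      apply Rle_trans with (1 := Cmod_triangle _ _).
      assert (D1 := Cmod_sub_le (f m w - f m b - c m * (w - b)) (f n w - f n b - c n * (w - b))).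
      assert (D2 := Cmod_sub_le ((f n w - F w) - (f m w - F w)) ((f n b - F b) - (f m b - F b))).
      assert (D3 := Cmod_sub_le (f n w - F w) (f m w - F w)).
      assert (D4 := Cmod_sub_le (f n b - F b) (f m b - F b)).
      lra. }
    apply Rmult_lt_reg_l with (1 := Pt).
    apply Rle_lt_trans with (1 := Q).
    replace (2 * (K * t ^ 2) + 4 * (t * eps / 16)) with (t * ((t * (8 * K)) / 4 + eps / 4)) by field.
    apply Rmult_lt_compat_l; lra. }
  exists l; apply (is_derive_second_order F b (F b) l K (r / 2)); [lra |].
  intros w Hw; apply le_epsilon; intros eps He.
  assert (Hw1 : Cmod w < 1) by (apply In; lra).
  destruct (Hlim b Hb (eps / 4) ltac:(lra)) as [N1 L1].
  destruct (Hlim w Hw1 (eps / 4) ltac:(lra)) as [N2 L2].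
  destruct (Hl (eps / 4) ltac:(lra)) as [N3 L3].
  set (n := (N1 + N2 + N3)%nat).
  specialize (L1 n ltac:(lia)); specialize (L2 n ltac:(lia)); specialize (L3 n ltac:(lia)).
  assert (B := Hc n w ltac:(lra)).
  replace (F w - (F b + l * (w - b)))%C with
    ((f n w - f n b - c n * (w - b)) + (((f n b - F b) - (f n w - F w)) + (c n - l) * (w - b)))%C by ring.
  apply Rle_trans with (1 := Cmod_triangle _ _).
  assert (D1 := Cmod_triangle ((f n b - F b) - (f n w - F w)) ((c n - l) * (w - b))).
  assert (D2 := Cmod_sub_le (f n b - F b) (f n w - F w)).
  rewrite (Cmod_mult (c n - l)) in D1.
  assert (P2 := Cmod_ge_0 (c n - l)).
  assert (Cmod (w - b) <= 1) by (unfold r in Hw; assert (A := Cmod_ge_0 b); lra).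
  nra.
Qed.

(** A limit of self-maps may degenerate to a constant of modulus 1; one value inside the disc
    excludes this, because Schwarz-Pick bounds [1 - Cmod (f n z)] from below in terms of [f n a]. *)
Lemma self_map_limit_lt_1 (f : nat -> C -> C) (F : C -> C) (a : C) :
  (forall n, holo_disc (f n) 0 1) -> (forall n z, Cmod z < 1 -> Cmod (f n z) < 1) ->
  (forall z, Cmod z < 1 -> tends_to (fun n => f n z) (F z)) ->
  Cmod a < 1 -> Cmod (F a) < 1 -> forall z, Cmod z < 1 -> Cmod (F z) < 1.
Proof.
  intros Hf H1 Hlim Ha HFa z Hz.
  assert (Pa := Cmod_ge_0 a); assert (Pz := Cmod_ge_0 z).
  set (X := (1 - Cmod z ^ 2) * (1 - Cmod a ^ 2)).
  assert (PX : 0 < X) by (unfold X; apply Rmult_lt_0_compat; simpl; nra).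
  set (q := (1 - Cmod (F a)) / 2).
  assert (Pq : 0 < q) by (unfold q; lra).
  (* Schwarz-Pick gives [1 - Cmod (f n z) >= X * (q * q) / 8], and half of this absorbs the distance
     to the limit. *)
  set (e := Rmin q (X * (q * q) / 16)).
  assert (PXq : 0 < X * (q * q)) by (apply Rmult_lt_0_compat; [exact PX | apply Rmult_lt_0_compat; exact Pq]).
  assert (Pe : 0 < e) by (apply Rmin_pos; lra).
  assert (E1 : e <= q) by apply Rmin_l; assert (E2 : e <= X * (q * q) / 16) by apply Rmin_r.
  destruct (Hlim a Ha e Pe) as [N1 L1]; destruct (Hlim z Hz e Pe) as [N2 L2].
  set (n := (N1 + N2)%nat).
  specialize (L1 n ltac:(lia)); specialize (L2 n ltac:(lia)).
  assert (Fa : Cmod (f n a) <= 1 - q).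
  { assert (A := Cmod_sub_ge (f n a) (F a)); unfold q in *; lra. }
  assert (D := schwarz_pick_defect (f n) z a (Hf n) (H1 n) Hz Ha); fold X in D.
  assert (Hz' := H1 n z Hz); assert (Pn := Cmod_ge_0 (f n z)); assert (Pna := Cmod_ge_0 (f n a)).
  assert (G : q <= Cmod (1 - Cconj (f n a) * f n z)).
  { rewrite one_sub_conj_sym; apply Rle_trans with (2 := one_sub_conj_ge _ _ (Rlt_le _ _ Hz')); lra. }
  assert (U : Cmod (1 - Cconj a * z) <= 2).
  { apply Rle_trans with (1 := Cmod_sub_le _ _); rewrite Cmod_1, Cmod_mult, Cmod_conj; nra. }
  assert (PU := Cmod_ge_0 (1 - Cconj a * z)).
  assert (D1 : X * (q * q) <= X * Cmod (1 - Cconj (f n a) * f n z) ^ 2).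
  { apply Rmult_le_compat_l; [lra | simpl; nra]. }
  assert (D2 : (1 - Cmod (f n z) ^ 2) * (1 - Cmod (f n a) ^ 2) * Cmod (1 - Cconj a * z) ^ 2 <=
    (1 - Cmod (f n z) ^ 2) * 4).
  { assert (0 <= 1 - Cmod (f n z) ^ 2) by (simpl; nra).
    rewrite Rmult_assoc; apply Rmult_le_compat_l; [assumption |].
    assert (0 <= 1 - Cmod (f n a) ^ 2 <= 1) by (simpl; nra).
    assert (0 <= Cmod (1 - Cconj a * z) ^ 2 <= 4) by (simpl; nra).
    nra. }
  assert (D3 : 1 - Cmod (f n z) ^ 2 <= 2 * (1 - Cmod (f n z))) by (simpl; nra).
  assert (A := Cmod_sub_ge (F z) (f n z)); rewrite Cmod_sub_sym in A.
  lra.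
Qed.

(** * Transfer to the type [disk] *)

Lemma disk_eq (x y : disk) : disk_val x = disk_val y -> x = y.
Proof.
  destruct x as [x Hx], y as [y Hy]; simpl; intros ->; f_equal; apply proof_irrelevance.
Qed.

Lemma disk_lt_1 (z : disk) : Cmod z < 1.
Proof. exact (proj2_sig z). Qed.

Lemma holomorphic_extension (f : disk -> C) :
  holomorphic f -> exists F : C -> C, (forall z : disk, f z = F z) /\ holo_disc F 0 1.
Proof.
  intros [F [E D]]; exists F; split; [exact E |].
  intros z Hz; rewrite Cmod_sub_0 in Hz; exact (D (exist _ z Hz)).
Qed.

Lemma self_map_lt_1 (f : disk -> disk) (F : C -> C) :
  (forall z : disk, disk_val (f z) = F z) -> forall z, Cmod z < 1 -> Cmod (F z) < 1.
Proof.
  intros E z Hz; assert (A := E (exist _ z Hz)); change (disk_val (f (exist _ z Hz)) = F z) in A.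
  rewrite <- A; apply disk_lt_1.
Qed.

Lemma iter_extension (phi : disk -> disk) (Phi : C -> C) (n : nat) (z : disk) :
  (forall z : disk, disk_val (phi z) = Phi z) ->
  disk_val (Nat.iter n phi z) = Nat.iter n Phi (disk_val z).
Proof. intros E; induction n as [| n IH]; [reflexivity |]; simpl; rewrite E, IH; reflexivity. Qed.

Lemma koenigs_model_exists (phi : disk -> disk) (h : disk -> C) (Phi H : C -> C) :
  (forall z : disk, disk_val (phi z) = Phi z) -> holo_disc Phi 0 1 ->
  (forall z : disk, h z = H z) -> holo_disc H 0 1 -> koenigs_function phi h ->
  exists V s, koenigs_model Phi H V s.
Proof.
  intros EPhi DPhi EH DH (_ & _ & Abel & Cover & W & ((_ & Op & _) & WPhi & Abs) & Inj).
  set (V := fun w => exists z : disk, W z /\ disk_val z = w).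
  assert (VD : forall z, V z -> Cmod z < 1) by (intros z [w [_ <-]]; apply disk_lt_1).
  assert (VO : forall z, V z -> exists d, 0 < d /\ forall w, Cmod (w - z) < d -> V w).
  { intros z [y [Hy <-]].
    destruct (Op y Hy) as [e He].
    exists (Rmin e (1 - Cmod y)); split.
    { apply Rmin_pos; [apply cond_pos | assert (A := disk_lt_1 y); lra]. }
    intros w Hw.
    destruct (Rmin_Rgt_l _ _ _ Hw) as [W1 W2].
    assert (Dw : Cmod w < 1) by (assert (A := Cmod_sub_ge w y); lra).
    exists (exist _ w Dw); split; [| reflexivity].
    (* The disc of radius [e] is contained in the square that serves as ball. *)
    apply He; exact (C_NormedModule_mixin_compat1 (disk_val y) w e W1). }
  destruct (holomorphic_inverse H V) as (s & S1 & S2 & S3).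
  - exact VO.
  - intros z Hz; apply DH; rewrite Cmod_sub_0; apply VD, Hz.
  - intros x y [p [Hp <-]] [q [Hq <-]] E; f_equal; apply Inj; auto.
    rewrite !EH; exact E.
  - exists V, s; constructor; auto.
    + exact (self_map_lt_1 phi Phi EPhi).
    + intros z Hz; assert (A := Abel (exist _ z Hz)).
      rewrite !EH, EPhi in A; exact A.
    + intros w; destruct (Cover w) as (n & z & E).
      exists n, z; split; [apply disk_lt_1 | rewrite <- EH; exact E].
    + intros z [y [Hy <-]]; exists (phi y); split; [apply WPhi, Hy | apply EPhi].
    + intros z Hz; destruct (Abs (exist _ z Hz)) as [n Hn].
      exists n, (Nat.iter n phi (exist _ z Hz)); split; [exact Hn | apply iter_extension, EPhi].
Qed.

Lemma commuting_extension (phi psi : disk -> disk) (Phi : C -> C) :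
  (forall z : disk, disk_val (phi z) = Phi z) -> in_centralizer phi psi ->
  exists Psi : C -> C, (forall z : disk, disk_val (psi z) = Psi z) /\ commuting_map Phi Psi.
Proof.
  intros EPhi [Hh Hc]; destruct (holomorphic_extension _ Hh) as [Psi [E D]].
  exists Psi; split; [exact E | split; [exact D | split]].
  - exact (self_map_lt_1 psi Psi E).
  - intros z Hz; assert (A := f_equal disk_val (Hc (exist _ z Hz))).
    rewrite E, !EPhi, E in A; exact A.
Qed.

Lemma denjoy_wolff_orbit (phi : disk -> disk) (Phi : C -> C) (tau : C) :
  (forall z : disk, disk_val (phi z) = Phi z) -> denjoy_wolff_boundary phi tau ->
  Cmod tau = 1 /\ is_lim_seq (fun n => Cmod (Nat.iter n Phi 0 - tau)) 0.
Proof.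
  intros EPhi [Ht Hlim]; split; [exact Ht |].
  apply is_lim_seq_spec; intros eps.
  (* With radius 0 the closed disc is the single point 0. *)
  assert (L := proj1 (filterlim_locunif _ _ _ _ _) Hlim 0 eps ltac:(lra) (cond_pos eps)).
  destruct L as [N HN]; exists N; intros n Hn.
  specialize (HN n Hn disk0); simpl in HN; rewrite Cmod_0 in HN.
  rewrite (iter_extension phi Phi n disk0 EPhi) in HN.
  rewrite Rminus_0_r, Rabs_pos_eq by apply Cmod_ge_0; apply HN; lra.
Qed.

Lemma koenigs_extension (phi : disk -> disk) (h : disk -> C) :
  holomorphic_self_map phi -> koenigs_function phi h ->
  exists (Phi H : C -> C) V s, koenigs_model Phi H V s /\
    (forall z : disk, disk_val (phi z) = Phi z) /\ (forall z : disk, h z = H z).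
Proof.
  intros Hphi K; destruct (holomorphic_extension _ Hphi) as [Phi [EPhi DPhi]].
  destruct (holomorphic_extension _ (proj1 K)) as [H [EH DH]].
  destruct (koenigs_model_exists phi h Phi H EPhi DPhi EH DH K) as (V & s & M).
  exists Phi, H, V, s; split; [exact M | split; assumption].
Qed.

(** Supplies the existence of the constant, without which [iota] in [lin_coef] would be an
    unspecified value. *)
Lemma lin_coef_spec (phi : disk -> disk) (h : disk -> C) :
  parabolic phi -> koenigs_function phi h ->
  forall psi, in_centralizer phi psi -> forall z, h (psi z) = (h z + lin_coef h psi)%C.
Proof.
  intros [Hphi (tau & DW & _)] K psi Hpsi.
  destruct (koenigs_extension phi h Hphi K) as (Phi & H & V & s & M & EPhi & EH).
  destruct (commuting_extension phi psi Phi EPhi Hpsi) as [Psi [EPsi CPsi]].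
  destruct (denjoy_wolff_orbit phi Phi tau EPhi DW) as [Ht Hlim].
  destruct (h_commuting_translation M Psi tau CPsi Ht Hlim) as [c Hc].
  assert (E : forall z, h (psi z) = (h z + c)%C).
  { intros z; rewrite !EH, EPsi; apply Hc, disk_lt_1. }
  rewrite (lin_coef_eq h psi c E); exact E.
Qed.

(** Uniform continuity of the inverse map on bounded sets of coefficients; for equal coefficients it
    is injectivity. *)
Lemma centralizer_close (phi : disk -> disk) (h : disk -> C) (B r eps : R) :
  parabolic phi -> koenigs_function phi h -> 0 <= B -> r < 1 -> 0 < eps ->
  exists eta, 0 < eta /\ forall psi1 psi2, in_centralizer phi psi1 -> in_centralizer phi psi2 ->
    Cmod (lin_coef h psi1) <= B -> Cmod (lin_coef h psi2) <= B ->
    Cmod (lin_coef h psi1 - lin_coef h psi2) <= eta ->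
    forall z : disk, Cmod z <= r -> Cmod (psi1 z - psi2 z) <= eps.
Proof.
  intros P K PB Hr He.
  assert (LC := lin_coef_spec phi h P K).
  destruct P as [Hphi _].
  destruct (koenigs_extension phi h Hphi K) as (Phi & H & V & s & M & EPhi & EH).
  destruct (commuting_maps_close M B r eps PB Hr He) as [eta [Pe Ke]].
  exists eta; split; [exact Pe |].
  intros psi1 psi2 C1 C2 B1 B2 Hd z Hz.
  destruct (commuting_extension phi psi1 Phi EPhi C1) as [P1 [E1 D1]].
  destruct (commuting_extension phi psi2 Phi EPhi C2) as [P2 [E2 D2]].
  rewrite E1, E2; apply (Ke P1 P2 (lin_coef h psi1) (lin_coef h psi2)); auto.
  - intros w Hw; assert (A := LC psi1 C1 (exist _ w Hw)); rewrite !EH, E1 in A; exact A.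
  - intros w Hw; assert (A := LC psi2 C2 (exist _ w Hw)); rewrite !EH, E2 in A; exact A.
Qed.

Lemma lin_coef_injective (phi : disk -> disk) (h : disk -> C) (psi1 psi2 : centralizer phi) :
  parabolic phi -> koenigs_function phi h -> lin_coef h psi1 = lin_coef h psi2 -> psi1 = psi2.
Proof.
  intros P K E.
  destruct psi1 as [f Hf], psi2 as [g Hg]; unfold centralizer_fun in E; simpl in E.
  assert (Efg : f = g).
  { apply functional_extensionality; intros z; apply disk_eq, Cmod_sub_eq_0, le_epsilon.
    intros eps He.
    destruct (centralizer_close phi h (Cmod (lin_coef h f)) (Cmod z) eps P K (Cmod_ge_0 _)
      (disk_lt_1 z) He) as [eta [Pe Ke]].
    rewrite Rplus_0_l; apply Ke; auto; try lra.
    - rewrite E; lra.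
    - rewrite E, Cmod_sub_self; lra. }
  subst g; f_equal; apply proof_irrelevance.
Qed.

Lemma in_centralizer_comp (phi psi1 psi2 : disk -> disk) :
  in_centralizer phi psi1 -> in_centralizer phi psi2 -> in_centralizer phi (fun z => psi1 (psi2 z)).
Proof.
  intros [H1 C1] [H2 C2]; split; [| intros z; rewrite C2, C1; reflexivity].
  destruct H1 as [F1 [E1 D1]]; destruct H2 as [F2 [E2 D2]].
  exists (fun z => F1 (F2 z)); split.
  - intros z; rewrite E1, E2; reflexivity.
  - intros z; apply (ex_derive_C_comp F1 F2); [| apply D2].
    rewrite <- E2; apply D1.
Qed.

Lemma in_centralizer_iter (phi : disk -> disk) (n : nat) :
  holomorphic_self_map phi -> in_centralizer phi (Nat.iter n phi).
Proof.
  intros H; induction n as [| n IH].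
  - exact (in_centralizer_id phi).
  - apply (in_centralizer_comp phi phi (Nat.iter n phi)); [| exact IH].
    split; [exact H | reflexivity].
Qed.

(** The maps with coefficients [b n] form a Cauchy sequence at each point by [commuting_maps_close];
    the limit inherits commutation and coefficient by continuity once it is known to map into the
    open disc. *)
Lemma centralizer_limit {phi h V s} (M : koenigs_model phi h V s) (c : C) :
  (forall eps, 0 < eps -> exists f b, commuting_map phi f /\
     (forall z, Cmod z < 1 -> h (f z) = (h z + b)%C) /\ Cmod (b - c) < eps) ->
  exists F, commuting_map phi F /\ (forall z, Cmod z < 1 -> h (F z) = (h z + c)%C).
Proof.
  intros Hex.
  destruct (choice (fun n (p : (C -> C) * C) => commuting_map phi (fst p) /\
     (forall z, Cmod z < 1 -> h (fst p z) = (h z + snd p)%C) /\ Cmod (snd p - c) < / (INR n + 1)))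
    as [p Hp].
  { intros n; destruct (Hex (/ (INR n + 1))) as (f & b & H).
    - apply Rinv_0_lt_compat; assert (A := pos_INR n); lra.
    - exists (f, b); exact H. }
  set (f := fun n => fst (p n)); set (b := fun n => snd (p n)).
  assert (Hf : forall n, commuting_map phi (f n)) by (intros n; apply (Hp n)).
  assert (Hb : forall n z, Cmod z < 1 -> h (f n z) = (h z + b n)%C) by (intros n; apply (Hp n)).
  assert (Lb : tends_to b c).
  { intros eps He; destruct (INR_unbounded (/ eps)) as [N HN]; exists N; intros n Hn.
    destruct (Hp n) as (_ & _ & H); apply Rlt_trans with (1 := H).
    apply le_INR in Hn; assert (Pe := Rinv_0_lt_compat _ He).
    rewrite <- (Rinv_inv eps); apply Rinv_lt_contravar; [apply Rmult_lt_0_compat |]; lra. }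
  set (B := Cmod c + 1).
  assert (PB : 0 <= B) by (unfold B; assert (A := Cmod_ge_0 c); lra).
  assert (Bb : forall n, Cmod (b n) <= B).
  { intros n; destruct (Hp n) as (_ & _ & H); fold (b n) in H.
    assert (A := Cmod_sub_ge (b n) c); assert (PI := pos_INR n).
    assert (/ (INR n + 1) <= / 1) by (apply Rinv_le_contravar; lra).
    rewrite Rinv_1 in *; unfold B; lra. }
  assert (Lim : forall z, exists l, Cmod z < 1 -> tends_to (fun n => f n z) l).
  { intros z; destruct (Rlt_le_dec (Cmod z) 1) as [Hz | Hz]; [| exists (RtoC 0); lra].
    destruct (C_complete (fun n => f n z)) as [l Hl]; [| exists l; intros _; exact Hl].
    intros eps He.
    destruct (commuting_maps_close M B (Cmod z) (eps / 2) PB Hz ltac:(lra)) as [eta [Pe Ke]].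
    destruct (Lb (eta / 2) ltac:(lra)) as [N HN]; exists N; intros n m Hn Hm.
    apply Rle_lt_trans with (eps / 2); [| lra].
    apply (Ke (f n) (f m) (b n) (b m)); auto; [| lra].
    assert (A1 := HN n Hn); assert (A2 := HN m Hm); rewrite Cmod_sub_sym in A2.
    assert (A := Cmod_sub_triangle (b n) c (b m)); lra. }
  destruct (choice _ Lim) as [F HF].
  assert (D1 : forall n, holo_disc (f n) 0 1) by (intros n; apply (Hf n)).
  assert (D2 : forall n z, Cmod z < 1 -> Cmod (f n z) < 1) by (intros n; apply (Hf n)).
  destruct (image_absorbs_disc M (B + 2)) as [N HN].
  assert (I0 : image h V (0 + RtoC (INR N))%C) by (apply HN; [rewrite Cmod_0; lra | lia]).
  assert (Ic : image h V (RtoC (INR N) + c)%C).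
  { rewrite Cplus_comm; apply HN; [unfold B; lra | lia]. }
  set (a := s (0 + RtoC (INR N))%C).
  assert (Ha : Cmod a < 1) by (apply (km_V_disc M), (image_s M), I0).
  (* At [a] the limit is explicit and lies in [V]; this is the inner value that rules out a
     degenerate limit. *)
  assert (Fa : F a = s (RtoC (INR N) + c)%C).
  { apply (tends_to_unique (fun n => f n a)); [apply HF, Ha |].
    apply (tends_to_ext (fun n => s (RtoC (INR N) + b n)%C)).
    - intros n; unfold a; rewrite (commuting_on_discs M (f n) (b n) N); auto.
      + f_equal; ring.
      + intros w m Hw Hm; apply HN; [specialize (Bb n); lra | exact Hm].
      + rewrite Cmod_0; lra.
    - apply (tends_to_map s); [apply (ex_derive_s M), Ic | apply tends_to_plus, Lb]. }
  assert (DF : holo_disc F 0 1).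
  { apply (holo_disc_limit f F D1); [| exact HF].
    intros n z Hz; apply Rlt_le, D2, Hz. }
  assert (F1 : forall z, Cmod z < 1 -> Cmod (F z) < 1).
  { apply (self_map_limit_lt_1 f F a); auto.
    rewrite Fa; apply (km_V_disc M), (image_s M), Ic. }
  exists F; split; [split; [exact DF | split; [exact F1 |]] |].
  - intros z Hz; apply (tends_to_unique (fun n => f n (phi z))).
    + apply HF, (km_phi_disc M), Hz.
    + apply (tends_to_ext (fun n => phi (f n z))).
      { intros n; symmetry; apply (Hf n), Hz. }
      apply (tends_to_map phi); [| apply HF, Hz].
      apply (km_phi_holo M); rewrite Cmod_sub_0; apply F1, Hz.
  - intros z Hz; apply (tends_to_unique (fun n => h (f n z))).
    + apply (tends_to_map h); [| apply HF, Hz].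
      apply (km_h_holo M); rewrite Cmod_sub_0; apply F1, Hz.
    + apply (tends_to_ext (fun n => h z + b n)%C).
      { intros n; symmetry; apply Hb, Hz. }
      apply tends_to_plus, Lb.
Qed.

Lemma coef_set_limit (phi : disk -> disk) (h : disk -> C) (c : C) :
  parabolic phi -> koenigs_function phi h ->
  (forall eps, 0 < eps -> exists b, coef_set phi h b /\ Cmod (b - c) < eps) ->
  coef_set phi h c.
Proof.
  intros P K Hex.
  assert (LC := lin_coef_spec phi h P K).
  destruct P as [Hphi _].
  destruct (koenigs_extension phi h Hphi K) as (Phi & H & V & s & M & EPhi & EH).
  destruct (centralizer_limit M c) as (F & (DF & F1 & FC) & HF).
  { intros eps He; destruct (Hex eps He) as (b & [[psi Cpsi] ->] & Hb).
    unfold centralizer_fun in Hb; simpl in Hb.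
    destruct (commuting_extension phi psi Phi EPhi Cpsi) as [Psi [E D]].
    exists Psi, (lin_coef h psi); split; [exact D | split; [| exact Hb]].
    intros z Hz; assert (A := LC psi Cpsi (exist _ z Hz)); rewrite !EH, E in A; exact A. }
  set (psi := fun z : disk => exist (fun w => Cmod w < 1) (F z) (F1 z (disk_lt_1 z)) : disk).
  assert (Cpsi : in_centralizer phi psi).
  { split.
    - exists F; split; [reflexivity |]; intros z; apply DF; rewrite Cmod_sub_0; apply disk_lt_1.
    - intros z; apply disk_eq; rewrite EPhi.
      change (F (disk_val (phi z)) = Phi (F (disk_val z))); rewrite EPhi.
      apply FC, disk_lt_1. }
  exists (exist _ psi Cpsi); symmetry; apply lin_coef_eq; intros z.
  rewrite !EH; apply HF, disk_lt_1.
Qed.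

Theorem theorem4p8 :
  forall (phi : disk -> disk),
    parabolic phi -> zero_hyperbolic_step phi ->
  forall (h : disk -> C), koenigs_function phi h ->
    homeomorphism_onto (fun psi : centralizer phi => lin_coef h psi)
      (coef_set phi h) /\
    closed (coef_set phi h) /\
    (forall psi1 psi2 : centralizer phi,
       lin_coef h (fun z => psi1 (psi2 z)) =
       (lin_coef h psi1 + lin_coef h psi2)%C) /\
    (forall a b : C,
       coef_set phi h a -> coef_set phi h b -> coef_set phi h (a + b)%C) /\
    (forall n : nat, coef_set phi h (RtoC (INR n))).
Proof.
  intros phi P _ h K.
  assert (LC := lin_coef_spec phi h P K).
  assert (Add : forall psi1 psi2 : centralizer phi,
    lin_coef h (fun z => psi1 (psi2 z)) = (lin_coef h psi1 + lin_coef h psi2)%C).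
  { intros [f Hf] [g Hg]; apply lin_coef_eq; intros z; simpl.
    rewrite (LC f Hf), (LC g Hg); ring. }
  split; [split; [| split] | split; [| split; [exact Add | split]]].
  - intros psi; exists psi; reflexivity.
  - intros psi Q HQ.
    destruct (proj1 (locally_C_disc _ _) HQ) as [e [He KQ]].
    destruct (holomorphic_extension _ (proj1 K)) as [H [EH DH]].
    destruct (ex_derive_C_continuous H (disk_val (centralizer_fun phi psi disk0))) with (eps := e) 
      as [d [Pd Kd]]; [| exact He |].
    { apply DH; rewrite Cmod_sub_0; apply disk_lt_1. }
    (* A [locunif_ball] of radius [e] controls the points with [Cmod z <= 1 - e], which include 0 as
       long as [e <= 1]. *)
    assert (Pm : 0 < Rmin d 1) by (apply Rmin_pos; lra).
    exists (mkposreal _ Pm); intros psi' Hb; apply KQ.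
    (* The coefficient depends on the single value [f disk0], so continuity reduces to that of
       [h]. *)
    assert (L : forall f : centralizer phi, lin_coef h f = (h (f disk0) - h disk0)%C).
    { intros [f Hf]; simpl; rewrite (LC f Hf); ring. }
    rewrite !L, !EH.
    match goal with |- Cmod (?x - ?z - (?y - ?z)) < _ =>
      replace (x - z - (y - z))%C with (x - y)%C by ring end.
    apply Kd; apply Rlt_le_trans with (2 := Rmin_l d 1).
    apply Hb; simpl; rewrite Cmod_0; assert (A := Rmin_r d 1); lra.
  - set (id_elt := exist _ (fun z => z) (in_centralizer_id phi) : centralizer phi).
    set (g := fun y => epsilon (inhabits id_elt) (fun psi : centralizer phi => lin_coef h psi = y)).
    assert (Hg : forall y, coef_set phi h y -> lin_coef h (g y) = y).
    { intros y [psi E].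
      apply (epsilon_spec (inhabits id_elt) (fun psi : centralizer phi => lin_coef h psi = y)).
      exists psi; symmetry; exact E. }
    exists g; split; [| split; [exact Hg |]].
    + intros psi; apply (lin_coef_injective phi h); [exact P | exact K |].
      apply Hg; exists psi; reflexivity.
    + intros c Hc Q [e He].
      (* The radius [1 - e] is dictated by [locunif_ball], and [e / 2] turns the weak inequality
         into the strict one; coefficients within 1 of [c] are bounded by [Cmod c + 1]. *)
      destruct (centralizer_close phi h (Cmod c + 1) (1 - e) (e / 2) P K) as [eta [Pe Ke]].
      * assert (A := Cmod_ge_0 c); lra.
      * assert (A := cond_pos e); lra.
      * assert (A := cond_pos e); lra.
      * apply locally_C_disc; exists (Rmin eta 1); split; [apply Rmin_pos; lra |].
        intros b Hb Ab; apply He; intros z Hz.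
        destruct (Rmin_Rgt_l _ _ _ Hb) as [H1 H2].
        apply Rle_lt_trans with (e / 2); [| assert (A := cond_pos e); lra].
        apply Ke; try (exact (proj2_sig (g _))); try exact Hz.
        -- rewrite (Hg b Ab); assert (A := Cmod_sub_ge b c); lra.
        -- rewrite (Hg c Hc); lra.
        -- rewrite (Hg b Ab), (Hg c Hc); lra.
  (* [closed] provides that [c] has no neighbourhood avoiding the set; classically, there are
     elements of the set arbitrarily close to [c]. *)
  - intros c Hc; apply (coef_set_limit phi h c P K).
    intros eps He; apply NNPP; intros No; apply Hc.
    apply locally_C_disc; exists eps; split; [exact He |].
    intros b Hb Ab; apply No; exists b; split; assumption.
  - intros a b [psi1 ->] [psi2 ->]; rewrite <- Add.
    exists (exist _ _ (in_centralizer_comp phi psi1 psi2 (proj2_sig psi1) (proj2_sig psi2))).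
    reflexivity.
  (* The number [n] is the coefficient of the iterate of order [n] of [phi]. *)
  - intros n.
    exists (exist _ _ (in_centralizer_iter phi n (proj1 P))).
    symmetry; apply lin_coef_eq; intros z; simpl.
    destruct K as (_ & _ & Abel & _).
    induction n as [| n IH]; [simpl; ring |].
    rewrite S_INR, RtoC_plus; simpl; rewrite Abel, IH; ring.
Qed.
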